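(* For every $\bm{p}=(p_1,p_2)$ with $p_1,p_2$ positive integers, there is a constant $c=c_{\bm{p}}>0$ such that, if $Q:\mathcal{V}_{\mathrm{hex}}\to\mathbb{R}$ is $\bm{p}$-periodic and $\|Q\|_\infty\le c$, then the following hold for $H_Q=\Delta_{\mathrm{hex}}+Q$: (1) $\sigma(H_Q)$ consists of no more than four intervals. (2) If at least one of $p_1$ or $p_2$ is odd, then $\sigma(H_Q)$ consists of no more than two intervals. Moreover, gaps may only open at $0$ and $\pm1$ in the first case, and only at $0$ in the second case; that is, for every $\varepsilon>0$ there is $\delta\in(0,c]$ such that whenever $Q$ is $\bm{p}$-periodic with $\|Q\|_\infty\le\delta$, every bounded connected component of $\mathbb{R}\setminus\sigma(H_Q)$ is contained in one of the intervals $(E-\varepsilon,E+\varepsilon)$ with $E\in\{-1,0,1\}$, and, if at least one of $p_1,p_2$ is odd, is contained in $(-\varepsilon,\varepsilon)$.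
   Context: Hexagonal lattice: let $\bm{a}_1=(1,0)$ and $\bm{b}_\pm=\frac12(3,\pm\sqrt3)$ in $\mathbb{R}^2$, and let $\mathcal{V}_{\mathrm{hex}}=\{n\bm{b}_++m\bm{b}_-:n,m\in\mathbb{Z}\}\cup\{\bm{a}_1+n\bm{b}_++m\bm{b}_-:n,m\in\mathbb{Z}\}$; vertices $u,v$ are neighbors, $u\sim v$, iff their Euclidean distance is $1$ (so each vertex has three neighbors). The Laplacian $\Delta_{\mathrm{hex}}$ is the bounded self-adjoint operator on $\ell^2(\mathcal{V}_{\mathrm{hex}})$ given by $[\Delta_{\mathrm{hex}}\psi]_u=\sum_{v\sim u}\psi_v$ (the adjacency operator). A bounded function $Q:\mathcal{V}_{\mathrm{hex}}\to\mathbb{R}$ acts by multiplication, $[Q\psi]_u=Q(u)\psi_u$. $Q$ is $(p_1,p_2)$-periodic if $Q(u+p_1\bm{b}_+)=Q(u+p_2\bm{b}_-)=Q(u)$ for all $u\in\mathcal{V}_{\mathrm{hex}}$. $\sigma$ denotes spectrum. *)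

(* Defs.v *)
From HB Require Import structures.
From mathcomp Require Import all_boot all_order all_algebra.
From mathcomp Require Import all_classical all_reals all_analysis.
From mathcomp Require Export complex.

Set Implicit Arguments.
Unset Strict Implicit.
Unset Printing Implicit Defensive.

Import Order.TTheory GRing.Theory Num.Theory.
Import numFieldNormedType.Exports.

Local Open Scope classical_set_scope.
Local Open Scope ring_scope.
Local Open Scope complex_scope.

Section HexagonalLattice.
Variable R : realType.

Definition hex_a1 : R * R := (1, 0).
Definition hex_bp : R * R := (3 / 2, Num.sqrt 3 / 2).
Definition hex_bm : R * R := (3 / 2, - (Num.sqrt 3 / 2)).

Definition hex_set : set (R * R) :=
  [set hex_bp *~ nm.1 + hex_bm *~ nm.2 | nm in [set: int * int]] `|`
  [set hex_a1 + hex_bp *~ nm.1 + hex_bm *~ nm.2 | nm in [set: int * int]].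

Definition hex_vertex : Type := set_type hex_set.

(* The norm that the library puts on [R * R] is the sup norm, so the Euclidean
   distance is written out. *)
Definition edist (u v : R * R) : R :=
  Num.sqrt ((u.1 - v.1) ^+ 2 + (u.2 - v.2) ^+ 2).

Definition hex_adj (u v : hex_vertex) : Prop := edist (val u) (val v) = 1.

Lemma hex_set_translate (n m : int) (u : R * R) :
  hex_set u -> hex_set (u + hex_bp *~ n + hex_bm *~ m).
Proof.
case=> -[[i j] _ <-] /=; [left|right]; exists (i + n, j + m) => //=;
  rewrite !mulrzDr.
- by rewrite addrACA !addrA.
- rewrite -!addrA; congr (_ + _); congr (_ + _).
  by rewrite !addrA; congr (_ + _); rewrite addrC.
Qed.

Definition hex_translate (n m : int) (u : hex_vertex) : hex_vertex :=
  SigSub (mem_set (hex_set_translate n m (set_valP u))).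

Definition hex_periodic (p1 p2 : nat) (Q : hex_vertex -> R) : Prop :=
  forall u, Q (hex_translate p1%:Z 0 u) = Q u /\
            Q (hex_translate 0 p2%:Z u) = Q u.

(* The sum is over a set of three vertices; [\sum_(v \in A)] is 0 by convention
   only when infinitely many terms are nonzero. *)
Definition hex_laplacian (psi : hex_vertex -> R[i]) : hex_vertex -> R[i] :=
  fun u => \sum_(v \in [set v | hex_adj u v]) psi v.

Definition hex_schrodinger (Q : hex_vertex -> R) (psi : hex_vertex -> R[i]) :
    hex_vertex -> R[i] :=
  fun u => hex_laplacian psi u + (Q u)%:C * psi u.

End HexagonalLattice.

Section EllTwo.
Variables (R : realType) (V : choiceType).

Definition sup_norm (Q : V -> R) : \bar R :=
  ereal_sup [set (`|Q u|)%:E | u in [set: V]].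

Definition l2_sqnorm (psi : V -> R[i]) : \bar R :=
  \esum_(u in [set: V]) (Normc.normc (psi u) ^+ 2)%:E.

Definition in_l2 (psi : V -> R[i]) : Prop := (l2_sqnorm psi < +oo)%E.

Definition l2_norm (psi : V -> R[i]) : R := Num.sqrt (fine (l2_sqnorm psi)).

(* A bounded linear operator on l2(V); its values outside l2 are irrelevant. *)
Definition l2_bounded_operator (S : (V -> R[i]) -> (V -> R[i])) : Prop :=
  [/\ forall psi, in_l2 psi -> in_l2 (S psi),
      forall (a : R[i]) psi phi, in_l2 psi -> in_l2 phi ->
        forall u, S (fun v => a * psi v + phi v) u = a * S psi u + S phi u
    & exists M : R, forall psi, in_l2 psi -> l2_norm (S psi) <= M * l2_norm psi].

Definition l2_resolvent_set (T : (V -> R[i]) -> (V -> R[i])) : set R[i] :=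
  [set z | exists2 S, l2_bounded_operator S &
    forall psi, in_l2 psi -> forall u,
      T (S psi) u - z * S psi u = psi u /\
      S (fun v => T psi v - z * psi v) u = psi u].

Definition l2_spectrum (T : (V -> R[i]) -> (V -> R[i])) : set R[i] :=
  ~` l2_resolvent_set T.

(* The spectrum is real and is a union of at most [k] compact intervals;
   a single point counts as an interval. *)
Definition consists_of_at_most_intervals (k : nat) (A : set R[i]) : Prop :=
  exists2 n : nat, (n <= k)%N &
  exists2 ab : 'I_n -> R * R, (forall i, (ab i).1 <= (ab i).2) &
    A = [set x%:C | x in \bigcup_(i in [set: 'I_n]) `[(ab i).1, (ab i).2]%classic].

(* Bounded connected components of the complement in [R] of a set of reals that
   is given as a subset of [R[i]]. *)
Definition is_gap (A : set R[i]) (G : set R) : Prop :=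
  exists2 x : R, ~ A x%:C &
    G = connected_component [set y : R | ~ A y%:C] x /\ bounded_set G.

End EllTwo.

(* Main.v *)
(** Floquet-Bloch theory turns [H_Q] into Hermitian matrices of size [2 p1 p2]
    indexed by a torus of quasi-momenta; the spectrum is the union of the ranges (the
    bands) of their ordered eigenvalues, and by Weyl's inequality each band edge moves
    by [O(|Q|)]. Hence for small [Q] a gap can only open between consecutive bands that,
    for [Q = 0], do not overlap in an interval, that is, at an energy [E] such that the
    number of free eigenvalues [< E] at any quasi-momentum is at most the number of free
    eigenvalues [<= E] at any other one.

    The free eigenvalues are [+-|1 + X + Y|], with [(X, Y)] running over a translated
    grid of [p1 * p2] points of the torus. If [0 < |E| < 3] and [|E| <> 1], some
    translate has exactly one grid point on the level curve [|1 + X + Y| = |E|]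
    (resultants show that a generic point of the curve is mapped off the curve by every
    nontrivial grid rotation), and moving it across the curve makes the counts jump. If
    [|E| = 1], the level curve contains the circle [X = -1]; a grid column with an odd
    number of points crossing it does not have as many points entering as leaving. So
    only [0], [1] and [-1] are left, and only [0] if [p1] or [p2] is odd. *)
Require Import Defs.
From mathcomp Require Import all_boot all_order all_algebra.
From mathcomp Require Import all_classical all_reals all_analysis.
From mathcomp Require Import perm spectral ring lra zify.
Set Implicit Arguments.
Unset Strict Implicit.
Unset Printing Implicit Defensive.
Import Order.TTheory GRing.Theory Num.Theory.
Import numFieldNormedType.Exports.
Local Open Scope classical_set_scope.
Local Open Scope ring_scope.


Definition sqn (R : realType) (z : R[i]) : R := Normc.normc z ^+ 2.

Section Sqn.
Variable R : realType.
Implicit Types z w : R[i].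

Lemma sqnE z : (sqn z)%:C%C = z * z^*.
Proof. by rewrite -normCK /sqn rmorphXn. Qed.

Lemma sqn_ge0 z : 0 <= sqn z.
Proof. exact: sqr_ge0. Qed.

Lemma sqnM z w : sqn (z * w) = sqn z * sqn w.
Proof. by rewrite /sqn Normc.normcM exprMn. Qed.

Lemma sqn_eq0 z : (sqn z == 0) = (z == 0).
Proof.
rewrite sqrf_eq0; apply/eqP/eqP => [/Normc.eq0_normc//|->].
exact: Normc.normc0.
Qed.

Lemma sqnC (a : R) : sqn a%:C%C = a ^+ 2.
Proof.
apply: (@complexI R); rewrite sqnE conj_Creal; first by rewrite -expr2 rmorphXn.
by apply/complex_realP; exists a.
Qed.

Lemma sqnReIm z : sqn z = complex.Re z ^+ 2 + complex.Im z ^+ 2.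
Proof.
by case: z => a b; rewrite /sqn /= sqr_sqrtr // addr_ge0 ?sqr_ge0.
Qed.

Lemma sqnD z w : sqn (z + w) <= 2 * (sqn z + sqn w).
Proof.
case: z w => [a b] [c d]; rewrite !sqnReIm /=.
by have := sqr_ge0 (a - c); have := sqr_ge0 (b - d); nra.
Qed.

Lemma sqnD3 (a b c : R[i]) :
  sqn (a + b + c) <= 3 * (sqn a + sqn b + sqn c).
Proof.
case: a b c => [a1 a2] [b1 b2] [c1 c2]; rewrite !sqnReIm /=.
have := sqr_ge0 (a1 - b1); have := sqr_ge0 (a1 - c1); have := sqr_ge0 (b1 - c1).
have := sqr_ge0 (a2 - b2); have := sqr_ge0 (a2 - c2); have := sqr_ge0 (b2 - c2).
nra.
Qed.

End Sqn.

Section Hermitian.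
Variable R : realType.
Local Notation C := R[i].
Local Open Scope sesquilinear_scope.
Local Open Scope complex_scope.

Section Dim.
Variable n : nat.
Implicit Types (A B P : 'M[C]_n) (v : 'rV[C]_n).

Definition vnorm v : R := \sum_j sqn (v 0 j).

Definition qform A v : R := complex.Re ((v *m A *m v ^t*) 0 0).

Definition eigs A : seq R :=
  sort <=%O [seq complex.Re (spectral_diag A 0 i) | i <- enum 'I_n].

Definition eig A k : R := nth 0 (eigs A) k.

Lemma size_eigs A : size (eigs A) = n.
Proof. by rewrite size_sort size_map size_enum_ord. Qed.

Lemma vnormE v : (vnorm v)%:C = (v *m v ^t*) 0 0.
Proof.
rewrite mxE rmorph_sum /=; apply: eq_bigr => j _.
by rewrite !mxE sqnE.
Qed.

Lemma vnorm_ge0 v : 0 <= vnorm v.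
Proof. by apply: sumr_ge0 => j _; exact: sqn_ge0. Qed.

Lemma vnorm_eq0 v : (vnorm v == 0) = (v == 0).
Proof.
rewrite psumr_eq0; last by move=> j _; exact: sqn_ge0.
apply/allP/eqP => [H|->].
  apply/rowP => j; rewrite mxE; apply/eqP.
  by have := H j (mem_index_enum _); rewrite sqn_eq0.
by move=> j _; rewrite mxE /= sqn_eq0.
Qed.

Lemma vnorm_unitary v P : P \is unitarymx -> vnorm (v *m P) = vnorm v.
Proof.
move=> PU; apply: (@complexI R); rewrite !vnormE trmx_mul map_mxM.
by rewrite mulmxA mulmxtVK.
Qed.

Lemma eig_mono A k l : (k <= l < n)%N -> eig A k <= eig A l.
Proof.
move=> /andP[kl ln].
apply: (@sorted_leq_nth _ <=%O) => //; first exact: le_trans.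
- exact: sort_le_sorted.
- by rewrite inE size_eigs (leq_ltn_trans kl).
- by rewrite inE size_eigs.
Qed.

Lemma hermitian_diag A : A ^t* = A ->
  exists2 P, P \is unitarymx &
    A = P ^t* *m diag_mx (\row_(i < n) (eig A i)%:C) *m P.
Proof.
move=> Aherm.
have hA : A \is hermsymmx.
  by apply/is_hermitianmxP; rewrite expr0 scale1r Aherm.
have /orthomx_spectralP Aeq := hermitian_normalmx hA.
have dR := hermitian_spectral_diag_real hA.
set d := spectral_diag A in Aeq dR *; set U := spectralmx A in Aeq.
have UU : U \is unitarymx by exact: spectral_unitarymx.
pose t := [tuple complex.Re (d 0 i) | i < n].
have st : size (eigs A) == n by rewrite size_eigs.
have : perm_eq (Tuple st) t by rewrite /= /eigs perm_sort /t /= enumT.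
case/tuple_permP => s es.
have eE (i : 'I_n) : (eig A i)%:C = d 0 (s i).
  rewrite /eig [eigs A]es (nth_map i) ?size_enum_ord// nth_ord_enum.
  by rewrite tnth_mktuple RRe_real// (mxOverP dR).
exists (row_perm s U).
  apply/unitarymxP/matrixP => i j; rewrite !mxE.
  have /unitarymxP/matrixP/(_ (s i) (s j)) := UU; rewrite !mxE (inj_eq perm_inj).
  by move=> <-; apply: eq_bigr => k _; rewrite !mxE.
rewrite {1}Aeq (invmx_unitary UU); apply/matrixP => i j.
rewrite [LHS]mxE [RHS]mxE (reindex_inj (@perm_inj _ s)); apply: eq_bigr => k _.
by rewrite !mul_mx_diag !mxE eE.
Qed.

Lemma char_poly_conj A P : P \in unitmx ->
  char_poly (invmx P *m A *m P) = char_poly A.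
Proof.
move=> Pu; rewrite /char_poly /char_poly_mx.
have Qu : map_mx polyC P \in unitmx by rewrite map_unitmx.
have -> : 'X%:M - map_mx polyC (invmx P *m A *m P) =
    invmx (map_mx polyC P) *m ('X%:M - map_mx polyC A) *m map_mx polyC P.
  rewrite mulmxBr mulmxBl !map_mxM /= map_invmx; congr (_ - _).
  by rewrite mul_mx_scalar -scalemxAl mulVmx// scalemx1.
by rewrite !det_mulmx det_inv mulrAC mulVr ?mul1r// -unitmxE.
Qed.

Lemma eigs_similar A P (d : 'I_n -> R) : A ^t* = A -> P \in unitmx ->
    P *m A = diag_mx (\row_(i < n) (d i)%:C) *m P ->
  perm_eq (eigs A) [seq d i | i <- enum 'I_n].
Proof.
move=> Ah Pu PA.
have [U UU AE] := hermitian_diag Ah.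
have diag_charpoly (e : 'I_n -> R) : char_poly (diag_mx (\row_(i < n) (e i)%:C)) =
    \prod_(x <- [seq (e i)%:C | i <- enum 'I_n]) ('X - x%:P).
  rewrite char_poly_trig ?diag_mx_is_trig// big_map big_enum.
  by apply: eq_bigr => i _; rewrite !mxE eqxx.
have Uu := unitarymx_unit UU.
have : char_poly A = char_poly (diag_mx (\row_(i < n) (eig A i)%:C)).
  by rewrite {1}AE -(invmx_unitary UU); exact: char_poly_conj.
have -> : char_poly A = char_poly (diag_mx (\row_(i < n) (d i)%:C)).
  have -> : A = invmx P *m diag_mx (\row_(i < n) (d i)%:C) *m P.
    by rewrite -mulmxA -PA mulKmx.
  exact: char_poly_conj.
rewrite !diag_charpoly => /prod_XsubC_eq /(perm_map (@complex.Re R)).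
rewrite -!map_comp perm_sym => /perm_trans H.
rewrite (_ : eigs A = [seq ((@complex.Re R) \o (fun i : 'I_n => (eig A i)%:C)) i | i <- enum 'I_n]).
  by rewrite !enumT; exact: (H _ (perm_refl _)).
apply: (@eq_from_nth _ 0).
  by rewrite size_eigs size_map size_enum_ord.
rewrite size_eigs => i ni.
by rewrite (nth_map (Ordinal ni)) ?size_enum_ord//= nth_enum_ord.
Qed.

Lemma qformE A P (e : 'I_n -> R) v :
    A = P ^t* *m diag_mx (\row_(i < n) (e i)%:C) *m P ->
  qform A v = \sum_i e i * sqn ((v *m P ^t*) 0 i).
Proof.
move=> ->; set w := v *m P ^t*.
have -> : forall D, qform (P ^t* *m D *m P) v = complex.Re ((w *m D *m w ^t*) 0 0).
  by move=> D; rewrite /qform /w trmx_mul map_mxM trmxCK !mulmxA.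
rewrite mxE; have -> : \sum_j (w *m diag_mx (\row_(i < n) (e i)%:C)) 0 j * (w ^t*) j 0 =
    (\sum_i e i * sqn (w 0 i))%:C.
  rewrite rmorph_sum /=; apply: eq_bigr => i _.
  by rewrite mul_mx_diag rmorphM /= sqnE !mxE; ring.
by [].
Qed.

Lemma vnormP P v : P \is unitarymx -> vnorm v = \sum_i sqn ((v *m P ^t*) 0 i).
Proof.
move=> PU; rewrite -[RHS]/(vnorm (v *m P ^t*)); symmetry.
by apply: vnorm_unitary; rewrite trmxC_unitary.
Qed.

Lemma weyl A B (delta : R) k : A ^t* = A -> B ^t* = B -> (k < n)%N ->
    (forall v, qform A v <= qform B v + delta * vnorm v) ->
  eig A k <= eig B k + delta.
Proof.
move=> Ah Bh kn AB.
have [P PU AE] := hermitian_diag Ah; have [Q QU BE] := hermitian_diag Bh.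
pose K := kermx (P ^t* *m (pid_mx k : 'M[C]_n)).
pose L := (pid_mx k.+1 : 'M[C]_n) *m Q.
have rK : (n - k <= \rank K)%N.
  by rewrite mxrank_ker leq_sub2l// (leq_trans (mxrankM_maxr _ _))// rank_pid_mx// ltnW.
have rL : \rank L = k.+1.
  by rewrite mxrankMfree ?rank_pid_mx// row_free_unit unitarymx_unit.
have : (K :&: L)%MS != 0.
  rewrite -mxrank_eq0 -lt0n; have := mxrank_sum_cap K L; rewrite rL.
  have := rank_leq_col (K + L)%MS; lia.
case/rowV0Pn => v; rewrite sub_capmx => /andP[/sub_kermxP vK /submxP[w vL]] v0.
have vp : 0 < vnorm v by rewrite lt_neqAle eq_sym vnorm_eq0 v0 vnorm_ge0.
have lowA (i : 'I_n) : (i < k)%N -> (v *m P ^t*) 0 i = 0.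
  move=> ik; move/rowP/(_ i): vK; rewrite mulmxA [X in _ = X]mxE => <-.
  rewrite [RHS]mxE (bigD1 i)//= [pid_mx k i i]mxE eqxx ik mulr1 big1 ?addr0// => j ji.
  by rewrite [pid_mx k j i]mxE (negPf (_ : val j != val i)) ?mulr0.
have highB (i : 'I_n) : (k < i)%N -> (v *m Q ^t*) 0 i = 0.
  move=> ki; rewrite vL /L mulmxA mulmxtVK// mxE big1// => j _.
  by rewrite [pid_mx _ _ _]mxE; case: eqP => [->|]; rewrite ?mulr0// ltnS leqNgt ki mulr0.
rewrite -(ler_pM2r vp).
apply: (@le_trans _ _ (qform A v)).
  rewrite (qformE v AE) (vnormP v PU) mulr_sumr; apply: ler_sum => i _.
  have [ik|ki] := ltnP i k; first by rewrite lowA// /sqn Normc.normc0 expr0n !mulr0.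
  by rewrite ler_wpM2r ?sqn_ge0// eig_mono// ki /=.
rewrite mulrDl (le_trans (AB v))// lerD2r.
rewrite (qformE v BE) (vnormP v QU) mulr_sumr; apply: ler_sum => i _.
have [ki|ik] := ltnP k i; first by rewrite highB// /sqn Normc.normc0 expr0n !mulr0.
by rewrite ler_wpM2r ?sqn_ge0// eig_mono// ik.
Qed.

Lemma eig_eigenvector A k : A ^t* = A -> (k < n)%N ->
  exists2 v : 'rV[C]_n, v != 0 & v *m A = (eig A k)%:C *: v.
Proof.
move=> Ah kn; have [P PU AE] := hermitian_diag Ah.
exists (row (Ordinal kn) P).
  rewrite -vnorm_eq0; have -> : row (Ordinal kn) P = delta_mx 0 (Ordinal kn) *m P by exact: rowE.
  rewrite vnorm_unitary// vnorm_eq0; apply/eqP => /rowP/(_ (Ordinal kn)) /eqP.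
  by rewrite !mxE !eqxx oner_eq0.
have PA : P *m A = diag_mx (\row_(i < n) (eig A i)%:C) *m P.
  by rewrite {1}AE !mulmxA (unitarymxP PU) mul1mx.
rewrite rowE -mulmxA PA mulmxA scalemxAl; congr (_ *m P); apply/rowP => j.
rewrite mul_mx_diag !mxE eqxx /= eq_sym.
by case: (Ordinal kn =P j) => [<-|_]; rewrite ?mul1r ?mulr1// mul0r mulr0.
Qed.

Lemma eig_ltE A k E : (k < n)%N -> (eig A k < E) = (k < count (< E)%R (eigs A))%N.
Proof.
move=> kn; have ss : sorted <=%O (eigs A) by exact: sort_le_sorted.
apply/idP/idP; last exact: nth_count_lt.
apply: contraLR; rewrite -leqNgt -leNgt => h.
by apply: nth_count_ge => //; rewrite h size_eigs.
Qed.

Lemma eig_leE A k E : (k < n)%N -> (eig A k <= E) = (k < count (<= E)%R (eigs A))%N.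
Proof.
move=> kn; have ss : sorted <=%O (eigs A) by exact: sort_le_sorted.
apply/idP/idP; last exact: nth_count_le.
apply: contraLR; rewrite -leqNgt -ltNge => h.
by apply: nth_count_gt => //; rewrite h size_eigs.
Qed.

Lemma vnorm_contraction A v (a b s q : R) : A ^t* = A -> 0 <= q ->
    (forall k, (k < n)%N -> `|1 - ((eig A k - a) ^+ 2 + b ^+ 2) / s| <= q) ->
  vnorm (v - (s^-1)%:C *: (v *m (A - a%:C%:M) *m (A - a%:C%:M) + (b ^+ 2)%:C *: v))
    <= q ^+ 2 * vnorm v.
Proof.
move=> Ah q0 eq; have [P PU AE] := hermitian_diag Ah.
pose D : 'M[C]_n := diag_mx (\row_(i < n) (eig A i)%:C).
set u := _ - _.
have uE : u *m P ^t* = (v *m P ^t*) *m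
    diag_mx (\row_(i < n) (1 - ((eig A i - a) ^+ 2 + b ^+ 2) / s)%:C).
  have AP : A *m P ^t* = P ^t* *m D.
    by rewrite {1}AE (mulmxtVK _ PU).
  have APa : (A - a%:C%:M) *m P ^t* = P ^t* *m (D - a%:C%:M).
    by rewrite mulmxBl AP mulmxBr scalar_mxC.
  have vAA : v *m (A - a%:C%:M) *m (A - a%:C%:M) *m P ^t* =
      v *m P ^t* *m (D - a%:C%:M) *m (D - a%:C%:M).
    by rewrite -(mulmxA (v *m _)) APa mulmxA -(mulmxA v (A - _)) APa mulmxA.
  rewrite /u mulmxBl -scalemxAl mulmxDl vAA -scalemxAl.
  move: (v *m P ^t*) => w.
  apply/rowP => i; rewrite mul_mx_diag mxE.
  have wD (x : 'rV[C]_n) : (x *m (D - a%:C%:M)) 0 i = x 0 i * (eig A i - a)%:C.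
    by rewrite mulmxBr mul_mx_diag mul_mx_scalar !mxE rmorphB /=; ring.
  have lin (x y z : 'rV[C]_n) c d :
    (x - c *: (y + d *: z)) 0 i = x 0 i - c * (y 0 i + d * z 0 i) by rewrite !mxE.
  have cE (t : R) : (1 - (t ^+ 2 + b ^+ 2) / s)%:C =
      1 - (s^-1)%:C * (t%:C * t%:C + (b ^+ 2)%:C).
    by apply/eqP; rewrite eq_complex /=; apply/andP; split; apply/eqP; ring.
  by rewrite lin !wD [X in _ = _ * X]mxE cE; ring.
rewrite (vnormP u PU) (vnormP v PU) uE mulr_sumr; apply: ler_sum => i _.
move: (v *m P ^t*) => w; rewrite mul_mx_diag.
rewrite [X in sqn X]mxE [X in w 0 i * X]mxE sqnM sqnC mulrC.
rewrite ler_wpM2r ?sqn_ge0//.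
by rewrite -ler_sqrt ?exprn_ge0// !sqrtr_sqr (ger0_norm q0) eq.
Qed.

End Dim.
End Hermitian.

Lemma sqnN (R : realType) (z : R[i]) : sqn (- z) = sqn z.
Proof. by case: z => a b; rewrite !sqnReIm /= !sqrrN. Qed.

Section L2.
Variables (R : realType) (V : choiceType).
Local Notation C := R[i].
Implicit Types (psi phi : V -> C).
Local Open Scope complex_scope.

Definition l2le psi (B : R) : Prop :=
  forall s : seq V, uniq s -> \sum_(u <- s) sqn (psi u) <= B.

Lemma l2le_ge0 psi B : l2le psi B -> 0 <= B.
Proof. by move=> /(_ [::] isT); rewrite big_nil. Qed.

Lemma l2le_pt psi B u : l2le psi B -> sqn (psi u) <= B.
Proof. by move=> /(_ [:: u] isT); rewrite big_seq1. Qed.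

Lemma l2leW psi B B' : B <= B' -> l2le psi B -> l2le psi B'.
Proof. by move=> BB' h s us; apply: le_trans (h _ us) BB'. Qed.

Lemma l2_sqnorm_leE psi B : l2le psi B <-> (l2_sqnorm psi <= B%:E)%E.
Proof.
split=> [h|h s us].
  apply: ge_ereal_sup => _ [A [fA _] <-].
  by rewrite fsbig_finite//= sumEFin lee_fin h// finmap.fset_uniq.
rewrite -lee_fin -sumEFin; apply: le_trans h; apply: esum_ge.
exists [set` s]; first by split=> //; exact: finite_seq.
by rewrite -fsbig_seq.
Qed.

Lemma in_l2P psi : in_l2 psi <-> exists B, l2le psi B.
Proof.
split=> [h|[B /l2_sqnorm_leE h]]; last exact: le_lt_trans h (ltry _).
exists (fine (l2_sqnorm psi)); apply/l2_sqnorm_leE; rewrite fineK//.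
rewrite ge0_fin_numE//; apply: esum_ge0 => u _.
by rewrite lee_fin sqn_ge0.
Qed.

Lemma l2_sqnorm_ge0 psi : 0 <= fine (l2_sqnorm psi).
Proof.
apply/fine_ge0/esum_ge0 => u _; by rewrite lee_fin sqn_ge0.
Qed.

Lemma l2le_norm psi : in_l2 psi -> l2le psi (l2_norm psi ^+ 2).
Proof.
move=> h; apply/l2_sqnorm_leE; rewrite sqr_sqrtr ?l2_sqnorm_ge0//.
rewrite fineK// ge0_fin_numE//; apply: esum_ge0 => u _.
by rewrite lee_fin sqn_ge0.
Qed.

Lemma l2_norm_le psi M : 0 <= M -> l2le psi (M ^+ 2) -> l2_norm psi <= M.
Proof.
move=> M0 h; rewrite /l2_norm -[leRHS](ger0_norm M0) -sqrtr_sqr ler_sqrt ?sqr_ge0//.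
rewrite -lee_fin fineK; first exact/l2_sqnorm_leE.
rewrite ge0_fin_numE; first by apply/in_l2P; exists (M ^+ 2).
by apply: esum_ge0 => u _; rewrite lee_fin sqn_ge0.
Qed.

Lemma l2leD psi phi B B' : l2le psi B -> l2le phi B' ->
  l2le (fun u => psi u + phi u) (2 * (B + B')).
Proof.
move=> h h' s us; rewrite (@le_trans _ _ (\sum_(u <- s) 2 * (sqn (psi u) + sqn (phi u))))//.
  by apply: ler_sum => u _; exact: sqnD.
by rewrite -mulr_sumr big_split ler_wpM2l// lerD// ?h ?h'.
Qed.

Lemma l2leZ (a : C) psi B : l2le psi B -> l2le (fun u => a * psi u) (sqn a * B).
Proof.
move=> h s us; under eq_bigr do rewrite sqnM.
by rewrite -mulr_sumr ler_wpM2l ?sqn_ge0// h.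
Qed.

Section Neumann.
Variables (K : (V -> C) -> V -> C) (q : R).
Hypothesis q01 : 0 < q < 1.
Hypothesis K_lin : forall a psi phi,
  K (fun u => a * psi u + phi u) = (fun u => a * K psi u + K phi u).
Hypothesis K_bnd : forall psi B, l2le psi B -> l2le (K psi) (q ^+ 2 * B).
(* Continuity for pointwise convergence, as enjoyed by operators of finite range. *)
Hypothesis K_cvg : forall (psi_ : nat -> V -> C) psi,
  (forall u, sqn (psi_ n u - psi u) @[n --> \oo] --> (0 : R)) ->
  forall u, sqn (K (psi_ n) u - K psi u) @[n --> \oo] --> (0 : R).

Lemma contraction_fix0 psi B : l2le psi B -> K psi = psi -> forall u, psi u = 0.
Proof.
move=> h Kpsi u; have [q0 q1] := andP q01.
have hn n : l2le psi ((q ^+ 2) ^+ n * B).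
  elim: n => [|n IH]; first by rewrite mul1r.
  by rewrite exprS -mulrA -Kpsi; apply: K_bnd.
apply/eqP; rewrite -sqn_eq0 eq_le sqn_ge0 andbT.
have : (q ^+ 2) ^+ n * B @[n --> \oo] --> (0 * B : R).
  apply: cvgMl; apply: cvg_expr.
  by rewrite ger0_norm ?sqr_ge0// expr_lt1// ltW.
rewrite mul0r => cv; rewrite -(cvg_lim _ cv)//.
apply: limr_ge; first by apply/cvg_ex; exists 0.
by near=> n; exact: l2le_pt (hn n).
Unshelve. all: by end_near. Qed.

Let part psi n := iter n (fun phi u => K phi u + psi u) (fun=> 0).

Lemma sqnD_weight (z w : C) : sqn (z + w) <= sqn z / q + sqn w / (1 - q).
Proof.
have [q0 q1] := andP q01.
have q1' : 0 < 1 - q by rewrite subr_gt0.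
rewrite -(ler_pM2r (mulr_gt0 q0 q1')) mulrDl.
have -> : sqn z / q * (q * (1 - q)) = sqn z * (1 - q) by field; rewrite gt_eqF.
have -> : sqn w / (1 - q) * (q * (1 - q)) = sqn w * q by field; rewrite gt_eqF.
case: z w => [a b] [c d]; rewrite !sqnReIm /=.
have := sqr_ge0 ((1 - q) * a - q * c); have := sqr_ge0 ((1 - q) * b - q * d).
nra.
Qed.

Lemma part_bnd psi B n : l2le psi B -> l2le (part psi n) (B / (1 - q) ^+ 2).
Proof.
have [q0 q1] := andP q01; have q1' : 0 < 1 - q by rewrite subr_gt0.
move=> h; have B0 := l2le_ge0 h.
elim: n => [|n IH] s us.
  rewrite big1 => [|u _]; first by rewrite divr_ge0// sqr_ge0.
  by apply/eqP; rewrite sqn_eq0.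
rewrite /= (@le_trans _ _ (\sum_(u <- s) (sqn (K (part psi n) u) / q + sqn (psi u) / (1 - q))))//.
  by apply: ler_sum => u _; exact: sqnD_weight.
rewrite big_split/= -!mulr_suml.
have -> : B / (1 - q) ^+ 2 = q ^+ 2 * (B / (1 - q) ^+ 2) / q + B / (1 - q).
  by field; rewrite !gt_eqF.
by apply: lerD; apply: ler_wpM2r; rewrite ?invr_ge0 ?(ltW q0) ?(ltW q1') ?h//;
  exact: (K_bnd IH).
Qed.

Lemma neumann psi B : l2le psi B ->
  exists2 phi, l2le phi (B / (1 - q) ^+ 2) & forall u, phi u - K phi u = psi u.
Proof.
move=> h; have B0 := l2le_ge0 h; have [q0 q1] := andP q01.
pose d n u := part psi n.+1 u - part psi n u.
have dS n : d n.+1 = K (d n).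
  rewrite /d (_ : (fun u => part psi n.+1 u - part psi n u) =
    (fun u => -1 * part psi n u + part psi n.+1 u)).
    by rewrite K_lin; apply/funext => u; rewrite /=; ring.
  by apply/funext => u; ring.
have d0 : d 0%N = psi.
  have K0 : K (fun=> 0) = fun=> 0.
    have := K_lin (-1) (fun=> 0) (fun=> 0).
    rewrite (_ : (fun _ : V => _) = (fun=> 0)); last by apply/funext => u; ring.
    by move=> e; apply/funext => u; rewrite e; ring.
  by apply/funext => u; rewrite /d /= K0; ring.
have db n : l2le (d n) ((q ^+ 2) ^+ n * B).
  elim: n => [|n IH]; first by rewrite mul1r d0.
  by rewrite exprS -mulrA dS; apply: K_bnd.
have dsqrt n u : Num.sqrt (sqn (d n u)) <= Num.sqrt B * q ^+ n.
  rewrite (le_trans (ler_wsqrtr (l2le_pt u (db n))))// exprAC mulrC sqrtrM//.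
  by rewrite sqrtr_sqr ger0_norm// exprn_ge0// ltW.
have scvg (f : nat -> R) : (forall n, `|f n| <= Num.sqrt B * q ^+ n) -> cvgn (series f).
  move=> fb; apply: normed_cvg.
  apply: (@series_le_cvg _ _ (geometric (Num.sqrt B) q)) => //=.
    by move=> n; rewrite mulr_ge0 ?sqrtr_ge0// exprn_ge0// ltW.
  by apply: is_cvg_geometric_series; rewrite ger0_norm// ltW.
have Reb (z : C) : `|complex.Re z| <= Num.sqrt (sqn z).
  by rewrite -sqrtr_sqr ler_wsqrtr// sqnReIm lerDl sqr_ge0.
have Imb (z : C) : `|complex.Im z| <= Num.sqrt (sqn z).
  by rewrite -sqrtr_sqr ler_wsqrtr// sqnReIm lerDr sqr_ge0.
have partS n u : part psi n.+1 u = part psi n u + d n u by rewrite /d; ring.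
have partRe n u : complex.Re (part psi n u) = series (fun n => complex.Re (d n u)) n.
  elim: n => [|n IH]; first by rewrite /series /= big_geq.
  by rewrite seriesSr partS -IH; case: (part psi n u) (d n u) => [? ?] [? ?].
have partIm n u : complex.Im (part psi n u) = series (fun n => complex.Im (d n u)) n.
  elim: n => [|n IH]; first by rewrite /series /= big_geq.
  by rewrite seriesSr partS -IH; case: (part psi n u) (d n u) => [? ?] [? ?].
have cvRe u : cvgn (fun n => complex.Re (part psi n u)).
  under eq_fun do rewrite partRe.
  by apply: scvg => n; apply: le_trans (Reb _) (dsqrt _ _).
have cvIm u : cvgn (fun n => complex.Im (part psi n u)).
  under eq_fun do rewrite partIm.
  by apply: scvg => n; apply: le_trans (Imb _) (dsqrt _ _).
pose phi u : C := (limn (fun n => complex.Re (part psi n u))) +i*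
                  (limn (fun n => complex.Im (part psi n u))).
have sqncv u : sqn (part psi n u) @[n --> \oo] --> sqn (phi u).
  under eq_fun do rewrite sqnReIm; rewrite sqnReIm /phi.
  by apply: cvgD; rewrite expr2; under eq_fun do rewrite expr2; apply: cvgM.
have sqncv0 u : sqn (part psi n u - phi u) @[n --> \oo] --> (0 : R).
  have E z : sqn (z - phi u) = (complex.Re z - complex.Re (phi u)) ^+ 2
      + (complex.Im z - complex.Im (phi u)) ^+ 2.
    by rewrite sqnReIm; case: z (phi u) => [? ?] [? ?].
  under eq_fun do rewrite E.
  have -> : (0 : R) = (complex.Re (phi u) - complex.Re (phi u)) ^+ 2
      + (complex.Im (phi u) - complex.Im (phi u)) ^+ 2 by ring.
  by apply: cvgD; rewrite [X in _ --> X]expr2; under eq_fun do rewrite expr2;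
    apply: cvgM; apply: cvgB => //; exact: cvg_cst.
exists phi.
  move=> s us.
  have sumcv (t : seq V) : \sum_(u <- t) sqn (part psi n u) @[n --> \oo] -->
      \sum_(u <- t) sqn (phi u).
    elim: t => [|a t IH].
      by rewrite big_nil; under eq_fun do rewrite big_nil; exact: cvg_cst.
    by rewrite big_cons; under eq_fun do rewrite big_cons; exact: cvgD.
  rewrite -(cvg_lim _ (sumcv s))//; apply: limr_le.
    by apply/cvg_ex; exists (\sum_(u <- s) sqn (phi u)).
  by near=> n; apply: part_bnd.
move=> u; apply/eqP; rewrite -subr_eq0 -sqn_eq0 eq_le sqn_ge0 andbT.
pose e n : R := 2 * (sqn (part psi n.+1 u - phi u) + sqn (K (part psi n) u - K phi u)).
have ecv : e n @[n --> \oo] --> (0 : R).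
  rewrite -[X in _ --> X](mulr0 2) -[X in 2 * X](addr0 0).
  apply: cvgMr; apply: cvgD; last exact: K_cvg.
  by have := sqncv0 u; rewrite -(cvg_shiftS (fun n => sqn (part psi n u - phi u))).
rewrite -(cvg_lim _ ecv)//; apply: limr_ge; first by apply/cvg_ex; exists 0.
near=> n; rewrite /e -(sqnN (_ - phi u)).
by apply: le_trans (sqnD _ _); rewrite le_eqVlt; apply/orP; left; apply/eqP; congr sqn => /=; ring.
Unshelve. all: by end_near. Qed.

End Neumann.

Section Resolvent.
Variables (T : (V -> C) -> V -> C) (c a b s q : R).
Hypothesis q01 : 0 < q < 1.
Hypothesis T_lin : forall (d : C) psi phi,
  T (fun u => d * psi u + phi u) = (fun u => d * T psi u + T phi u).
Hypothesis T_bnd : forall psi B, l2le psi B -> l2le (T psi) (c * B).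
Hypothesis T_cvg : forall (psi_ : nat -> V -> C) psi,
  (forall u, sqn (psi_ n u - psi u) @[n --> \oo] --> (0 : R)) ->
  forall u, sqn (T (psi_ n) u - T psi u) @[n --> \oo] --> (0 : R).

Definition shift (z : C) psi : V -> C := fun u => T psi u - z * psi u.

Definition contraction psi : V -> C := fun u => psi u -
  (s^-1)%:C * (shift a%:C (shift a%:C psi) u + (b ^+ 2)%:C * psi u).

Hypothesis K_bnd : forall psi B, l2le psi B -> l2le (contraction psi) (q ^+ 2 * B).

Lemma shift_lin z (d : C) psi phi : shift z (fun u => d * psi u + phi u) =
  (fun u => d * shift z psi u + shift z phi u).
Proof. by rewrite /shift T_lin; apply/funext => u; ring. Qed.

Lemma shift_bnd z psi B : l2le psi B -> l2le (shift z psi) (2 * (c + sqn z) * B).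
Proof.
move=> h; rewrite -mulrA [X in _ * X]mulrDl.
have -> : shift z psi = (fun u => T psi u + (- z) * psi u).
  by apply/funext => u; rewrite /shift; ring.
apply: l2leD; first exact: T_bnd.
by rewrite -(sqnN z); exact: l2leZ.
Qed.

Lemma shift_cvg z (psi_ : nat -> V -> C) psi :
  (forall u, sqn (psi_ n u - psi u) @[n --> \oo] --> (0 : R)) ->
  forall u, sqn (shift z (psi_ n) u - shift z psi u) @[n --> \oo] --> (0 : R).
Proof.
move=> h u; apply: (@squeeze_cvgr _ _ _ _ (fun=> 0)
    (fun n => 2 * (sqn (T (psi_ n) u - T psi u) + sqn (- z) * sqn (psi_ n u - psi u)))).
- near=> n; rewrite sqn_ge0 /= -sqnM.
  apply: le_trans (sqnD _ _); rewrite le_eqVlt; apply/orP; left; apply/eqP.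
  by congr sqn; rewrite /shift; ring.
- exact: cvg_cst.
- rewrite -[X in _ --> X](mulr0 2) -[X in 2 * X](addr0 0) -[X in 0 + X](mulr0 (sqn (- z))).
  by apply: cvgMr; apply: cvgD; [exact: T_cvg|apply: cvgMr; exact: h].
Unshelve. all: by end_near. Qed.

Let z : C := a +i* b.

Lemma shift_conj psi u : shift z (shift z^* psi) u =
  shift a%:C (shift a%:C psi) u + (b ^+ 2)%:C * psi u.
Proof.
have E (w : C) phi : shift w phi = (fun u => - w * phi u + T phi u).
  by apply/funext => v; rewrite /shift; ring.
rewrite !E !T_lin.
have -> : z^* = a -i* b by [].
have -> : z = a%:C + b *i by apply/eqP; rewrite eq_complex /= addr0 add0r !eqxx.
have -> : a -i* b = a%:C - b *i by apply/eqP; rewrite eq_complex /= ?subr0 ?sub0r !eqxx.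
have -> : (b ^+ 2)%:C = - (b *i * b *i).
  by apply/eqP; rewrite eq_complex /=; apply/andP; split; apply/eqP; ring.
ring.
Qed.

Lemma contraction_lin (d : C) psi phi :
  contraction (fun u => d * psi u + phi u) =
  (fun u => d * contraction psi u + contraction phi u).
Proof. by rewrite /contraction !shift_lin; apply/funext => u; ring. Qed.

Lemma contraction_cvg (psi_ : nat -> V -> C) psi :
  (forall u, sqn (psi_ n u - psi u) @[n --> \oo] --> (0 : R)) ->
  forall u, sqn (contraction (psi_ n) u - contraction psi u) @[n --> \oo] --> (0 : R).
Proof.
move=> h u; pose k := (s^-1)%:C; pose l := (b ^+ 2)%:C.
have h2 := shift_cvg a%:C (shift_cvg a%:C h) u.
apply: (@squeeze_cvgr _ _ _ _ (fun=> 0)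
    (fun n => 2 * (sqn (1 - k * l) * sqn (psi_ n u - psi u) + sqn k *
       sqn (shift a%:C (shift a%:C (psi_ n)) u - shift a%:C (shift a%:C psi) u)))).
- near=> n; rewrite sqn_ge0 /= -(sqnN k) -!sqnM.
  apply: le_trans (sqnD _ _); rewrite le_eqVlt; apply/orP; left; apply/eqP.
  by congr sqn; rewrite /contraction -/k -/l; ring.
- exact: cvg_cst.
- rewrite (_ : (0 : R) = 2 * (sqn (1 - k * l) * 0 + sqn k * 0)); last by ring.
  by apply: cvgMr; apply: cvgD; apply: cvgMr.
Unshelve. all: by end_near. Qed.

Lemma shiftC (w w' : C) psi : shift w (shift w' psi) = shift w' (shift w psi).
Proof.
have E (x : C) phi : shift x phi = (fun u => - x * phi u + T phi u).
  by apply/funext => v; rewrite /shift; ring.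
by rewrite !E !T_lin; apply/funext => u; ring.
Qed.

Lemma shift0 w : shift w (fun=> 0) = fun=> 0.
Proof.
have := shift_lin w (-1) (fun=> 0) (fun=> 0).
rewrite (_ : (fun _ : V => _) = (fun=> 0)); last by apply/funext => u; ring.
by move=> e; apply/funext => u; rewrite e; ring.
Qed.

Lemma shift_inj psi B : l2le psi B -> (forall u, shift z psi u = 0) ->
  forall u, psi u = 0.
Proof.
move=> h e; apply: (contraction_fix0 q01 K_bnd h).
apply/funext => u; rewrite /contraction -shift_conj shiftC.
by rewrite (_ : shift z psi = fun=> 0) ?shift0 ?mulr0 ?subr0//; apply/funext.
Qed.

Lemma resolvent_of_contraction : l2_resolvent_set T z.
Proof.
pose D := sqn (s^-1)%:C * (2 * (c + sqn (z^*)) * (1 - q) ^- 2).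
have D0 : 0 <= D.
  have c0 : 0 <= c.
    rewrite -[c]mulr1; apply: (l2le_ge0 (T_bnd (psi := fun=> 0) _)) => t _.
    rewrite big1 ?ler01// => u _; by apply/eqP; rewrite sqn_eq0.
  rewrite /D mulr_ge0 ?sqn_ge0// mulr_ge0 ?invr_ge0 ?sqr_ge0// mulr_ge0//.
  by rewrite addr_ge0 ?sqn_ge0.
have /choice[S SP] : forall psi, exists x, in_l2 psi ->
    l2le x (D * l2_norm psi ^+ 2) /\ forall u, shift z x u = psi u.
  move=> psi; have [h|h] := pselect (in_l2 psi); last by exists psi.
  have [phi phiB phiE] := neumann q01 contraction_lin K_bnd contraction_cvg (l2le_norm h).
  exists (fun u => (s^-1)%:C * shift z^* phi u) => _; split.
    have := l2leZ (s^-1)%:C (shift_bnd (z^*) phiB); apply: l2leW.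
    by rewrite /D le_eqVlt; apply/orP; left; apply/eqP; ring.
  move=> u; rewrite -phiE.
  have -> : (fun u => (s^-1)%:C * shift z^* phi u) =
      (fun u => (s^-1)%:C * shift z^* phi u + (fun=> 0) u).
    by apply/funext => v; rewrite addr0.
  by rewrite shift_lin shift0 addr0 shift_conj /contraction; ring.
have Sl2 psi : in_l2 psi -> in_l2 (S psi).
  by move=> h; apply/in_l2P; eexists; exact: (SP _ h).1.
have inj psi phi : in_l2 psi -> in_l2 phi -> (forall u, shift z psi u = shift z phi u) ->
    forall u, psi u = phi u.
  move=> /in_l2P[B h] /in_l2P[B' h'] e u.
  have d : l2le (fun u => -1 * phi u + psi u) (2 * (sqn (-1 : C) * B' + B)).
    exact: l2leD (l2leZ _ h') h.
  have := shift_inj d; rewrite shift_lin => H.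
  apply/eqP; rewrite -subr_eq0 -(H _ u) => [|v]; last by rewrite e; ring.
  by apply/eqP; ring.
have comb_l2 (d : C) psi phi : in_l2 psi -> in_l2 phi ->
    in_l2 (fun u => d * psi u + phi u).
  move=> /in_l2P[B h] /in_l2P[B' h']; apply/in_l2P; eexists.
  exact: l2leD (l2leZ d h) h'.
have shift_l2 psi : in_l2 psi -> in_l2 (shift z psi).
  by move=> /in_l2P[B h]; apply/in_l2P; eexists; exact: shift_bnd h.
exists S.
  split=> //.
    move=> d psi phi h h'; apply: inj.
    - exact/Sl2/comb_l2.
    - by apply: comb_l2; exact: Sl2.
    - move=> u; rewrite (SP _ (comb_l2 d _ _ h h')).2 shift_lin.
      by rewrite (SP _ h).2 (SP _ h').2.
  exists (Num.sqrt D) => psi h; apply: l2_norm_le.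
    by rewrite mulr_ge0 ?sqrtr_ge0.
  by rewrite exprMn sqr_sqrtr//; exact: (SP _ h).1.
move=> psi h u; split; first exact: (SP _ h).2.
apply: inj => //; first exact/Sl2/shift_l2.
by move=> v; rewrite (SP _ (shift_l2 _ h)).2.
Qed.

End Resolvent.
End L2.

Section Lipschitz.
Variables (R : realType) (n : nat).
Local Notation C := R[i].
Local Open Scope sesquilinear_scope.
Local Open Scope complex_scope.
Implicit Types A B D : 'M[C]_n.

Lemma normc_ge0 (z : C) : 0 <= Normc.normc z.
Proof. by case: z => a b; exact: sqrtr_ge0. Qed.

Lemma normcJ (z : C) : Normc.normc (z^*)%R = Normc.normc z.
Proof. by case: z => a b /=; rewrite sqrrN. Qed.

Definition mxl1 D : R := \sum_j \sum_i Normc.normc (D i j).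

Lemma qformB A B (v : 'rV[C]_n) : qform A v - qform B v = qform (A - B) v.
Proof.
rewrite /qform mulmxBr mulmxBl [in RHS]mxE [X in _ = complex.Re (_ + X)]mxE.
by case: ((_ *m A *m _) 0 0) ((_ *m B *m _) 0 0) => [? ?] [? ?].
Qed.

Lemma qform_le D (v : 'rV[C]_n) : qform D v <= mxl1 D * vnorm v.
Proof.
have nv j : Normc.normc (v 0 j) <= Num.sqrt (vnorm v).
  rewrite -[leLHS](ger0_norm (normc_ge0 _)) -sqrtr_sqr ler_wsqrtr//.
  by rewrite /vnorm (bigD1 j)//= lerDl sumr_ge0// => k _; exact: sqn_ge0.
have Ren (z : C) : complex.Re z <= Normc.normc z.
  case: z => a b /=; rewrite (le_trans (ler_norm _))// -sqrtr_sqr.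
  by rewrite ler_wsqrtr// lerDl sqr_ge0.
have nsum (I : finType) (F : I -> C) :
    Normc.normc (\sum_i F i) <= \sum_i Normc.normc (F i).
  elim/big_rec2: _ => [|i y1 y2 _ h]; first by rewrite Normc.normc0.
  by rewrite (le_trans (le_normcD _ _))// lerD2l.
rewrite /qform (le_trans (Ren _))// mxE mulr_suml.
rewrite (le_trans (nsum _ _))//; apply: ler_sum => j _.
rewrite mxE mulr_suml mulr_suml (le_trans (nsum _ _))//; apply: ler_sum => i _.
rewrite !mxE !Normc.normcM normcJ -[vnorm v]sqr_sqrtr ?vnorm_ge0// expr2.
rewrite [leRHS]mulrCA mulrA ler_pM ?mulr_ge0 ?normc_ge0//.
by rewrite ler_wpM2r ?normc_ge0.
Qed.

Lemma eig_lipschitz A B k : A ^t* = A -> B ^t* = B -> (k < n)%N ->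
  `|eig A k - eig B k| <= mxl1 (A - B).
Proof.
have le A' B' : A' ^t* = A' -> B' ^t* = B' -> (k < n)%N ->
    eig A' k <= eig B' k + mxl1 (A' - B').
  move=> Ah Bh kn; apply: weyl => // v; rewrite -lerBlDl qformB.
  exact: qform_le.
move=> Ah Bh kn; rewrite ler_distl lerBlDr le// andbT.
have -> : mxl1 (A - B) = mxl1 (B - A); last exact: le.
apply: eq_bigr => j _; apply: eq_bigr => i _.
have -> : (A - B) i j = - (B - A) i j by rewrite !mxE opprB.
by case: (_ i j) => a b /=; rewrite !sqrrN.
Qed.

End Lipschitz.

Section Bloch.
Variables (R : realType) (p1 p2 : nat).
Local Notation C := R[i].
Local Open Scope sesquilinear_scope.
Local Open Scope complex_scope.

Local Notation cell := ('I_p1.+1 * 'I_p2.+1 * bool)%type.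

Implicit Types (q : cell -> R) (x y : C) (v : cell -> C).

Definition step (b : bool) n (j : 'I_n) : 'I_n := if b then ordS j else ord_pred j.
Definition phase (b : bool) (x : C) : C := if b then x else (x^*)%R.

Definition bloch q x y v : cell -> C := fun r =>
  v (r.1, ~~ r.2) + phase r.2 x * v (step r.2 r.1.1, r.1.2, ~~ r.2)
  + phase r.2 y * v (r.1.1, step r.2 r.1.2, ~~ r.2) + (q r)%:C * v r.

Definition rowf v : 'rV[C]_#|{: cell}| := \row_j v (enum_val j).
Definition blochmx q x y : 'M[C]_#|{: cell}| :=
  \matrix_(i, j) bloch q x y (fun r => (r == enum_val i)%:R) (enum_val j).

Lemma rowf_surj (w : 'rV[C]_#|{: cell}|) : exists v, w = rowf v.
Proof. by exists (fun r => w 0 (enum_rank r)); apply/rowP => j; rewrite mxE enum_valK. Qed.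

Lemma vnorm_rowf v : vnorm (rowf v) = \sum_r sqn (v r).
Proof.
transitivity (\sum_(r in {: cell}) sqn (v r)); last exact: eq_bigl.
by rewrite big_enum_val; apply: eq_bigr => j _; rewrite mxE.
Qed.

Lemma bloch_mulmx q x y v : rowf v *m blochmx q x y = rowf (bloch q x y v).
Proof.
apply/rowP => j; rewrite !mxE.
have sumE r : v r = \sum_(i < #|{: cell}|) v (enum_val i) * (r == enum_val i)%:R.
  rewrite (bigD1 (enum_rank r))//= enum_rankK eqxx mulr1 big1 ?addr0// => i.
  by rewrite -(inj_eq enum_val_inj) enum_rankK eq_sym => /negPf ->; rewrite mulr0.
rewrite [RHS]/bloch.
rewrite 4!{1}[v _]sumE !mulr_sumr -!big_split /=; apply: eq_bigr => i _.
by rewrite !mxE /bloch; ring.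
Qed.

Lemma step_eq b n (j k : 'I_n) : (step b j == k) = (j == step (~~ b) k).
Proof.
case: b => /=; last by rewrite -[in LHS](ordSK k) (inj_eq (can_inj (@ord_predK n))).
by rewrite -[in LHS](ord_predK k) (inj_eq (can_inj (@ordSK n))).
Qed.

Lemma phaseJ b x : ((phase b x)^*)%R = phase (~~ b) x.
Proof. by case: b => //=; rewrite conjCK. Qed.

Lemma blochmx_herm q x y : (blochmx q x y) ^t* = blochmx q x y.
Proof.
apply/matrixP => i j; rewrite !mxE /bloch.
case: (enum_val i) (enum_val j) => [[a b] c] [[a' b'] c'] /=.
have cE : (~~ c == c') = (~~ c' == c) by case: c c' => [] [].
rewrite !xpair_eqE !step_eq cE [c == c']eq_sym [a == a']eq_sym [b == b']eq_sym.
have conjE (t1 t2 t3 t4 : bool) (u w : C) (d : R) :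
    Num.conj (t1%:R + u * t2%:R + w * t3%:R + d%:C * t4%:R) =
    t1%:R + (u^*)%R * t2%:R + (w^*)%R * t3%:R + d%:C * t4%:R.
  have dC : Num.conj d%:C = d%:C by exact: conjc_real.
  by rewrite !rmorphD !rmorphM !rmorph_nat /= dC.
rewrite conjE !phaseJ.
rewrite -(step_eq c') -(step_eq c') ![step c' _ == _]eq_sym.
case: c c' {cE} => [] [] /=; rewrite ?andbT ?andbF ?mulr0 ?addr0 ?add0r//;
  by case: (a' =P a) => [->|]; case: (b' =P b) => [->|]; rewrite ?mulr0.
Qed.

Lemma blochmxB_entry q q' x y x' y' i j (d : R) :
    (forall r, `|q r - q' r| <= d) ->
  Normc.normc ((blochmx q x y - blochmx q' x' y') i j) <=
  Normc.normc (x - x') + Normc.normc (y - y') + d.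
Proof.
move=> qd; rewrite !mxE /bloch; set r := enum_val j.
set d1 := (_ == _)%:R; set d2 := (_ == _)%:R; set d3 := (_ == _)%:R.
set d4 := (_ == _)%:R.
have -> : d1 + phase r.2 x * d2 + phase r.2 y * d3 + (q r)%:C * d4 -
    (d1 + phase r.2 x' * d2 + phase r.2 y' * d3 + (q' r)%:C * d4) =
    phase r.2 (x - x') * d2 + phase r.2 (y - y') * d3 + (q r - q' r)%:C * d4.
  have -> : (q r - q' r)%:C = (q r)%:C - (q' r)%:C.
    by apply/eqP; rewrite eq_complex /= subrr !eqxx.
  have phaseB b u w : phase b (u - w) = phase b u - phase b w.
    by case: b => //=; rewrite rmorphB.
  by rewrite !phaseB; ring.
have natle (z : C) (t : bool) : Normc.normc (z * t%:R) <= Normc.normc z.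
  case: t; first by rewrite mulr1.
  by rewrite mulr0 Normc.normc0 normc_ge0.
have normphase b (z : C) : Normc.normc (phase b z) = Normc.normc z.
  by case: b => //=; rewrite normcJ.
rewrite (le_trans (le_normcD _ _))// lerD//.
  rewrite (le_trans (le_normcD _ _))// lerD// (le_trans (natle _ _))// normphase//.
rewrite (le_trans (natle _ _))//= expr0n addr0 sqrtr_sqr.
exact: qd.
Qed.

Lemma band_lipschitz q q' x y x' y' (d : R) k : (k < #|{: cell}|)%N ->
    (forall r, `|q r - q' r| <= d) ->
  `|eig (blochmx q x y) k - eig (blochmx q' x' y') k| <=
  (#|{: cell}| * #|{: cell}|)%:R * (Normc.normc (x - x') + Normc.normc (y - y') + d).
Proof.
move=> kn qd; apply: (le_trans (eig_lipschitz (blochmx_herm _ _ _) (blochmx_herm _ _ _) kn)).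
rewrite /mxl1 (@le_trans _ _ (\sum_(j < #|{: cell}|) \sum_(i < #|{: cell}|)
    (Normc.normc (x - x') + Normc.normc (y - y') + d)))//.
  by apply: ler_sum => j _; apply: ler_sum => i _; exact: blochmxB_entry.
by rewrite !sumr_const !card_ord -mulrnA mulr_natl.
Qed.

End Bloch.

Section Window.
Variable V : zmodType.
Implicit Types (f : int -> V) (L : nat).

Definition window L f : V := \sum_(i < L.*2) f (i%:Z - L%:Z).

Lemma window_shift L (b : bool) f :
    (forall n, (L%:Z - 1 <= `|n|)%R -> f n = 0) ->
  window L (fun n => f (n + if b then 1 else -1)) = window L f.
Proof.
have shift1 g : g (- L%:Z) = 0 -> g L%:Z = 0 ->
    window L (fun n => g (n + 1)) = window L g.
  move=> g0 gL; have h i : g ((i.+1)%:Z - L%:Z) = g (i%:Z - L%:Z + 1) by congr g; lia.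
  rewrite /window; under eq_bigr do rewrite -h.
  apply: (addrI (g (0%:Z - L%:Z))).
  rewrite -(big_ord_recl _ (fun i : 'I__ => g (i%:Z - L%:Z))) big_ord_recr /=.
  by rewrite -addnn PoszD addrK gL sub0r g0 addr0 add0r.
move=> f0; case: b; first by apply: shift1; apply: f0; lia.
have := @shift1 (fun n => f (n - 1)); rewrite /= => <-.
- by congr window; apply/funext => n; congr f; lia.
- by apply: f0; lia.
- by apply: f0; lia.
Qed.

Lemma eq_window L f g : f =1 g -> window L f = window L g.
Proof. by move=> fg; apply: eq_bigr => i _; exact: fg. Qed.

Lemma windowD L f g : window L (fun n => f n + g n) = window L f + window L g.
Proof. exact: big_split. Qed.

End Window.

Lemma windowZ (A : pzRingType) L (c : A) f :
  window L (fun n => c * f n) = c * window L f.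
Proof. by rewrite /window mulr_sumr. Qed.

Section Site.
Variables (R : realType).
Local Notation C := R[i].
Implicit Types (x y w : C).

Lemma unit_exprz_step x (n : int) b : `|x| = 1 ->
  x ^ (n + if b then 1 else -1) = phase b x * x ^ n.
Proof.
move=> x1; have x0 : x != 0 by rewrite -normr_eq0 x1 oner_eq0.
rewrite expfzDr// mulrC; congr (_ * _); case: b => //=.
by rewrite -invr_expz expr1z invC_norm x1 expr1n invr1 mul1r.
Qed.

Lemma unit_exprz x (n : int) : `|x| = 1 -> `|x ^ n| = 1.
Proof.
move=> x1; case: n => n; first by rewrite -exprnP normrX x1 expr1n.
by rewrite NegzE -invr_expz -exprnP normrV ?unitfE ?expf_eq0 ?normrX ?x1 ?expr1n ?invr1//
  -normr_eq0 x1 oner_eq0 andbF.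
Qed.

Lemma unit_exprzJ x (n : int) : `|x| = 1 -> (x ^ n)^* = x ^ (- n).
Proof.
move=> x1; have := unit_exprz n x1 => xn1.
by rewrite -invr_expz invC_norm xn1 expr1n invr1 mul1r.
Qed.

Lemma sqn_unit x : `|x| = 1 -> sqn x = 1.
Proof.
by move=> x1; apply: (@complexI R); rewrite sqnE -normCK x1 expr1n.
Qed.

Lemma parseval L M w (f : int -> C) : (L.*2 <= M)%N -> M.-primitive_root w ->
  \sum_(a < M) sqn (window L (fun n => f n * (w ^+ a) ^ (- n))) =
  M%:R * window L (fun n => sqn (f n)).
Proof.
move=> LM prim; have M0 := prim_order_gt0 prim.
have w1 : `|w| = 1.
  by apply: (@pexpIrn _ M); rewrite ?nnegrE ?normr_ge0//
    -?normrX ?(prim_expr_order prim) ?normr1 ?expr1n.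
have wne : w != 0 by rewrite -normr_eq0 w1 oner_eq0.
apply: (@complexI R); rewrite rmorph_sum rmorphM rmorph_nat /=.
have -> : (window L (fun n => sqn (f n)))%:C%C = window L (fun n => f n * (f n)^*).
  by rewrite /window rmorph_sum; apply: eq_bigr => i _; exact: sqnE.
have sumE a : (sqn (window L (fun n => f n * (w ^+ a) ^ (- n))))%:C%C =
   \sum_(i < L.*2) \sum_(j < L.*2) f (i%:Z - L%:Z) * (f (j%:Z - L%:Z))^* *
      (w ^ (j%:Z - i%:Z)) ^+ a.
  rewrite sqnE /window mulr_suml; apply: eq_bigr => i _.
  rewrite rmorph_sum mulr_sumr; apply: eq_bigr => j _.
  rewrite rmorphM /= mulrACA; congr (_ * _).
  have wa1 : `|w ^+ a| = 1 by rewrite normrX w1 expr1n.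
  have wa0 : w ^+ a != 0 by rewrite expf_eq0 (negPf wne) andbF.
  rewrite unit_exprzJ// opprK -expfzDr// !exprnP !exprz_exp; congr (_ ^ _); lia.
under eq_bigr do rewrite sumE.
rewrite exchange_big /window mulr_sumr; apply: eq_bigr => i _.
rewrite exchange_big (bigD1 i)//= [X in _ + X]big1 ?addr0 => [|j ji].
  rewrite subrr expr0z; under eq_bigr do rewrite expr1n mulr1.
  by rewrite sumr_const card_ord mulr_natl.
rewrite -mulr_sumr; apply/eqP; rewrite mulf_eq0; apply/orP; right.
have : w ^ (j%:Z - i%:Z) - 1 != 0.
  rewrite subr_eq0; apply: contraNneq ji => /(congr1 (fun z => w ^+ i * z)).
  rewrite exprnP -expfzDr// mulr1 addrC subrK => /eqP.
  rewrite -!exprnP (eq_prim_root_expr prim) !modn_small ?(leq_trans (ltn_ord _) LM)//.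
move=> zne; rewrite -(mulrI_eq0 _ (mulfI zne)) -subrX1.
rewrite exprnP exprz_exp mulrC -exprz_exp -exprnP (prim_expr_order prim).
by rewrite exp1rz subrr.
Qed.

End Site.
Section Operator.
Variables (R : realType) (p1 p2 : nat).
Local Notation C := R[i].
Local Notation cell := ('I_p1.+1 * 'I_p2.+1 * bool)%type.
Local Notation site := (int * int * bool)%type.
Implicit Types (q : cell -> R) (x y : C) (v : cell -> C) (psi phi : site -> C).

Definition proj n (k : int) : 'I_n.+1 := inord `|(k %% n.+1)%Z|%N.

Lemma proj_step n (k : int) b : proj n (k + if b then 1 else -1) = step b (proj n k).
Proof.
have projS (l : int) : proj n (l + 1) = ordS (proj n l).
  apply/val_inj; rewrite /= !inordK; last 2 first.
  - by rewrite -ltz_nat gez0_abs ?modz_ge0 ?ltz_pmod.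
  - by rewrite -ltz_nat gez0_abs ?modz_ge0 ?ltz_pmod.
  have [a aE] : exists a : nat, (l %% n.+1)%Z = a.
    by exists `|(l %% n.+1)%Z|%N; rewrite gez0_abs ?modz_ge0.
  by rewrite -modzDml aE -[1]/(1%:Z) -PoszD modz_nat addn1.
case: b; first exact: projS.
by rewrite /= -[in RHS](subrK 1 k) projS ordSK.
Qed.

Definition cellof (u : site) : cell := (proj p1 u.1.1, proj p2 u.1.2, u.2).

Definition nbr1 (u : site) : site := (u.1, ~~ u.2).
Definition nbr2 (u : site) : site :=
  (u.1.1 + (if u.2 then 1 else -1), u.1.2, ~~ u.2).
Definition nbr3 (u : site) : site :=
  (u.1.1, u.1.2 + (if u.2 then 1 else -1), ~~ u.2).

Lemma nbr1_inj : injective nbr1.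
Proof. by case=> [[n m] b] [[n' m'] b'] [-> -> /negb_inj ->]. Qed.

Lemma nbr2_inj : injective nbr2.
Proof. by case=> [[n m] b] [[n' m'] b'] [+ -> /negb_inj e]; rewrite e => /addIr ->. Qed.

Lemma nbr3_inj : injective nbr3.
Proof. by case=> [[n m] b] [[n' m'] b'] [-> + /negb_inj e]; rewrite e => /addIr ->. Qed.

Definition op q psi : site -> C := fun u =>
  psi (u.1, ~~ u.2) + psi (u.1.1 + (if u.2 then 1 else -1), u.1.2, ~~ u.2)
  + psi (u.1.1, u.1.2 + (if u.2 then 1 else -1), ~~ u.2)
  + (q (cellof u))%:C%C * psi u.

Definition wave x y v : site -> C := fun u => x ^ u.1.1 * y ^ u.1.2 * v (cellof u).

Lemma op_wave q x y v : `|x| = 1 -> `|y| = 1 ->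
  op q (wave x y v) = wave x y (bloch q x y v).
Proof.
move=> x1 y1; apply/funext => -[[n m] b]; rewrite /op /wave /bloch /cellof /=.
by rewrite !unit_exprz_step// !proj_step; ring.
Qed.

Lemma op_lin q (d : C) psi phi : op q (fun u => d * psi u + phi u) =
  (fun u => d * op q psi u + op q phi u).
Proof. by apply/funext => u; rewrite /op; ring. Qed.

Lemma l2le_inj (f : site -> site) psi B : injective f -> l2le psi B ->
  l2le (psi \o f) B.
Proof.
move=> fi h s us; rewrite /= -(big_map f predT (fun u => sqn (psi u))).
by apply: h; rewrite map_inj_uniq.
Qed.

Definition opnorm q : R := 2 * (9 + \sum_r q r ^+ 2).

Lemma op_bnd q psi B : l2le psi B -> l2le (op q psi) (opnorm q * B).
Proof.
move=> h s us; have B0 := l2le_ge0 h.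
pose Q := \sum_r q r ^+ 2.
rewrite (@le_trans _ _ (\sum_(u <- s) 2 * (3 * (sqn (psi (nbr1 u)) + sqn (psi (nbr2 u))
   + sqn (psi (nbr3 u))) + Q * sqn (psi u))))//.
  apply: ler_sum => u _; rewrite (le_trans (sqnD _ _))// ler_wpM2l// lerD ?sqnD3//.
  rewrite sqnM sqnC ler_wpM2r ?sqn_ge0// /Q (bigD1 (cellof u))//= lerDl.
  by apply: sumr_ge0 => r _; exact: sqr_ge0.
rewrite -mulr_sumr /opnorm -mulrA ler_wpM2l// big_split/= -mulr_sumr [leRHS]mulrDl.
apply: lerD; last first.
  rewrite -mulr_sumr ler_wpM2l ?h//.
  by apply: sumr_ge0 => r _; exact: sqr_ge0.
have -> : 9 * B = 3 * (B + B + B) by ring.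
rewrite ler_wpM2l// !big_split/=.
by rewrite !lerD//; [exact: (l2le_inj nbr1_inj h)|
  exact: (l2le_inj nbr2_inj h)|exact: (l2le_inj nbr3_inj h)].
Qed.

Lemma op_cvg q (psi_ : nat -> site -> C) psi :
  (forall u, sqn (psi_ n u - psi u) @[n --> \oo] --> (0 : R)) ->
  forall u, sqn (op q (psi_ n) u - op q psi u) @[n --> \oo] --> (0 : R).
Proof.
move=> h u.
pose d n w := psi_ n w - psi w.
apply: (@squeeze_cvgr _ _ _ _ (fun=> 0)
    (fun n => 2 * (3 * (sqn (d n (nbr1 u)) + sqn (d n (nbr2 u)) + sqn (d n (nbr3 u)))
       + sqn (q (cellof u))%:C%C * sqn (d n u)))).
- near=> n; rewrite sqn_ge0 /=.
  have -> : op q (psi_ n) u - op q psi u =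
      d n (nbr1 u) + d n (nbr2 u) + d n (nbr3 u) + (q (cellof u))%:C%C * d n u.
    by rewrite /op /d /nbr1 /nbr2 /nbr3; ring.
  by rewrite (le_trans (sqnD _ _))// ler_wpM2l// sqnM lerD2r sqnD3.
- exact: cvg_cst.
- rewrite (_ : (0 : R) = 2 * (3 * (0 + 0 + 0) + sqn (q (cellof u))%:C%C * 0)); last by ring.
  apply: cvgMr; apply: cvgD; apply: cvgMr; last exact: h.
  by apply: cvgD; [apply: cvgD|]; exact: h.
Unshelve. all: by end_near. Qed.

Definition supp (L : int) psi :=
  forall u, (L <= `|u.1.1|)%R || (L <= `|u.1.2|)%R -> psi u = 0.

Lemma op_supp q L psi : supp L psi -> supp (L + 1) (op q psi).
Proof.
move=> h [[n m] b] /= hL; rewrite /op /= !h ?mulr0 ?addr0//=.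
all: by case: b; lia.
Qed.

Definition hat L x y psi : cell -> C := fun r =>
  window L (fun n => window L (fun m => (proj p1 n == r.1.1)%:R *
    (proj p2 m == r.1.2)%:R * psi (n, m, r.2) * (x ^ (- n) * y ^ (- m)))).

Lemma hatD L x y (c : C) psi phi r :
  hat L x y (fun u => psi u + c * phi u) r = hat L x y psi r + c * hat L x y phi r.
Proof.
rewrite /hat -windowZ -windowD; apply: eq_window => n.
rewrite -windowZ -windowD; apply: eq_window => m; ring.
Qed.

Lemma hat_op q L x y psi : `|x| = 1 -> `|y| = 1 -> supp (L%:Z - 1) psi ->
  hat L x y (op q psi) = bloch q x y (hat L x y psi).
Proof.
move=> x1 y1 h; apply/funext => -[[j l] b]; rewrite /bloch /=.
pose g (j' : 'I_p1.+1) (l' : 'I_p2.+1) n m := (proj p1 n == j')%:R *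
    (proj p2 m == l')%:R * psi (n, m, ~~ b) * (x ^ (- n) * y ^ (- m)).
have -> : hat L x y psi (step b j, l, ~~ b) =
    window L (fun n => window L (g (step b j) l (n + if b then 1 else -1))).
  rewrite (@window_shift _ L b (fun n => window L (g (step b j) l n)))// => n nL.
  by rewrite /window big1// => i _; rewrite /g h ?mulr0 ?mul0r//= nL.
have -> : hat L x y psi (j, step b l, ~~ b) =
    window L (fun n => window L (fun m => g j (step b l) n (m + if b then 1 else -1))).
  apply: eq_window => n; rewrite (@window_shift _ L b (g j (step b l) n))// => m mL.
  by rewrite /g h ?mulr0 ?mul0r//= mL orbT.
rewrite /hat -!windowZ -!windowD; apply: eq_window => n.
rewrite -!windowZ -!windowD; apply: eq_window => m.
have inj k (i i' : 'I_k) : (step b i == step b i') = (i == i').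
  by rewrite step_eq; case: b {g h}; rewrite /= ?ordSK ?ord_predK.
have ex (z : C) (k : int) : `|z| = 1 -> z ^ (- k) = phase b z * z ^ (- (k + if b then 1 else -1)).
  move=> z1; rewrite -unit_exprz_step//; congr (_ ^ _); lia.
rewrite /g !proj_step !inj /op /cellof /= (ex x n x1) (ex y m y1).
case: (proj p1 n =P j) => [->|_]; case: (proj p2 m =P l) => [->|_] /=; ring.
Qed.

End Operator.
Section Expi.
Variable R : realType.
Local Notation C := R[i].

Definition expi (t : R) : C := (cos t +i* sin t)%C.

Lemma expiD s t : expi (s + t) = expi s * expi t.
Proof.
by apply/eqP; rewrite eq_complex /= cosD sinD; apply/andP; split; apply/eqP; ring.
Qed.

Lemma expi0 : expi 0 = 1.
Proof. by rewrite /expi cos0 sin0. Qed.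

Lemma norm_expi t : `|expi t| = 1.
Proof. by rewrite normc_def /= cos2Dsin2 sqrtr1. Qed.

Lemma expiX t n : expi t ^+ n = expi (t *+ n).
Proof.
elim: n => [|n IH]; first by rewrite expr0 mulr0n expi0.
by rewrite exprS IH mulrS expiD.
Qed.

Lemma expi_neq1 t : 0 < t < pi *+ 2 -> expi t != 1.
Proof.
move=> t0; have ht : 0 < t / 2 < pi by lra.
have := sin_gt0_pi ht; apply: contraTneq => /(congr1 (@complex.Re R)) /= e.
have : cos t = cos (t / 2 *+ 2) by congr cos; rewrite -mulr_natr; field.
rewrite cos_mulr2n e cos2sin2 => h.
have /eqP : sin (t / 2) ^+ 2 = 0 by lra.
by rewrite sqrf_eq0 => /eqP ->; rewrite ltxx.
Qed.

Lemma expi2pi : expi (pi *+ 2) = 1.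
Proof. by rewrite /expi cos2pi sin2pi. Qed.

Lemma expi_prim M : (0 < M)%N -> M.-primitive_root (expi (pi *+ 2 / M%:R)).
Proof.
move=> M0; have Mr : (0 : R) < M%:R by rewrite ltr0n.
rewrite /primitive_root_of_unity M0; apply/forallP => i.
rewrite unity_rootE expiX -[_ *+ i.+1]mulr_natr.
have [->|iM] := eqVneq i.+1 M; first by rewrite divfK ?(gt_eqF Mr)// expi2pi eqxx.
have P0 : (0 : R) < pi *+ 2 by rewrite pmulrn_lgt0// pi_gt0.
rewrite (negPf (expi_neq1 _))//; move: (pi *+ 2) P0 => P P0; apply/andP; split.
  by rewrite mulr_gt0 ?ltr0n// divr_gt0.
rewrite -mulrA gtr_pMr// mulrC ltr_pdivrMr// mul1r ltr_nat.
by rewrite ltn_neqAle iM ltn_ord.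
Qed.

End Expi.

Section WindowBound.
Variables (R : realType) (p1 p2 : nat).
Local Notation C := R[i].
Local Notation cell := ('I_p1.+1 * 'I_p2.+1 * bool)%type.
Local Notation site := (int * int * bool)%type.
Implicit Types (q : cell -> R) (x y : C) (v : cell -> C) (psi phi : site -> C).

Lemma window_sum (I : finType) (V : zmodType) L (F : I -> int -> V) :
  \sum_i window L (F i) = window L (fun n => \sum_i F i n).
Proof. exact: exchange_big. Qed.

Lemma parseval2 L M w psi : (L.*2 <= M)%N -> M.-primitive_root w ->
  \sum_(a < M) \sum_(b < M) \sum_(r : cell) sqn (hat L (w ^+ a) (w ^+ b) psi r) =
  M%:R ^+ 2 * window L (fun n => window L (fun m => \sum_c sqn (psi (n, m, c)))).
Proof.
move=> LM prim; rewrite exchange_big /=.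
pose e (r : cell) n m : C := (proj p1 n == r.1.1)%:R * (proj p2 m == r.1.2)%:R * psi (n, m, r.2).
pose g b r n := window L (fun m => e r n m * (w ^+ b) ^ (- m)).
have hatE a b r : hat L (w ^+ a) (w ^+ b) psi r =
    window L (fun n => g b r n * (w ^+ a) ^ (- n)).
  apply: eq_window => n; rewrite /g mulrC -windowZ; apply: eq_window => m.
  by rewrite /e; ring.
transitivity (\sum_(b < M) \sum_(r : cell) M%:R * window L (fun n => sqn (g b r n))).
  apply: eq_bigr => b _; rewrite exchange_big; apply: eq_bigr => r _.
  by under eq_bigr do rewrite hatE; exact: parseval.
rewrite exchange_big /=.
transitivity (\sum_(r : cell) M%:R ^+ 2 * window L (fun n => window L (fun m => sqn (e r n m)))).
  apply: eq_bigr => r _; rewrite -mulr_sumr window_sum expr2 -mulrA; congr (_ * _).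
  by rewrite -windowZ; apply: eq_window => n; exact: parseval.
rewrite -mulr_sumr window_sum; congr (_ * _); apply: eq_window => n.
rewrite window_sum; apply: eq_window => m.
transitivity (\sum_(r : cell) sqn (e (r.1, r.2) n m)).
  by apply: eq_bigr => -[].
rewrite -(pair_bigA _ (fun jl c => sqn (e (jl, c) n m))) /=.
rewrite (bigD1 (proj p1 n, proj p2 m))//= [X in _ + X]big1 ?addr0.
  by apply: eq_bigr => c _; rewrite /e /= !eqxx !mul1r.
move=> [j l] /=; rewrite xpair_eqE negb_and => jl; apply: big1 => c _.
apply/eqP; rewrite sqn_eq0 /e /= [_ == j]eq_sym [_ == l]eq_sym.
by case/orP: jl => /negPf ->; rewrite ?mul0r ?mulr0 ?mul0r.
Qed.

Definition trunc (L : int) psi : site -> C := fun u =>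
  if (`|u.1.1| < L)%R && (`|u.1.2| < L)%R then psi u else 0.

Lemma trunc_supp L psi : supp L (trunc L psi).
Proof.
by move=> u; rewrite /trunc !ltNge -negb_or => ->.
Qed.

Definition range L : seq int := [seq i%:Z - L%:Z | i <- index_iota 0 L.*2].
Definition box L : seq site :=
  [seq (nm, c) | nm <- [seq (n, m) | n <- range L, m <- range L], c <- [:: true; false]].

Lemma window_range (V : zmodType) L (f : int -> V) :
  window L f = \sum_(n <- range L) f n.
Proof. by rewrite /range big_map big_mkord. Qed.

Lemma window_box L (f : site -> R) :
  window L (fun n => window L (fun m => \sum_c f (n, m, c))) = \sum_(u <- box L) f u.
Proof.
rewrite /box big_allpairs_dep /= big_allpairs_dep window_range; apply: eq_bigr => n _.
rewrite window_range; apply: eq_bigr => m _.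
by rewrite big_bool big_cons big_seq1.
Qed.

Lemma box_uniq L : uniq (box L).
Proof.
have ru : uniq (range L) by rewrite map_inj_uniq ?iota_uniq// => i j; lia.
by rewrite !allpairs_uniq// => -[? ?] [? ?] _ _ [-> ->].
Qed.

Lemma mem_box L (u : site) : (`|u.1.1| < L%:Z)%R -> (`|u.1.2| < L%:Z)%R -> u \in box L.
Proof.
case: u => [[n m] c] /= hn hm.
have mr (k : int) : (`|k| < L%:Z)%R -> k \in range L.
  move=> kL; apply/mapP; exists (absz (k + L%:Z)); last by lia.
  by rewrite mem_index_iota; lia.
apply: allpairs_f; first by apply: allpairs_f; exact: mr.
by case: c; rewrite !inE.
Qed.

Lemma site_bound (t : seq site) : exists L : nat,
  {in t, forall u : site, (`|u.1.1| < L%:Z)%R && (`|u.1.2| < L%:Z)%R}.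
Proof.
elim: t => [|u t [L IH]]; first by exists 0%N.
case: u => [[n m] c]; exists (L + absz n + absz m + 1)%N => -[[n' m'] c'] /=.
by rewrite inE => /predU1P[[-> -> _]|/IH /=]; lia.
Qed.

Lemma box_cover (t : seq site) : exists L, {subset t <= box L}.
Proof.
by have [L tL] := site_bound t; exists L => u /tL /andP[hn hm]; exact: mem_box.
Qed.

Lemma ler_sum_subset (I : eqType) (s t : seq I) (F : I -> R) :
    uniq s -> uniq t -> {subset s <= t} -> (forall i, 0 <= F i) ->
  \sum_(i <- s) F i <= \sum_(i <- t) F i.
Proof.
move=> us ut st F0.
have st' : perm_eq s [seq i <- t | i \in s].
  apply: uniq_perm => //; first exact: filter_uniq.
  by move=> i; rewrite mem_filter; case: (boolP (i \in s)) => //= /st ->.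
rewrite (perm_big _ st') big_filter big_mkcond; apply: ler_sum => i _.
by case: ifP.
Qed.

Definition agree (L : int) psi phi := forall u : site,
  (`|u.1.1| < L)%R -> (`|u.1.2| < L)%R -> psi u = phi u.

Lemma agree_shift q (c : C) L psi phi : agree (L + 1) psi phi ->
  agree L (shift (op q) c psi) (shift (op q) c phi).
Proof.
move=> h [[n m] e] /= hn hm; rewrite /shift /op /= !h//=; try lia.
all: by case: e; lia.
Qed.

Variables (q : cell -> R) (a b s rho : R).
Hypothesis rho0 : 0 <= rho.
Hypothesis eigq : forall t t' k, 0 <= t <= pi *+ 2 -> 0 <= t' <= pi *+ 2 ->
  (k < #|{: cell}|)%N ->
  `|1 - ((eig (blochmx q (expi t) (expi t')) k - a) ^+ 2 + b ^+ 2) / s| <= rho.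

Let K := contraction (op q) a b s.

Lemma hat_contraction L x y psi : `|x| = 1 -> `|y| = 1 -> supp (L%:Z - 2) psi ->
  let v := rowf (hat L x y psi) in let A := blochmx q x y in
  rowf (hat L x y (K psi)) =
  v - (s^-1)%:C%C *: (v *m (A - a%:C%C%:M) *m (A - a%:C%C%:M) + (b ^+ 2)%:C%C *: v).
Proof.
move=> x1 y1 h v A.
have h1 : supp (L%:Z - 1) psi by move=> u hu; apply: h; lia.
have shiftE phi : supp (L%:Z - 1) phi ->
    rowf (hat L x y (shift (op q) a%:C%C phi)) = rowf (hat L x y phi) *m (A - a%:C%C%:M).
  move=> hphi; rewrite mulmxBr bloch_mulmx mul_mx_scalar.
  apply/rowP => j; rewrite !mxE -hat_op// -mulNr -hatD.
  by congr (hat _ _ _ _ _); apply/funext => u; rewrite /shift mulNr.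
have hs : supp (L%:Z - 1) (shift (op q) a%:C%C psi).
  move=> u hu; rewrite /shift h1// mulr0 subr0.
  by apply: (op_supp q h); lia.
rewrite /v -shiftE// -shiftE//; apply/rowP => j; rewrite !mxE.
rewrite -[in RHS]mulNr mulrDr addrA mulrA -hatD -hatD; congr (hat _ _ _ _ _).
by apply/funext => u; rewrite /K /contraction; ring.
Qed.

Lemma box_contraction L psi : (0 < L)%N -> supp (L%:Z - 2) psi ->
  \sum_(u <- box L) sqn (K psi u) <= rho ^+ 2 * \sum_(u <- box L) sqn (psi u).
Proof.
move=> L0 h; set M := L.*2.
have M0 : (0 < M)%N by rewrite double_gt0.
have prim := @expi_prim R M M0; set w := expi _ in prim.
have Mr : (0 : R) < M%:R by rewrite ltr0n.
rewrite -(window_box L (fun u => sqn (K psi u))) -(window_box L (fun u => sqn (psi u))).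
have PP phi := parseval2 phi (leqnn M) prim.
rewrite -(ler_pM2l (exprn_gt0 2 Mr)) mulrCA -!PP.
rewrite mulr_sumr; apply: ler_sum => i _; rewrite mulr_sumr; apply: ler_sum => j _.
have we (k : 'I_M) : exists2 t, 0 <= t <= pi *+ 2 & w ^+ k = expi t.
  exists (pi *+ 2 / M%:R *+ k); last by rewrite expiX.
  rewrite -[_ *+ k]mulr_natr; have : (0 : R) < pi *+ 2 by rewrite pmulrn_lgt0// pi_gt0.
  move: (pi *+ 2) => P P0; rewrite mulr_ge0 ?ler0n ?divr_ge0 ?(ltW P0) ?(ltW Mr)//=.
  by rewrite -mulrA ger_pMr// mulrC ler_pdivrMr// mul1r ler_nat ltnW.
have [t t0 ->] := we i; have [t' t0' ->] := we j.
rewrite -!vnorm_rowf hat_contraction ?norm_expi//.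
apply: vnorm_contraction => //; first exact: blochmx_herm.
by move=> k; exact: eigq.
Qed.

Lemma contraction_bnd psi B : l2le psi B -> l2le (K psi) (rho ^+ 2 * B).
Proof.
move=> h t ut.
have [L tL] := site_bound t.
set psi' := trunc (L + 2)%:Z psi.
have Keq : {in t, K psi =1 K psi'}.
  have h0 : agree (L%:Z + 2) psi psi'.
    by move=> u hn hm; rewrite /psi' /trunc PoszD hn hm.
  have h2 : agree L%:Z (shift (op q) a%:C%C (shift (op q) a%:C%C psi))
      (shift (op q) a%:C%C (shift (op q) a%:C%C psi')).
    by apply/agree_shift/agree_shift; rewrite -addrA.
  by move=> u /tL /andP[hn hm]; rewrite /K /contraction h2// h0//; lia.
rewrite big_seq_cond; under eq_bigr => u /andP[ut' _] do rewrite Keq//.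
rewrite -big_seq_cond.
apply: (@le_trans _ _ (\sum_(u <- box (L + 4)) sqn (K psi' u))).
  apply: ler_sum_subset => //; first exact: box_uniq.
    by move=> u /tL hu; apply: mem_box; lia.
  by move=> u; exact: sqn_ge0.
apply: le_trans (box_contraction _ _) _; first by rewrite addn_gt0 orbT.
  by move=> u hu; apply: trunc_supp; lia.
rewrite ler_wpM2l ?sqr_ge0//.
apply: le_trans (h _ (box_uniq (L + 4))); apply: ler_sum => u _.
by rewrite /psi' /trunc; case: ifP => // _; rewrite /sqn Normc.normc0 expr0n sqn_ge0.
Qed.

End WindowBound.
Section Spectrum.
Variables (R : realType) (p1 p2 : nat).
Local Notation C := R[i].
Local Notation cell := ('I_p1.+1 * 'I_p2.+1 * bool)%type.
Local Notation site := (int * int * bool)%type.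
Variable q : cell -> R.

Definition band t t' k : R := eig (blochmx q (expi t) (expi t')) k.

Lemma normc_unitB (x y : C) : `|x| = 1 -> `|y| = 1 -> Normc.normc (x - y) <= 2.
Proof.
move=> x1 y1; rewrite -lecR; change (`|x - y| <= 2%:C%C); rewrite (le_trans (ler_normB _ _))//.
by rewrite x1 y1 -[1]/(1%:C%C) -rmorphD lecR.
Qed.

Lemma band_bound : exists E, forall t t' k, (k < #|{: cell}|)%N -> `|band t t' k| <= E.
Proof.
pose N := (#|{: cell}| * #|{: cell}|)%N.
exists (\sum_(k < #|{: cell}|) `|eig (blochmx q 1 1) k| + N%:R * 4) => t t' k kn.
rewrite -(subrK (eig (blochmx q 1 1) k) (band t t' k)) addrC (le_trans (ler_normD _ _))//.
apply: lerD.
  rewrite (bigD1 (Ordinal kn))//= lerDl; apply: sumr_ge0 => *; exact: normr_ge0.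
rewrite (le_trans (@band_lipschitz _ _ _ q q _ _ _ _ 0 _ kn _))//.
  by move=> r; rewrite subrr normr0.
rewrite ler_wpM2l// addr0 -[4]/((2 + 2)%:R) natrD lerD// normc_unitB ?norm_expi ?normr1//.
Qed.

Lemma resolvent_off_bands (a b m : R) : 0 < m ->
    (forall t t' k, 0 <= t <= pi *+ 2 -> 0 <= t' <= pi *+ 2 ->
       (k < #|{: cell}|)%N -> m <= (band t t' k - a) ^+ 2 + b ^+ 2) ->
  l2_resolvent_set (op q) (a +i* b)%C.
Proof.
move=> m0 hm; have [E hE] := band_bound.
pose s := (E + `|a|) ^+ 2 + b ^+ 2 + m + m.
have s0 : 0 < s by rewrite /s; have := sqr_ge0 (E + `|a|); have := sqr_ge0 b; lra.
have ms : m / s < 1.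
  by rewrite ltr_pdivrMr// mul1r /s; have := sqr_ge0 (E + `|a|); have := sqr_ge0 b; lra.
have ms0 : 0 < m / s by rewrite divr_gt0.
apply: (@resolvent_of_contraction _ _ (op q) (opnorm q) a b s (1 - m / s)).
- lra.
- exact: op_lin.
- exact: op_bnd.
- exact: op_cvg.
- apply: contraction_bnd; first lra.
  move=> t t' k t0 t0' kn.
  have h1 := hm _ _ _ t0 t0' kn; have h2 := hE t t' _ kn.
  rewrite -/(band t t' k); set d := _ + b ^+ 2 in h1 *.
  have ds : d <= s.
    have : `|band t t' k - a| <= E + `|a|.
      by rewrite (le_trans (ler_normB _ _))// lerD2r.
    rewrite -(ler_pXn2r (ltn0Sn 1)) ?nnegrE ?normr_ge0//; last first.
      by rewrite addr_ge0// (le_trans _ h2).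
    by rewrite -normrX ger0_norm ?sqr_ge0// /d /s; lra.
  have : d / s <= 1 by rewrite ler_pdivrMr// mul1r.
  have : m / s <= d / s by rewrite ler_pM2r ?invr_gt0.
  by move=> *; rewrite ger0_norm; lra.
Qed.

Section Weyl.
Variables (t t' : R) (k : nat).
Hypothesis kn : (k < #|{: cell}|)%N.
Let E := band t t' k.

Lemma bloch_eigenvector : exists2 v : cell -> C, exists r, v r != 0 &
  bloch q (expi t) (expi t') v = (fun r => E%:C%C * v r).
Proof.
have [w w0 wE] := eig_eigenvector (blochmx_herm q (expi t) (expi t')) kn.
have [v wv] := rowf_surj w; exists v.
  apply/existsP; rewrite -negb_forall; apply: contraNN w0 => /forallP h.
  by rewrite wv; apply/eqP/rowP => j; rewrite !mxE; apply/eqP.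
apply/funext => r; move: wE; rewrite wv bloch_mulmx => /rowP/(_ (enum_rank r)).
by rewrite !mxE enum_rankK.
Qed.

Definition damping (r : R) (u : site) : R := r ^+ (absz u.1.1 + absz u.1.2).

Lemma damping_diff (r : R) (i j : nat) : 0 < r < 1 -> (i <= j.+1)%N -> (j <= i.+1)%N ->
  `|r ^+ i - r ^+ j| <= (r^-1 - 1) * r ^+ i.
Proof.
move=> /andP[r0 r1] ij ji; have ri : 0 < r ^+ i by rewrite exprn_gt0.
have rV : 1 < r^-1 by rewrite invf_gt1.
have [->|] := eqVneq i j; first by rewrite subrr normr0 mulr_ge0 ?exprn_ge0 ?(ltW r0)//; lra.
rewrite neq_ltn => /orP[lt|lt].
  have -> : j = i.+1 by lia.
  rewrite exprS -[X in X - _]mul1r -mulrBl normrM (gtr0_norm ri) ler_wpM2r ?(ltW ri)//.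
  rewrite ger0_norm ?subr_ge0 ?(ltW r1)//.
  have : r * r^-1 = 1 by rewrite divff ?gt_eqF.
  nra.
have e : i = j.+1 by lia.
have -> : (r^-1 - 1) * r ^+ i = r ^+ j - r ^+ i by rewrite e exprS; field; rewrite gt_eqF.
rewrite ler0_norm ?opprB// subr_le0 e exprS ler_piMl ?(ltW r1)//.
by rewrite exprn_ge0// ltW.
Qed.

Lemma windowS (V : zmodType) L (f : int -> V) :
  window L.+1 f = f (- (L.+1)%:Z) + window L f + f L%:Z.
Proof.
rewrite /window doubleS big_ord_recr big_ord_recl /= sub0r; congr (_ + _ + _).
  by apply: eq_bigr => i _; congr f; rewrite /bump /=; lia.
by congr f; lia.
Qed.

Lemma window_geometric L (z : R) : 0 <= z < 1 ->
  window L (fun n => z ^+ absz n) <= 2 / (1 - z).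
Proof.
move=> /andP[z0 z1]; have z1' : 0 < 1 - z by rewrite subr_gt0.
rewrite ler_pdivlMr//.
suff : window L (fun n => z ^+ absz n) * (1 - z) <= 2 - z ^+ L - z ^+ L.+1.
  move/le_trans; apply; have := exprn_ge0 L z0; have := exprn_ge0 L.+1 z0; lra.
elim: L => [|L IH]; first by rewrite /window big_ord0 mul0r expr0 expr1; lra.
rewrite windowS abszN !absz_nat !exprS; rewrite exprS in IH.
by move: (window _ _) (z ^+ L) IH => W Z; nra.
Qed.

Lemma damping_l2 (r B : R) phi : 0 < r < 1 -> (forall u, sqn (phi u) <= B) ->
  in_l2 (fun u : site => (damping r u)%:C%C * phi u).
Proof.
move=> /andP[r0 r1] hB; have B0 : 0 <= B := le_trans (sqn_ge0 _) (hB (0, 0, true)).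
pose z := r ^+ 2; have z01 : 0 <= z < 1 by rewrite sqr_ge0 expr_lt1 ?(ltW r0).
apply/in_l2P; exists (2 * B * (2 / (1 - z)) ^+ 2) => s us.
have [L sL] := box_cover s.
apply: (@le_trans _ _ (\sum_(u <- s) B * (z ^+ absz u.1.1 * z ^+ absz u.1.2))).
  apply: ler_sum => u _; rewrite sqnM sqnC mulrC /damping -exprAC -/z exprD.
  by rewrite ler_wpM2r// -exprD exprn_ge0// sqr_ge0.
apply: le_trans (ler_sum_subset us (box_uniq L) sL _) _.
  by move=> u; rewrite mulr_ge0// -exprD exprn_ge0// sqr_ge0.
rewrite -(window_box L (fun u => B * (z ^+ absz u.1.1 * z ^+ absz u.1.2))) /=.
have -> : window L (fun n => window L (fun m => \sum_(c : bool) B * (z ^+ absz n * z ^+ absz m)))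
    = 2 * B * window L (fun n => z ^+ absz n) ^+ 2.
  set W := window L (fun n => z ^+ absz n).
  transitivity (window L (fun n => 2 * B * W * z ^+ absz n)); last first.
    by rewrite windowZ -/W; ring.
  apply: eq_window => n.
  have -> : 2 * B * W * z ^+ absz n = 2 * B * z ^+ absz n * W by ring.
  by rewrite /W -windowZ; apply: eq_window => m; rewrite big_bool /=; ring.
rewrite ler_wpM2l ?mulr_ge0// ler_pXn2r ?nnegrE ?window_geometric//.
  by apply: sumr_ge0 => i _; rewrite exprn_ge0// sqr_ge0.
by rewrite divr_ge0// subr_ge0; case/andP: z01 => _ /ltW.
Qed.

Lemma wave_bound (x y : C) (v : cell -> C) u : `|x| = 1 -> `|y| = 1 ->
  sqn (wave x y v u) <= \sum_c sqn (v c).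
Proof.
move=> x1 y1; rewrite /wave 2!sqnM.
rewrite (sqn_unit (unit_exprz u.1.1 x1)) (sqn_unit (unit_exprz u.1.2 y1)) !mul1r.
by rewrite (bigD1 (cellof p1 p2 u))//= lerDl; apply: sumr_ge0 => *; exact: sqn_ge0.
Qed.

Lemma damped_residual (x y : C) (e r : R) (v : cell -> C) B : `|x| = 1 -> `|y| = 1 ->
    0 < r < 1 -> bloch q x y v = (fun c => e%:C%C * v c) ->
    let psi := fun u => (damping r u)%:C%C * wave x y v u in
  l2le psi B -> l2le (shift (op q) e%:C%C psi) (9 * (r^-1 - 1) ^+ 2 * B).
Proof.
move=> x1 y1 r01 vE; set phi := wave x y v => psi h s us.
have phiE u : phi (nbr1 u) + phi (nbr2 u) + phi (nbr3 u) =
    e%:C%C * phi u - (q (cellof p1 p2 u))%:C%C * phi u.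
  have /(congr1 (fun f => f u)) : op q phi = (fun u => e%:C%C * phi u).
    rewrite /phi op_wave// vE; apply/funext => w; rewrite /wave.
    by move: (x ^ _) (y ^ _) (v _) => *; ring.
  by rewrite /op => <-; rewrite /nbr1 /nbr2 /nbr3; ring.
have d1 u : `|damping r (nbr1 u) - damping r u| <= (r^-1 - 1) * damping r (nbr1 u).
  by apply: damping_diff; rewrite //=; lia.
have d2 u : `|damping r (nbr2 u) - damping r u| <= (r^-1 - 1) * damping r (nbr2 u).
  by case: u => [[n m] b]; apply: damping_diff => //=; case: b; lia.
have d3 u : `|damping r (nbr3 u) - damping r u| <= (r^-1 - 1) * damping r (nbr3 u).
  by case: u => [[n m] b]; apply: damping_diff => //=; case: b; lia.
have sqd (w w' : R) (z : C) : `|w - w'| <= (r^-1 - 1) * w ->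
    sqn ((w - w')%:C%C * z) <= (r^-1 - 1) ^+ 2 * sqn (w%:C%C * z).
  move=> hw; rewrite (sqnM (w - w')%:C%C) (sqnM w%:C%C) !sqnC.
  move: (sqn z) (sqn_ge0 z) => Z Z0; rewrite [leRHS]mulrA -exprMn ler_wpM2r//.
  rewrite -[leLHS]real_normK ?num_real// ler_pXn2r ?nnegrE//.
  exact: le_trans (normr_ge0 _) hw.
have pt u : sqn (shift (op q) e%:C%C psi u) <= (r^-1 - 1) ^+ 2 *
    (3 * (sqn (psi (nbr1 u)) + sqn (psi (nbr2 u)) + sqn (psi (nbr3 u)))).
  have -> : shift (op q) e%:C%C psi u =
      (damping r (nbr1 u) - damping r u)%:C%C * phi (nbr1 u) +
      (damping r (nbr2 u) - damping r u)%:C%C * phi (nbr2 u) +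
      (damping r (nbr3 u) - damping r u)%:C%C * phi (nbr3 u).
    have cB (w w' : R) : (w - w')%:C%C = w%:C%C - w'%:C%C by exact: rmorphB.
    have -> : shift (op q) e%:C%C psi u =
        psi (nbr1 u) + psi (nbr2 u) + psi (nbr3 u)
        - (damping r u)%:C%C * (e%:C%C * phi u - (q (cellof p1 p2 u))%:C%C * phi u).
      by rewrite /shift /op /psi /nbr1 /nbr2 /nbr3; ring.
    by rewrite -phiE !cB /psi; ring.
  apply: le_trans (sqnD3 _ _ _) _; rewrite [leRHS]mulrCA ler_wpM2l//.
  rewrite [leRHS]mulrDr [X in _ <= X + _]mulrDr.
  by rewrite !lerD// sqd.
apply: le_trans (ler_sum _ (fun u _ => pt u)) _.
rewrite -mulr_sumr [9 * _]mulrC -[leRHS]mulrA ler_wpM2l ?sqr_ge0//.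
rewrite -mulr_sumr; have -> : 9 * B = 3 * (B + B + B) by ring.
rewrite ler_wpM2l// !big_split/=.
by rewrite !lerD//; [exact: (l2le_inj nbr1_inj h)|
  exact: (l2le_inj nbr2_inj h)|exact: (l2le_inj nbr3_inj h)].
Qed.

Lemma band_spectrum : l2_spectrum (op q) E%:C%C.
Proof.
case=> S [Sl2 Slin [M SM]] Sinv.
have [v [r0 vr0] vE] := bloch_eigenvector.
pose x := `|M| * 3 + 1; have x1 : 1 <= x by rewrite lerDr mulr_ge0.
pose r := x / (x + 1); have r01 : 0 < r < 1.
  by rewrite divr_gt0 ?ltr_pdivrMr; lra.
have rE : r^-1 - 1 = x^-1.
  have x0 : x != 0 by rewrite gt_eqF// (lt_le_trans ltr01).
  by rewrite /r invf_div mulrDl divff// mul1r addrAC subrr add0r.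
pose psi := fun u => (damping r u)%:C%C * wave (expi t) (expi t') v u.
have psil2 : in_l2 psi.
  apply: damping_l2 r01 _ => u.
  exact: (wave_bound v u (norm_expi t) (norm_expi t')).
have := damped_residual (norm_expi t) (norm_expi t') r01 vE (l2le_norm psil2); rewrite -/psi => res.
have resl2 : in_l2 (shift (op q) E%:C%C psi) by apply/in_l2P; eexists; exact: res.
have psi0 : 0 < l2_norm psi.
  pose u0 : site := ((r0.1.1 : nat)%:Z, (r0.1.2 : nat)%:Z, r0.2).
  have cu0 : cellof p1 p2 u0 = r0.
    have pk n (i : 'I_n.+1) : proj n (i : nat)%:Z = i.
      by rewrite /proj modz_nat absz_nat modn_small// inord_val.
    by rewrite /u0 /cellof /= !pk; case: (r0) => [[]].
  rewrite lt_neqAle eq_sym sqrtr_ge0 andbT.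
  have := l2le_pt u0 (l2le_norm psil2); apply: contraTneq => ->.
  rewrite expr0n -ltNge lt_neqAle eq_sym sqn_ge0 andbT sqn_eq0 /psi /wave cu0.
  have xe (y : R) (n : int) : expi y ^ n != 0.
    by rewrite -normr_eq0 (unit_exprz n (norm_expi y)) oner_eq0.
  rewrite !mulf_neq0// -[0]/(0%:C%C) (inj_eq (@complexI R)) /damping expf_neq0//.
  by case/andP: r01 => /gt_eqF ->.
have le1 : l2_norm psi <= M * l2_norm (shift (op q) E%:C%C psi).
  have -> : l2_norm psi = l2_norm (S (shift (op q) E%:C%C psi)).
    by congr l2_norm; apply/funext => u; rewrite -(Sinv psi psil2 u).2.
  exact: SM.
have le2 : l2_norm (shift (op q) E%:C%C psi) <= 3 * x^-1 * l2_norm psi.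
  apply: l2_norm_le; first by rewrite !mulr_ge0 ?invr_ge0 ?sqrtr_ge0//; lra.
  rewrite -rE; apply: l2leW res; rewrite le_eqVlt; apply/orP; left; apply/eqP.
  by move: (l2_norm psi) (r^-1) => *; ring.
move: le1 le2 psi0; set P := l2_norm psi; set Q := l2_norm _ => le1 le2 P0.
have Q0 : 0 <= Q by exact: sqrtr_ge0.
have le3 : P <= `|M| * Q by rewrite (le_trans le1)// ler_wpM2r// ler_norm.
have le4 : `|M| * Q <= `|M| * (3 * x^-1 * P) by rewrite ler_wpM2l.
have : 1 <= `|M| * 3 * x^-1.
  by rewrite -(ler_pM2r P0) mul1r (le_trans le3)// (le_trans le4)// !mulrA.
by rewrite ler_pdivlMr ?(lt_le_trans ltr01 x1)// mul1r /x gerDl ler10.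
Qed.

End Weyl.
End Spectrum.

Section Symbol.
Variable R : realType.
Local Notation C := R[i].
Implicit Types (X Y xi eta : C) (lam : R).

Definition symbol (s t : R) : R := sqn (1 + expi s + expi t).

Lemma expi_neq0 (t : R) : expi t != 0.
Proof. by rewrite -normr_eq0 norm_expi oner_eq0. Qed.

Lemma expiV (t : R) : (expi t)^* = (expi t)^-1.
Proof. by rewrite invC_norm norm_expi expr1n invr1 mul1r. Qed.

Lemma symbolC s t : symbol s t = symbol t s.
Proof. by rewrite /symbol addrAC. Qed.

Lemma symbol_quadratic s t lam : let X := expi s in let Y := expi t in
  symbol s t = lam ->
  (X + 1) * Y ^+ 2 + (X ^+ 2 + 1 + (3 - lam%:C%C) * X) * Y + X * (X + 1) = 0.
Proof.
move=> X Y <-; have X0 : X != 0 := expi_neq0 _; have Y0 : Y != 0 := expi_neq0 _.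
have -> : (symbol s t)%:C%C = (1 + X + Y) * (1 + X^-1 + Y^-1).
  by rewrite /symbol sqnE !rmorphD /= rmorph1 !expiV.
field; apply/andP; split; exact: expi_neq0.
Qed.

Lemma symbol_eq1 s t : let X := expi s in let Y := expi t in
  symbol s t = 1 -> (X + 1) * (Y + 1) * (X + Y) = 0.
Proof.
move=> X Y /symbol_quadratic; rewrite -/X -/Y rmorph1 => h.
by rewrite -h; ring.
Qed.

Lemma symbol_cos (u v : R) :
  symbol (u + u) (u + v) = 1 + 4 * cos u ^+ 2 + 4 * cos u * cos v.
Proof.
rewrite /symbol sqnReIm /= add0r !cosD !sinD.
have := cos2Dsin2 u; have := cos2Dsin2 v.
move: (cos u) (sin u) (cos v) (sin v) => c s d e hv hu.
transitivity (1 + (c ^+ 2 + s ^+ 2) ^+ 2 + (c ^+ 2 + s ^+ 2) * (d ^+ 2 + e ^+ 2)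
    + 2 * (c ^+ 2 - s ^+ 2) + 2 * (c * d - s * e)
    + 2 * (c * d + s * e) * (c ^+ 2 + s ^+ 2)); first by ring.
rewrite hu hv; have -> : s ^+ 2 = 1 - c ^+ 2 by lra.
ring.
Qed.

Lemma resultant_eq0 (a b c a' b' c' Y : C) : Y != 0 ->
    a * Y ^+ 2 + b * Y + c = 0 -> a' * Y ^+ 2 + b' * Y + c' = 0 ->
  (a * c' - a' * c) ^+ 2 - (a * b' - a' * b) * (b * c' - b' * c) = 0.
Proof.
move=> Y0 h h'.
pose D1 := a * b' - a' * b; pose D2 := a * c' - a' * c; pose D3 := b * c' - b' * c.
have e1 : D1 * Y + D2 = 0.
  have -> : D1 * Y + D2 = a * (a' * Y ^+ 2 + b' * Y + c') - a' * (a * Y ^+ 2 + b * Y + c).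
    by rewrite /D1 /D2; ring.
  by rewrite h h' !mulr0 subr0.
have e2 : D2 * Y + D3 = 0.
  apply/eqP; rewrite -(mulrI_eq0 _ (mulfI Y0)); apply/eqP.
  have -> : Y * (D2 * Y + D3) = (a * Y ^+ 2 + b * Y + c) * c' - (a' * Y ^+ 2 + b' * Y + c') * c.
    by rewrite /D2 /D3; ring.
  by rewrite h h' !mul0r subr0.
have -> : (a * c' - a' * c) ^+ 2 - (a * b' - a' * b) * (b * c' - b' * c) =
   D2 * (D1 * Y + D2) - D1 * (D2 * Y + D3) by rewrite /D1 /D2 /D3; ring.
by rewrite e1 e2 !mulr0 subr0.
Qed.

Lemma shift_resultant_eq0 (a b c eta Y : C) : Y != 0 -> eta != 1 ->
    a * Y ^+ 2 + b * Y + c = 0 -> a * (eta * Y) ^+ 2 + b * (eta * Y) + c = 0 ->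
  eta * b ^+ 2 - a * c * (1 + eta) ^+ 2 = 0.
Proof.
move=> Y0 eta1 h h'; have d0 : eta - 1 != 0 by rewrite subr_eq0.
have e1 : b * eta * Y + c * (eta + 1) = 0.
  apply/eqP; rewrite -(mulrI_eq0 _ (mulfI d0)); apply/eqP.
  have -> : (eta - 1) * (b * eta * Y + c * (eta + 1)) =
    eta ^+ 2 * (a * Y ^+ 2 + b * Y + c) - (a * (eta * Y) ^+ 2 + b * (eta * Y) + c) by ring.
  by rewrite h h' mulr0 subr0.
have e2 : a * (eta + 1) * Y + b = 0.
  apply/eqP; rewrite -(mulrI_eq0 _ (mulfI (mulf_neq0 d0 Y0))); apply/eqP.
  have -> : (eta - 1) * Y * (a * (eta + 1) * Y + b) =
    (a * (eta * Y) ^+ 2 + b * (eta * Y) + c) - (a * Y ^+ 2 + b * Y + c) by ring.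
  by rewrite h h' subr0.
have -> : eta * b ^+ 2 - a * c * (1 + eta) ^+ 2 =
   b * eta * (a * (eta + 1) * Y + b) - a * (eta + 1) * (b * eta * Y + c * (eta + 1)) by ring.
by rewrite e1 e2 !mulr0 subr0.
Qed.

(* Evaluating the resultants at [X = -1], where both extreme coefficients of the
   unshifted quadratic vanish, shows that they are nonzero polynomials. *)
Lemma generic_shift lam (xi eta : C) : lam != 1 -> xi != 0 -> eta != 0 ->
    (xi, eta) != (1, 1) ->
  exists2 p : {poly C}, p != 0 & forall s t s' t',
    expi s' = xi * expi s -> expi t' = eta * expi t ->
    symbol s t = lam -> symbol s' t' = lam -> root p (expi s).
Proof.
move=> lam1 xi0 eta0; rewrite xpair_eqE negb_and => ne.
have l1 : lam%:C%C - 1 != 0 by rewrite subr_eq0 -[1]/(1%:C%C) (inj_eq (@complexI R)).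
pose a : {poly C} := 'X + 1%:P; pose c : {poly C} := 'X * ('X + 1%:P).
pose b : {poly C} := 'X * 'X + 1%:P + (3 - lam%:C%C)%:P * 'X.
have aE x : a.[x] = x + 1 by rewrite hornerD hornerX hornerC.
have bE x : b.[x] = x * x + 1 + (3 - lam%:C%C) * x.
  by rewrite !hornerD !hornerM hornerX !hornerC.
have cE x : c.[x] = x * (x + 1) by rewrite hornerM hornerD hornerX hornerC.
clearbody a b c.
have [xi1|xi1] := eqVneq xi 1.
  have eta1 : eta != 1 by move: ne; rewrite xi1 eqxx.
  pose p := eta%:P * b ^+ 2 - a * c * ((1 + eta) ^+ 2)%:P.
  have pE x : p.[x] = eta * b.[x] ^+ 2 - a.[x] * c.[x] * (1 + eta) ^+ 2.
    by rewrite hornerD hornerN !hornerM !hornerC.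
  exists p.
    have : eta * (lam%:C%C - 1) ^+ 2 != 0 by rewrite mulf_neq0// expf_neq0.
    apply: contra_neq => /(congr1 (fun p => p.[-1])); rewrite horner0 pE aE bE cE => <-.
    ring.
  move=> s t s' t' se te h h'.
  have ss : expi s' = expi s by rewrite se xi1 mul1r.
  have := symbol_quadratic h; have := symbol_quadratic h'; rewrite ss te => e' e.
  rewrite /root pE aE bE cE -expr2; apply/eqP.
  exact: shift_resultant_eq0 (expi_neq0 t) eta1 e e'.
pose a' : {poly C} := (xi%:P * 'X + 1%:P) * (eta ^+ 2)%:P.
pose b' : {poly C} := ((xi ^+ 2)%:P * ('X * 'X) + 1%:P + ((3 - lam%:C%C) * xi)%:P * 'X) * eta%:P.
pose c' : {poly C} := (xi%:P * 'X) * (xi%:P * 'X + 1%:P).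
have a'E x : a'.[x] = (xi * x + 1) * eta ^+ 2.
  by rewrite !(hornerM, hornerD) !hornerC hornerX.
have b'E x : b'.[x] = (xi ^+ 2 * (x * x) + 1 + (3 - lam%:C%C) * xi * x) * eta.
  by rewrite !(hornerM, hornerD) !hornerC hornerX.
have c'E x : c'.[x] = (xi * x) * (xi * x + 1).
  by rewrite !(hornerM, hornerD) !hornerC hornerX.
clearbody a' b' c'.
pose p := (a * c' - a' * c) ^+ 2 - (a * b' - a' * b) * (b * c' - b' * c).
have pE x : p.[x] = (a.[x] * c'.[x] - a'.[x] * c.[x]) ^+ 2 -
    (a.[x] * b'.[x] - a'.[x] * b.[x]) * (b.[x] * c'.[x] - b'.[x] * c.[x]).
  by rewrite !(hornerD, hornerN, hornerM).
exists p.
  have : (lam%:C%C - 1) ^+ 2 * eta ^+ 2 * xi * (1 - xi) ^+ 2 != 0.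
    by rewrite !mulf_neq0// ?expf_neq0// subr_eq0 eq_sym.
  apply: contra_neq => /(congr1 (fun p => p.[-1])).
  rewrite horner0 pE aE bE cE a'E b'E c'E => /eqP; rewrite -oppr_eq0 => /eqP <-.
  ring.
move=> s t s' t' se te h h'.
have := symbol_quadratic h; have := symbol_quadratic h'; rewrite se te => e' e.
rewrite /root pE aE bE cE a'E b'E c'E; apply/eqP.
apply: (resultant_eq0 (expi_neq0 t)); [rewrite -[RHS]e|rewrite -[RHS]e']; ring.
Qed.

Lemma avoid_roots (p : {poly C}) (phi : R -> C) (lo hi : R) : p != 0 -> lo < hi ->
    (forall x y, lo < x < hi -> lo < y < hi -> phi x = phi y -> x = y) ->
  exists2 x, lo < x < hi & ~~ root p (phi x).
Proof.
move=> p0 lh inj; apply: contrapT => /forall2NP none.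
pose n := size p; pose pt k := lo + (hi - lo) * ((k.+1)%:R / (n.+1)%:R).
have n0 : (0 : R) < (n.+1)%:R by rewrite ltr0n.
have ptI k : (k < n)%N -> lo < pt k < hi.
  move=> kn; have d0 : 0 < hi - lo by rewrite subr_gt0.
  have r0 : (0 : R) < (k.+1)%:R / (n.+1)%:R by rewrite divr_gt0 ?ltr0n.
  have r1 : (k.+1)%:R / (n.+1)%:R < 1 :> R by rewrite ltr_pdivrMr// mul1r ltr_nat ltnS.
  by rewrite /pt; move: (_ / _) r0 r1 => r r0 r1; apply/andP; split; nra.
pose rs := [seq phi (pt k) | k <- iota 0 n].
suff : (size rs < size p)%N by rewrite size_map size_iota ltnn.
apply: max_poly_roots => //.
  apply/allP => _ /mapP[k + ->]; rewrite mem_iota => /andP[_ kn].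
  by case: (none (pt k)) => [/(_ (ptI _ kn))|/negP]//; rewrite negbK.
rewrite map_inj_in_uniq ?iota_uniq// => j k; rewrite !mem_iota => /andP[_ jn] /andP[_ kn].
move/(inj _ _ (ptI _ jn) (ptI _ kn)); rewrite /pt => /addrI /mulfI.
rewrite subr_eq0 gt_eqF// => /(_ isT) /mulIf; rewrite invr_eq0 gt_eqF// => /(_ isT).
by move=> /eqP; rewrite eqr_nat => /eqP [].
Qed.

Lemma expi_inj (s t : R) : 0 < s < pi -> 0 < t < pi -> expi s = expi t -> s = t.
Proof.
move=> /andP[s0 s1] /andP[t0 t1] /(congr1 (@complex.Re R)) /= /cos_inj; apply;
  by rewrite in_itv /= !ltW.
Qed.

End Symbol.

Section Stable.
Variable R : realType.

Lemma stable_sign (I : finType) (P : pred I) (h : I -> R -> R) (l : R) :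
    (forall i, {for 0, continuous (h i)}) -> (forall i, P i -> h i 0 != l) ->
  exists2 d : R, 0 < d & forall x, `|x| < d -> forall i, P i ->
    (h i x < l) = (h i 0 < l) /\ h i x != l.
Proof.
move=> hc hl.
have /choice[d hd] : forall i, exists d : R, 0 < d /\ forall x, `|x| < d -> P i ->
    (h i x < l) = (h i 0 < l) /\ h i x != l.
  move=> i; have [Pi|] := boolP (P i); last by exists 1.
  have := hl i Pi; rewrite neq_lt => /orP[lt|lt].
    have [d /= d0 hd] := (nbhs_ballP _ _).1 (cvgr_lt _ (hc i) _ lt).
    exists d; split=> // x xd _.
    have hx : h i x < l by apply: hd; rewrite /ball /= sub0r normrN.
    by rewrite hx lt lt_eqF.
  have [d /= d0 hd] := (nbhs_ballP _ _).1 (cvgr_gt _ (hc i) _ lt).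
  exists d; split=> // x xd _.
  have hx : l < h i x by apply: hd; rewrite /ball /= sub0r normrN.
  by rewrite !ltNge !ltW// gt_eqF.
exists (\big[Num.min/1]_i d i).
  by rewrite lt_bigmin// => i _; exact: (hd i).1.
move=> x xd i; apply: (hd i).2; apply: lt_le_trans xd _.
exact: bigmin_le_cond.
Qed.

Lemma symbol_continuous (f g : R -> R) : {for 0, continuous f} -> {for 0, continuous g} ->
  {for 0, continuous (fun x => symbol (f x) (g x))}.
Proof.
move=> fc gc.
have comp (h k : R -> R) : continuous h -> {for 0, continuous k} ->
    {for 0, continuous (fun x => h (k x))}.
  by move=> hc kc; apply: (@continuous_comp _ _ _ k h) => //; exact: hc.
have C k := comp (@cos R) k (@continuous_cos R).
have S k := comp (@sin R) k (@continuous_sin R).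
have -> : (fun x => symbol (f x) (g x)) = (fun x => (1 + cos (f x) + cos (g x)) ^+ 2
    + (0 + sin (f x) + sin (g x)) ^+ 2).
  by apply/funext => x; rewrite /symbol sqnReIm.
have sq (h : R -> R) : {for 0, continuous h} -> {for 0, continuous (fun x => h x ^+ 2)}.
  by move=> hc; apply: (comp (fun y => y ^+ 2) h _ hc); exact: exprn_continuous.
apply: cvgD; apply: sq; apply: cvgD; try apply: cvgD; try exact: cvg_cst.
- exact: C.
- exact: C.
- exact: S.
- exact: S.
Qed.

Lemma continuous_addl (a : R) : {for 0, continuous (fun x : R => a + x)}.
Proof. by apply: cvgD; [exact: cvg_cst|exact: cvg_id]. Qed.

End Stable.

Section Counting.
Variable R : realType.
Local Notation C := R[i].

Definition ang n (s : R) (j : 'I_n.+1) : R := s + pi *+ 2 / n.+1%:R *+ j.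

Lemma ang0 n s : ang s (ord0 : 'I_n.+1) = s.
Proof. by rewrite /ang mulr0n addr0. Qed.

Lemma angD n s x (j : 'I_n.+1) : ang (s + x) j = ang s j + x.
Proof. by rewrite /ang addrAC. Qed.

Lemma expi_ang n s (j : 'I_n.+1) : expi (ang s j) = expi (pi *+ 2 / n.+1%:R) ^+ j * expi s.
Proof. by rewrite /ang expiD expiX mulrC. Qed.

Lemma root_eq1 n (j : 'I_n.+1) :
  (expi (pi *+ 2 / n.+1%:R : R) ^+ j == 1) = (j == ord0).
Proof.
rewrite -(expr0 (expi (pi *+ 2 / n.+1%:R : R))) (eq_prim_root_expr (expi_prim R (ltn0Sn n))).
by rewrite !modn_small.
Qed.

Section Grid.
Variables p1 p2 : nat.
Local Notation grid := ('I_p1.+1 * 'I_p2.+1)%type.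

Definition gsym (s t : R) (g : grid) : R := symbol (ang s g.1) (ang t g.2).
Definition nlt (lam s t : R) : nat := #|[pred g : grid | gsym s t g < lam]|.
Definition nle (lam s t : R) : nat := #|[pred g : grid | gsym s t g <= lam]|.

Lemma count_jump (lam : R) : 0 < lam < 9 -> lam != 1 ->
  exists s t s' t', [/\ 0 <= s <= pi *+ 2, 0 <= t <= pi *+ 2, 0 <= s' <= pi *+ 2,
    0 <= t' <= pi *+ 2 & (nle lam s t < nlt lam s' t')%N].
Proof.
move=> lam09 lam1.
have /choice[p hp] : forall g : grid, exists p : {poly C}, p != 0 /\ (g != (ord0, ord0) ->
    forall s t, symbol s t = lam -> gsym s t g = lam -> root p (expi s)).
  move=> g; have [g0|g0] := eqVneq g (ord0, ord0).
    by exists 1; rewrite oner_eq0.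
  pose w n (j : 'I_n.+1) : C := expi (pi *+ 2 / n.+1%:R) ^+ j.
  have w0 n j : @w n j != 0 by rewrite expf_neq0 ?expi_neq0.
  have ne : (w _ g.1, w _ g.2) != (1, 1).
    apply: contra g0; case: (g) => j l /=; rewrite !xpair_eqE => /andP[].
    by rewrite !root_eq1 => -> ->.
  have [p p0 hp] := generic_shift lam1 (w0 _ g.1) (w0 _ g.2) ne.
  exists p; split=> // _ s t h h'; apply: hp h h'; exact: expi_ang.
pose E := Num.sqrt lam.
have EE : E ^+ 2 = lam by rewrite sqr_sqrtr//; case/andP: lam09 => /ltW.
have E0 : 0 < E by rewrite sqrtr_gt0; case/andP: lam09.
have E3 : E < 3.
  rewrite -(ltr_pXn2r (ltn0Sn 1)) ?nnegrE ?ltW// EE.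
  by case/andP: lam09 => _ h; apply: lt_le_trans h _; lra.
pose lo := `|E - 1| / 2; pose hi := Num.min 1 ((E + 1) / 2).
have lo0 : 0 <= lo by rewrite divr_ge0.
have lohi : lo < hi.
  by rewrite lt_min /lo; have [h|h] := lerP 1 E; apply/andP; split; lra.
have hi1 x : x < hi -> x < 1 by rewrite lt_min => /andP[].
pose phi (c : R) := expi (acos c + acos c).
have acosin (c : R) : 0 < c < 1 -> cos (acos c) = c.
  by move=> h; rewrite acosK// in_itv /=; apply/andP; split; lra.
have inj x y : lo < x < hi -> lo < y < hi -> phi x = phi y -> x = y.
  move=> /andP[x0 /hi1 x1] /andP[y0 /hi1 y1] /(congr1 (@complex.Re R)) /=.
  rewrite !cosD -!expr2 !sin2cos2 !acosin ?(le_lt_trans lo0)// => e.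
  have {}e : x ^+ 2 = y ^+ 2 by lra.
  have := lt_trans (le_lt_trans lo0 x0) x1.
  by move/eqP: e; rewrite eqrXn2 ?(le_trans lo0) ?ltW// => /eqP.
have [|c /andP[c0 /[dup] chi /hi1 c1] nr] := @avoid_roots R (\prod_g p g) phi lo hi _ lohi inj.
  by apply/prodf_neq0 => g _; exact: (hp g).1.
have c00 : 0 < c := le_lt_trans lo0 c0.
pose r := (lam - 1 - 4 * c ^+ 2) / (4 * c).
have r1 : -1 < r < 1.
  have hE : (2 * c - 1) ^+ 2 < E ^+ 2 /\ E ^+ 2 < (2 * c + 1) ^+ 2.
    have c2 : c < (E + 1) / 2 by move: chi; rewrite lt_min => /andP[].
    have := c0; rewrite /lo ltr_pdivrMr// ltr_norml => /andP[h1 h2].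
    by split; nra.
  rewrite /r -EE ltr_pdivlMr ?ltr_pdivrMr ?mulr_gt0//.
  by case: hE => h1 h2; apply/andP; split; lra.
pose u := acos c; pose v := acos r.
have cu : cos u = c by rewrite acosin ?c00.
have cv : cos v = r by rewrite acosK// in_itv /= !ltW//; case/andP: r1.
have u0 : 0 < u < pi.
  by rewrite /u acos_gt0 ?acos_ltpi//; apply/andP; split; lra.
have v0 : 0 < v < pi.
  by rewrite /v acos_gt0 ?acos_ltpi//; apply/andP; split; lra.
have u2 : u + u < pi.
  have pg := pi_gt0 R; have : u < pi / 2; last by lra.
  have uin : u \in `[0, pi] by rewrite in_itv /=; apply/andP; split; lra.
  have hin : pi / 2 \in `[0, pi :> R] by rewrite in_itv /=; apply/andP; split; lra.
  by rewrite -(ltr_cos uin hin) cos_pihalf cu.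
have sym x : symbol (u + u) (u + v + x) = 1 + 4 * c ^+ 2 + 4 * c * cos (v + x).
  by rewrite -addrA symbol_cos cu.
have sym0 : symbol (u + u) (u + v) = lam.
  rewrite -[u + v]addr0 sym addr0 cv /r; field; lra.
pose h (g : grid) x := gsym (u + u) (u + v + x) g.
have hcont g : {for 0, continuous (h g)}.
  rewrite /h /gsym; apply: symbol_continuous; first exact: cvg_cst.
  have -> : (fun x => ang (u + v + x) g.2) = (fun x => ang (u + v) g.2 + x).
    by apply/funext => x; rewrite angD.
  exact: continuous_addl.
have hne g : g != (ord0, ord0) -> h g 0 != lam.
  move=> g0; apply: contra nr => /eqP hg; rewrite (bigD1 g)//= rootM.
  by rewrite ((hp g).2 g0 _ _ sym0)// -hg /h addr0.
have [d d0 hd] := stable_sign hcont hne.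
pose x := Num.min d (Num.min v (pi - v)) / 2.
have x0 : 0 < x.
  by rewrite divr_gt0// !lt_min d0 subr_gt0.
have xd : x < d.
  have : x * 2 <= d by rewrite divfK// ge_min lexx.
  lra.
have xv : x < v.
  have : x * 2 <= v by rewrite divfK// !ge_min lexx orbT.
  lra.
have xpv : x < pi - v.
  have : x * 2 <= pi - v by rewrite divfK// !ge_min lexx !orbT.
  lra.
clearbody x.
have [vi [vpi vmi]] : v \in `[0, pi] /\ v + x \in `[0, pi] /\ v - x \in `[0, pi].
  by clear -v0 x0 xv xpv; rewrite !in_itv /=; split; [|split]; apply/andP; split; lra.
have h0lt : h (ord0, ord0) x < lam.
  rewrite /h /gsym !ang0 sym -sym0 -[u + v in ltRHS]addr0 sym addr0 ltrD2l ltr_pM2l ?mulr_gt0//.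
  by rewrite ltr_cos// ltrDl.
have h0gt : lam < h (ord0, ord0) (- x).
  rewrite /h /gsym !ang0 sym -sym0 -[u + v in ltLHS]addr0 sym addr0 ltrD2l ltr_pM2l ?mulr_gt0//.
  by rewrite ltr_cos// gtrDl oppr_lt0.
have xdn : `|x| < d by rewrite gtr0_norm.
exists (u + u), (u + v - x), (u + u), (u + v + x).
split; try by clear -u0 v0 u2 x0 xv xpv; rewrite ?mulr2n; apply/andP; split; lra.
apply: proper_card; apply/properP; split; last first.
  by exists (ord0, ord0); rewrite inE -?ltNge; [exact: h0lt|exact: h0gt].
apply/fintype.subsetP => g; rewrite !inE => hg.
have g0 : g != (ord0, ord0) by apply: contraTneq hg => ->; rewrite -ltNge.
have [e ne] : (h g (- x) < lam) = (h g 0 < lam) /\ h g (- x) != lam.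
  by apply: hd; rewrite ?normrN.
have [+ _] := hd _ xdn g g0; rewrite -e => ->.
by rewrite lt_neqAle ne.
Qed.

End Grid.
End Counting.
Section Grid2.
Variable R : realType.
Local Notation C := R[i].

Lemma symbol_pi (x y : R) : symbol (pi + x) y =
  1 + 4 * sin (x / 2) * (sin (x / 2) - sin (y - x / 2)).
Proof.
pose u := pi / 2 + x / 2.
have -> : pi + x = u + u by rewrite /u; field.
have -> : y = u + (y - u) by ring.
rewrite symbol_cos.
have -> : cos u = - sin (x / 2) by rewrite /u addrC cosDpihalf.
have -> : cos (y - u) = sin (y - x / 2).
  have -> : y - u = (y - x / 2) - pi / 2 by rewrite /u; ring.
  exact: cosBpihalf.
have -> : u + (y - u) - x / 2 = y - x / 2 by ring.
ring.
Qed.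

Lemma avoid_finite (s : seq C) : exists2 t : R, 0 < t < pi & expi t \notin s.
Proof.
have pg := pi_gt0 R.
have [|t t0 nr] := @avoid_roots R (\prod_(z <- s) ('X - z%:P)) (@expi R) 0 pi _ pg (@expi_inj R).
  by apply: monic_neq0; exact: monic_prod_XsubC.
by exists t; rewrite // -root_prod_XsubC.
Qed.

Section Grid.
Variables p1 p2 : nat.
Local Notation grid := ('I_p1.+1 * 'I_p2.+1)%type.

Lemma card_column (b b0 : pred grid) (A : {set 'I_p2.+1}) :
    (forall g, g.1 != ord0 -> b g = b0 g) -> (forall l, b (ord0, l) = (l \in A)) ->
  #|b| = (#|A| + #|[pred g | (g.1 != ord0) && b0 g]|)%N.
Proof.
move=> hb hA; rewrite -(cardID [pred g : grid | g.1 == ord0]); congr addn.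
  rewrite -(card_imset A (_ : injective (fun l => (ord0, l) : grid))).
    apply: eq_card => -[j l]; rewrite !inE /=; apply/andP/imsetP => [[bl /eqP j0]|[l' l'A [-> ->]]].
      by exists l; rewrite -?hA -?j0.
    by split=> //; rewrite -hA in l'A.
  by move=> l l' [].
by apply: eq_card => g; rewrite !inE; case: eqP => //= /eqP /hb; rewrite unfold_in.
Qed.

Lemma count_jump1 : odd p2.+1 ->
  exists s t s' t' : R, [/\ 0 <= s <= pi *+ 2, 0 <= t <= pi *+ 2, 0 <= s' <= pi *+ 2,
    0 <= t' <= pi *+ 2 & (nle p1 p2 1 s t < nlt p1 p2 1 s' t')%N].
Proof.
move=> p2odd; have pg := pi_gt0 R.
pose w n : C := expi (pi *+ 2 / n.+1%:R).
have [y y0 yn] := avoid_finite ([seq w p2 ^- l | l : 'I_p2.+1 <- enum 'I_p2.+1]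
   ++ [seq - w p2 ^- l | l : 'I_p2.+1 <- enum 'I_p2.+1]
   ++ [seq w p1 ^+ jl.1 / w p2 ^+ jl.2 | jl : grid <- enum {: grid}]).
have w0 n k : w n ^+ k != 0 by rewrite expf_neq0 ?expi_neq0.
have yl (l : 'I_p2.+1) : expi (ang y l) = w p2 ^+ l * expi y by exact: expi_ang.
have yl1 (l : 'I_p2.+1) : expi (ang y l) != 1.
  apply: contraNneq yn => e; rewrite mem_cat; apply/orP; left;
    apply/mapP; exists l; first by rewrite mem_enum.
  by apply: (mulfI (w0 p2 l)); rewrite -yl e mulfV.
have ylN1 (l : 'I_p2.+1) : expi (ang y l) != -1.
  apply: contraNneq yn => e; rewrite !mem_cat; apply/orP; right; apply/orP; left.
  apply/mapP; exists l; first by rewrite mem_enum.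
  by apply: (mulfI (w0 p2 l)); rewrite -yl e mulrN mulfV.
have yljl (j : 'I_p1.+1) (l : 'I_p2.+1) : expi (ang y l) != w p1 ^+ j.
  apply: contraNneq yn => e; rewrite !mem_cat; apply/orP; right; apply/orP; right.
  apply/mapP; exists (j, l); first by rewrite mem_enum.
  by apply: (mulfI (w0 p2 l)); rewrite -yl e /= mulrCA mulfV// mulr1.
have sinl (l : 'I_p2.+1) : sin (ang y l) != 0.
  apply/eqP => s0; have := cos2Dsin2 (ang y l); rewrite s0 expr0n addr0 => /eqP.
  rewrite sqrf_eq1 => /orP[/eqP c1|/eqP c1].
    by have /eqP := yl1 l; apply; rewrite /expi s0 c1.
  by have /eqP := ylN1 l; apply; rewrite /expi s0 c1; apply/eqP; rewrite eq_complex /= oppr0 !eqxx.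
pose h (g : grid) x := gsym (pi + x) y g.
have hcont g : {for 0, continuous (h g)}.
  rewrite /h /gsym; apply: symbol_continuous; last exact: cvg_cst.
  have -> : (fun x : R => ang (pi + x) g.1) = (fun x => ang pi g.1 + x).
    by apply/funext => x; rewrite angD.
  exact: continuous_addl.
have hne (g : grid) : g.1 != ord0 -> h g 0 != 1.
  move=> g0; rewrite /h /gsym addr0; apply/eqP => /symbol_eq1 /eqP.
  have e1 : expi (ang pi g.1) = - w p1 ^+ g.1.
    rewrite expi_ang /expi cospi sinpi -[RHS]mulrN1; congr (_ * _).
    by apply/eqP; rewrite eq_complex /= oppr0 !eqxx.
  rewrite e1 !mulf_eq0 -orbA => /or3P[|/eqP|].
  - by rewrite addrC subr_eq0 eq_sym root_eq1 (negPf g0).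
  - by move/eqP; rewrite addr_eq0 (negPf (ylN1 _)).
  - by rewrite addrC subr_eq0 (negPf (yljl _ _)).
have [d d0 hd] := stable_sign hcont hne.
pose k (l : 'I_p2.+1) (x : R) := sin (x / 2) - sin (ang y l - x / 2).
have kcont l : {for 0, continuous (k l)}.
  rewrite /k; apply: cvgB.
    apply: (@continuous_comp _ _ _ (fun x : R => x / 2) (@sin R)); last exact: continuous_sin.
    by apply: cvgMl; exact: cvg_id.
  apply: (@continuous_comp _ _ _ (fun x : R => ang y l - x / 2) (@sin R));
    last exact: continuous_sin.
  by apply: cvgB; [exact: cvg_cst|apply: cvgMl; exact: cvg_id].
have kne l : true -> k l 0 != 0.
  by move=> _; rewrite /k mul0r sin0 subr0 sub0r oppr_eq0.
have [e e0 he] := stable_sign kcont kne.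
pose x := Num.min d (Num.min e 1) / 2.
have x0 : 0 < x by rewrite divr_gt0// !lt_min d0 e0 /=.
have xd : x < d.
  have : x * 2 <= d by rewrite divfK// ge_min lexx.
  lra.
have xe : x < e.
  have : x * 2 <= e by rewrite divfK// !ge_min lexx orbT.
  lra.
have x1 : x < 1.
  have : x * 2 <= 1 by rewrite divfK// !ge_min lexx !orbT.
  lra.
clearbody x.
have p2' := pi_ge2 R.
have s0 : 0 < sin (x / 2) by apply: sin_gt0_pi; apply/andP; split; lra.
pose pos := [set l : 'I_p2.+1 | 0 < sin (ang y l)]%SET.
(* On the column [j = 0] one has [h (0, l) z - 1 = 4 * sin (z / 2) * k l z], where
   [k l z] keeps its sign near [z = 0]: crossing [0] flips every entry, and an odd
   number of entries cannot split evenly. *)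
have col (l : 'I_p2.+1) : (h (ord0, l) x < 1) = (l \in pos) /\
    (h (ord0, l) (- x) < 1) = (l \notin pos) /\ h (ord0, l) (- x) != 1 /\ h (ord0, l) x != 1.
  have hE (z : R) : h (ord0, l) z = 1 + 4 * (sin (z / 2) * k l z).
    by rewrite /h /gsym /= ang0 symbol_pi /k; ring.
  have kz (z : R) : `|z| < e -> (k l z < 0) = (l \in pos) /\ k l z != 0.
    move=> ze; have [-> ->] := he z ze l isT; split=> //.
    by rewrite /k mul0r sin0 subr0 sub0r oppr_lt0 /pos inE.
  have [kx kx0] : (k l x < 0) = (l \in pos) /\ k l x != 0 by apply: kz; rewrite gtr0_norm.
  have [ky ky0] : (k l (- x) < 0) = (l \in pos) /\ k l (- x) != 0.
    by apply: kz; rewrite normrN gtr0_norm.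
  have sN : sin (- x / 2) = - sin (x / 2) by rewrite mulNr sinN.
  rewrite !hE sN mulNr mulrN; split; [|split; [|split]].
  - by rewrite gtrDl pmulr_rlt0// pmulr_rlt0.
  - rewrite gtrDl oppr_lt0 pmulr_rgt0// pmulr_rgt0// -ky -leNgt le_eqVlt eq_sym.
    by rewrite (negPf ky0).
  - by rewrite -subr_eq0 addrAC subrr add0r oppr_eq0 !mulf_neq0// gt_eqF.
  - by rewrite -subr_eq0 addrAC subrr add0r !mulf_neq0// gt_eqF.
pose b0 (g : grid) := h g 0 < 1.
have xdn : `|x| < d by rewrite gtr0_norm.
have xdN : `|- x| < d by rewrite normrN.
have ltE g : h g x != 1 /\ h g (- x) != 1.
  have [g0|g0] := eqVneq g.1 ord0; last first.
    by split; [exact: (hd _ xdn g g0).2|exact: (hd _ xdN g g0).2].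
  by case: g g0 => j l /= ->; have [_ [_ []]] := col l.
have nltx : nlt p1 p2 1 (pi + x) y = (#|pos| + #|[pred g | (g.1 != ord0) && b0 g]|)%N.
  apply: card_column => [g g0|l]; first exact: (hd _ xdn g g0).1.
  exact: (col l).1.
have nltN : nlt p1 p2 1 (pi - x) y = (#|(~: pos)%SET| + #|[pred g | (g.1 != ord0) && b0 g]|)%N.
  apply: card_column => [g g0|l]; first exact: (hd _ xdN g g0).1.
  by rewrite finset.in_setC; exact: (col l).2.1.
have nlex : nle p1 p2 1 (pi + x) y = nlt p1 p2 1 (pi + x) y.
  by apply: eq_card => g; rewrite !inE le_eqVlt (negPf (ltE g).1).
have nleN : nle p1 p2 1 (pi - x) y = nlt p1 p2 1 (pi - x) y.
  by apply: eq_card => g; rewrite !inE le_eqVlt (negPf (ltE g).2).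
have : #|pos| != #|(~: pos)%SET|.
  apply: contraTneq p2odd => e2; have := cardsC pos; rewrite card_ord -e2 => <-.
  by rewrite addnn odd_double.
rewrite neq_ltn => /orP[lt|lt].
- exists (pi + x), y, (pi - x), y; rewrite nlex nltx nltN ltn_add2r.
  by split=> //; clear -p2' x0 x1 y0; rewrite ?mulr2n; apply/andP; split; lra.
- exists (pi - x), y, (pi + x), y; rewrite nleN nltx nltN ltn_add2r.
  by split=> //; clear -p2' x0 x1 y0; rewrite ?mulr2n; apply/andP; split; lra.
Qed.

Lemma generic_level (lam : R) : exists s t, [/\ 0 <= s <= pi *+ 2, 0 <= t <= pi *+ 2 &
  forall g : grid, gsym s t g != lam].
Proof.
have pg := pi_gt0 R.
pose w n : C := expi (pi *+ 2 / n.+1%:R).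
have w0 n k : w n ^+ k != 0 by rewrite expf_neq0 ?expi_neq0.
have [s s0 sn] := avoid_finite [seq - w p1 ^- j | j : 'I_p1.+1 <- enum 'I_p1.+1].
have sj (j : 'I_p1.+1) : expi (ang s j) + 1 != 0.
  apply: contraNneq sn => /eqP; rewrite addr_eq0 => /eqP e.
  apply/mapP; exists j; first by rewrite mem_enum.
  by apply: (mulfI (w0 p1 j)); rewrite -expi_ang e mulrN mulfV.
pose a (g : grid) := (expi (ang s g.1) + 1) * (w p2 ^+ g.2) ^+ 2.
pose b (g : grid) := (expi (ang s g.1) ^+ 2 + 1 + (3 - lam%:C%C) * expi (ang s g.1)) * w p2 ^+ g.2.
pose c (g : grid) := expi (ang s g.1) * (expi (ang s g.1) + 1).
pose p (g : grid) : {poly C} := (a g)%:P * 'X^2 + (b g)%:P * 'X + (c g)%:P.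
have p0 : \prod_g p g != 0.
  apply/prodf_neq0 => g _; apply/eqP => /(congr1 (fun q : {poly C} => q`_2)).
  rewrite coef0 /p !coefD !coefCM coefXn coefX coefC /= mulr0 !addr0 mulr1 => /eqP.
  by rewrite /a mulf_eq0 (negPf (sj _)) expf_eq0 (negPf (w0 _ _)) andbF.
have [t t0 nr] := avoid_roots p0 pg (@expi_inj R).
exists s, t; split.
- by clear -s0 pg; rewrite mulr2n; apply/andP; split; lra.
- by clear -t0 pg; rewrite mulr2n; apply/andP; split; lra.
move=> g; apply: contraNneq nr => hg; rewrite (bigD1 g)//= rootM; apply/orP; left.
rewrite /root /p !hornerD !hornerM !hornerC !hornerX.
have := symbol_quadratic hg; rewrite [expi (ang t _)]expi_ang -/(w p2) => <-.
by apply/eqP; rewrite /a /b /c; ring.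
Qed.

End Grid.

Lemma gsym_swap p1 p2 (s t : R) (j : 'I_p1.+1) (l : 'I_p2.+1) : gsym s t (j, l) = gsym t s (l, j).
Proof. by rewrite /gsym symbolC. Qed.

Lemma swap_inj (A B : Type) : injective (fun x : A * B => (x.2, x.1)).
Proof. by move=> [a b] [a' b'] [-> ->]. Qed.

Lemma card_swap (A B : finType) (P : pred (A * B)) (Q : pred (B * A)) :
  (forall a b, P (a, b) = Q (b, a)) -> #|P| = #|Q|.
Proof.
move=> PQ; rewrite -(fintype.card_image (@swap_inj A B) P); apply: eq_card => -[b a].
apply/fintype.imageP/idP => [[[a' b'] + [-> ->]]|h]; first by rewrite unfold_in PQ.
by exists (a, b); rewrite // unfold_in PQ.
Qed.

Lemma count_jump_odd p1 p2 (lam : R) : 0 < lam < 9 -> odd p1.+1 || odd p2.+1 ->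
  exists s t s' t' : R, [/\ 0 <= s <= pi *+ 2, 0 <= t <= pi *+ 2, 0 <= s' <= pi *+ 2,
    0 <= t' <= pi *+ 2 & (nle p1 p2 lam s t < nlt p1 p2 lam s' t')%N].
Proof.
have [-> _|lam1 lam09 _] := eqVneq lam 1; last exact: count_jump.
case/orP => [p1o|p2o]; last exact: count_jump1.
have [s [t [s' [t' [hs ht hs' ht' h]]]]] := count_jump1 p2 p1o.
exists t, s, t', s'; split=> //.
suff -> : nle p1 p2 1 t s = nle p2 p1 1 s t.
  suff -> : nlt p1 p2 1 t' s' = nlt p2 p1 1 s' t' by [].
  by apply: card_swap => j l /=; rewrite gsym_swap.
by apply: card_swap => j l /=; rewrite gsym_swap.
Qed.

End Grid2.

Section FreeBands.
Variables (R : realType) (p1 p2 : nat).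
Local Notation C := R[i].
Local Notation grid := ('I_p1.+1 * 'I_p2.+1)%type.
Local Notation cell := ('I_p1.+1 * 'I_p2.+1 * bool)%type.
Local Open Scope sesquilinear_scope.

Definition uroot n : C := expi (pi *+ 2 / n.+1%:R).
Definition chi n (j a : 'I_n.+1) : C := uroot n ^+ (j * a).

Lemma uroot_prim n : (n.+1).-primitive_root (uroot n).
Proof. exact: expi_prim. Qed.

Lemma uroot_neq0 n k : uroot n ^+ k != 0.
Proof. by rewrite expf_neq0 ?expi_neq0. Qed.

Lemma conj_uroot n k : (uroot n ^+ k)^* = (uroot n ^+ k)^-1.
Proof. by rewrite /uroot expiX expiV. Qed.

Lemma chi_orth n (j j' : 'I_n.+1) :
  \sum_a chi j a * (chi j' a)^* = if j == j' then (n.+1)%:R else 0.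
Proof.
pose z := uroot n ^+ j / uroot n ^+ j'.
have chiE a : chi j a * (chi j' a)^* = z ^+ a.
  by rewrite /chi conj_uroot !exprM -exprVn -exprMn.
under eq_bigr do rewrite chiE.
have [jj|jj] := eqVneq.
  rewrite /z jj mulfV ?uroot_neq0//; under eq_bigr do rewrite expr1n.
  by rewrite sumr_const card_ord.
have z1 : z - 1 != 0.
  rewrite subr_eq0; apply: contra jj => /eqP e.
  have /eqP : uroot n ^+ j = uroot n ^+ j'.
    by rewrite -[LHS](divfK (uroot_neq0 n j')) -/z e mul1r.
  by rewrite (eq_prim_root_expr (uroot_prim n)) !modn_small.
apply/eqP; rewrite -(mulrI_eq0 _ (mulfI z1)) -subrX1 /z exprMn exprVn -!exprM.
rewrite !(mulnC _ n.+1) !exprM (prim_expr_order (uroot_prim n)) !expr1n.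
by rewrite mulfV ?oner_eq0// subrr.
Qed.

Lemma phaseM b (x y : C) : phase b (x * y) = phase b x * phase b y.
Proof. by case: b => //=; rewrite rmorphM. Qed.

Lemma phaseD b (x y : C) : phase b (x + y) = phase b x + phase b y.
Proof. by case: b => //=; rewrite rmorphD. Qed.

Lemma chi_step n (j a : 'I_n.+1) b : chi j (step b a) = phase b (uroot n ^+ j) * chi j a.
Proof.
have ordSE (k : 'I_n.+1) : chi j (ordS k) = uroot n ^+ j * chi j k.
  rewrite /chi -exprD -mulnS mulnC mulnC; apply/eqP.
  rewrite (eq_prim_root_expr (uroot_prim n)) /=.
  by rewrite modnMmr.
case: b; first exact: ordSE.
rewrite /= -[in RHS](ord_predK a) ordSE mulrA conj_uroot mulVf ?mul1r//.
exact: uroot_neq0.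
Qed.

Variables s t : R.

Definition ampl (g : grid) : C := 1 + expi (ang s g.1) + expi (ang t g.2).
Definition uphase (g : grid) : C :=
  if ampl g == 0 then 1 else ampl g / `|ampl g|.

Lemma uphaseE g : ampl g = `|ampl g| * uphase g.
Proof.
rewrite /uphase; case: eqP => [->|/eqP a0]; first by rewrite normr0 mul0r.
by rewrite mulrCA mulfV ?mulr1// normr_eq0.
Qed.

Lemma norm_uphase g : uphase g * (uphase g)^* = 1.
Proof.
rewrite -normCK /uphase; case: eqP => [_|/eqP a0]; first by rewrite normr1 expr1n.
by rewrite normrM normfV normr_id mulfV ?expr1n// normr_eq0.
Qed.

Definition spinor (r c : cell) : C :=
  chi r.1.1 c.1.1 * chi r.1.2 c.1.2 * (if c.2 then uphase r.1 else (-1) ^+ r.2).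

Definition free_eig (r : cell) : R := (-1) ^+ r.2 * Num.sqrt (gsym s t r.1).

Lemma sqrt_gsym g : (Num.sqrt (gsym s t g))%:C%C = `|ampl g|.
Proof.
rewrite /gsym /symbol /sqn -/(ampl g) sqrtr_sqr ger0_norm//.
exact: normc_ge0.
Qed.

Lemma bloch_spinor r : bloch (fun _ : cell => 0 : R) (expi s) (expi t) (spinor r) =
  (fun c => (free_eig r)%:C%C * spinor r c).
Proof.
have fE : (free_eig r)%:C%C = (-1) ^+ r.2 * `|ampl r.1|.
  by rewrite /free_eig rmorphM rmorphXn rmorphN1 /= sqrt_gsym.
have alg (a b x y v z w : C) : a * b * x + y * (v * a * b * x) + z * (a * (w * b) * x) =
  a * b * ((1 + v * y + w * z) * x) by ring.
apply/funext => c; rewrite fE /bloch /spinor /= !chi_step mul0r addr0.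
set u := if ~~ c.2 then _ else _; set A := chi _ _; set B := chi _ _.
have -> : A * B * u + phase c.2 (expi s) * (phase c.2 (uroot p1 ^+ r.1.1) * A * B * u)
    + phase c.2 (expi t) * (A * (phase c.2 (uroot p2 ^+ r.1.2) * B) * u) =
    A * B * (phase c.2 (ampl r.1) * u).
  have p1E : phase c.2 1 = 1 :> C by case: c.2 => //=; rewrite rmorph1.
  rewrite /ampl !phaseD !expi_ang !phaseM -/(uroot p1) -/(uroot p2) p1E.
  exact: alg.
rewrite [RHS]mulrCA; congr (_ * _); rewrite {}/u {A B}.
case: c.2 => /=; first by rewrite [in LHS]uphaseE; ring.
have -> : (ampl r.1)^* * uphase r.1 = `|ampl r.1|.
  rewrite {1}uphaseE rmorphM /= -mulrA [X in _ * X]mulrC norm_uphase mulr1.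
  by rewrite conj_Creal ?normr_real.
by rewrite mulrAC -exprD addnn -mul2n exprM sqrrN expr1n expr1n mul1r.
Qed.

Definition spinormx : 'M[C]_#|{: cell}| :=
  \matrix_(i, j) spinor (enum_val i) (enum_val j).

Lemma spinor_orth r r' : \sum_c spinor r c * (spinor r' c)^* =
  if r == r' then (p1.+1 * p2.+1 * 2)%:R else 0.
Proof.
transitivity (\sum_(c : cell) (fun ab e => spinor r (ab, e) * (spinor r' (ab, e))^*) c.1 c.2).
  by apply: eq_bigr => -[].
rewrite -(pair_bigA _ (fun ab e => spinor r (ab, e) * (spinor r' (ab, e))^*)) /=.
rewrite -(pair_bigA _ (fun a b => \sum_e spinor r (a, b, e) * (spinor r' (a, b, e))^*)) /=.
have alg (a a' b b' u u' e e' : C) :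
  a * b * u * (a' * b' * u') + a * b * e * (a' * b' * e') =
  a * a' * (b * b') * (u * u' + e * e') by ring.
pose U := uphase r.1 * (uphase r'.1)^* + (-1) ^+ r.2 * ((-1) ^+ r'.2)^*.
transitivity (\sum_a \sum_b (chi r.1.1 a * (chi r'.1.1 a)^*) *
    (chi r.1.2 b * (chi r'.1.2 b)^*) * U).
  apply: eq_bigr => a _; apply: eq_bigr => b _; rewrite big_bool /spinor /= !rmorphM /= /U.
  exact: alg.
under eq_bigr => a _ do rewrite -mulr_suml -mulr_sumr chi_orth.
rewrite -mulr_suml -mulr_suml chi_orth.
case: r r' @U => [[j l] e] [[j' l'] e'] /=; rewrite !xpair_eqE.
case: (j =P j') => [->|]; last by rewrite !mul0r.
case: (l =P l') => [->|]; last by rewrite mulr0 !mul0r.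
rewrite norm_uphase rmorphXn rmorphN1 /= -exprD.
case: e e' => [] [] /=; rewrite ?expr0 ?expr1 ?sqrrN ?expr1n ?subrr ?mulr0//.
all: by rewrite -natrM -[1 + 1]/(2%:R) -natrM.
Qed.

Lemma eigs_free : perm_eq (eigs (blochmx (fun _ : cell => 0 : R) (expi s) (expi t)))
  [seq free_eig (enum_val i) | i <- enum 'I_#|{: cell}|].
Proof.
apply: (@eigs_similar _ _ _ spinormx); first exact: blochmx_herm.
  pose k : C := (p1.+1 * p2.+1 * 2)%:R.
  have k0 : k != 0 by rewrite pnatr_eq0.
  suff : spinormx *m (k^-1 *: spinormx ^t*) = 1%:M by case/mulmx1_unit.
  rewrite -scalemxAr; apply/matrixP => i j; rewrite !mxE.
  transitivity (k^-1 * \sum_c spinor (enum_val i) c * (spinor (enum_val j) c)^*).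
    congr (_ * _); transitivity (\sum_(c in {: cell})
      spinor (enum_val i) c * (spinor (enum_val j) c)^*); last exact: eq_bigl.
    by rewrite [RHS]big_enum_val; apply: eq_bigr => l _; rewrite !mxE.
  rewrite spinor_orth (inj_eq enum_val_inj); case: eqP => _; last by rewrite mulr0.
  by rewrite mulVf.
apply/row_matrixP => i; rewrite row_mul.
have -> : row i spinormx = rowf (spinor (enum_val i)).
  by apply/rowP => j; rewrite !mxE.
rewrite bloch_mulmx bloch_spinor; apply/rowP => j.
by rewrite mul_diag_mx !mxE.
Qed.

Lemma count_eigs_free (P : pred R) :
  count P (eigs (blochmx (fun _ : cell => 0 : R) (expi s) (expi t))) =
  #|[pred r : cell | P (free_eig r)]|.
Proof.
rewrite (seq.permP eigs_free) -sum1_count big_map big_enum_cond /=.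
transitivity (\sum_(r in {: cell} | P (free_eig r)) 1)%N.
  by rewrite [RHS]big_enum_val_cond.
by rewrite -sum1_card; apply: eq_bigl => r; rewrite !inE.
Qed.

End FreeBands.

Section FreeCounts.
Variables (R : realType) (p1 p2 : nat).
Local Notation grid := ('I_p1.+1 * 'I_p2.+1)%type.
Local Notation cell := ('I_p1.+1 * 'I_p2.+1 * bool)%type.
Implicit Types (E s t : R).

Definition free_eigs s t := eigs (blochmx (fun _ : cell => 0 : R) (expi s) (expi t)).

Lemma card_prod_bool (T : finType) (P : pred (T * bool)) :
  #|P| = (#|[pred g | P (g, true)]| + #|[pred g | P (g, false)]|)%N.
Proof.
rewrite -!sum1_card big_mkcond /=.
transitivity (\sum_(c : T * bool) (fun g b => if P (g, b) then 1 else 0) c.1 c.2)%N.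
  by apply: eq_bigr => -[].
rewrite -(pair_bigA _ (fun g b => if P (g, b) then 1 else 0)%N) /=.
rewrite [in RHS]big_mkcond [X in (_ + X)%N]big_mkcond -big_split /=.
by apply: eq_bigr => g _; rewrite big_bool.
Qed.

Lemma gsym_ge0 s t (g : grid) : 0 <= gsym s t g.
Proof. exact: sqn_ge0. Qed.

Lemma sqrt_ltE (x E : R) : 0 <= x -> 0 < E -> (Num.sqrt x < E) = (x < E ^+ 2).
Proof.
by move=> x0 E0; rewrite -(ltr_pXn2r (ltn0Sn 1)) ?nnegrE ?sqrtr_ge0 ?(ltW E0)// sqr_sqrtr.
Qed.

Lemma sqrt_leE (x E : R) : 0 <= x -> 0 < E -> (Num.sqrt x <= E) = (x <= E ^+ 2).
Proof.
by move=> x0 E0; rewrite -(ler_pXn2r (ltn0Sn 1)) ?nnegrE ?sqrtr_ge0 ?(ltW E0)// sqr_sqrtr.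
Qed.

Lemma free_eigT s t (g : grid) : free_eig s t (g, true) = - Num.sqrt (gsym s t g).
Proof. by rewrite /free_eig /= expr1 mulN1r. Qed.

Lemma free_eigF s t (g : grid) : free_eig s t (g, false) = Num.sqrt (gsym s t g).
Proof. by rewrite /free_eig /= expr0 mul1r. Qed.

Lemma count_lt_pos s t E : 0 < E ->
  count (< E) (free_eigs s t) = (#|{: grid}| + nlt p1 p2 (E ^+ 2) s t)%N.
Proof.
move=> E0; rewrite count_eigs_free card_prod_bool; congr addn; apply: eq_card => g;
  rewrite !inE /=.
  by rewrite free_eigT (le_lt_trans _ E0)// oppr_le0 sqrtr_ge0.
by rewrite free_eigF sqrt_ltE ?gsym_ge0.
Qed.

Lemma count_le_pos s t E : 0 < E ->
  count (<= E) (free_eigs s t) = (#|{: grid}| + nle p1 p2 (E ^+ 2) s t)%N.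
Proof.
move=> E0; rewrite count_eigs_free card_prod_bool; congr addn; apply: eq_card => g;
  rewrite !inE /=.
  by rewrite free_eigT (le_trans _ (ltW E0))// oppr_le0 sqrtr_ge0.
by rewrite free_eigF sqrt_leE ?gsym_ge0.
Qed.

Lemma count_lt_neg s t E : E < 0 ->
  (count (< E) (free_eigs s t) + nle p1 p2 (E ^+ 2) s t)%N = #|{: grid}|.
Proof.
move=> E0; rewrite count_eigs_free card_prod_bool.
rewrite [X in (_ + X + _)%N](@eq_card0 _ _) ?addn0 => [|g]; last first.
  by rewrite !inE /= free_eigF ltNge (le_trans (ltW E0))// sqrtr_ge0.
rewrite addnC -(cardC [pred g : grid | gsym s t g <= E ^+ 2]); congr addn.
apply: eq_card => g; rewrite !inE /= free_eigT ltrNl -sqrrN ltNge.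
by rewrite sqrt_leE ?gsym_ge0// oppr_gt0.
Qed.

Lemma count_le_neg s t E : E < 0 ->
  (count (<= E) (free_eigs s t) + nlt p1 p2 (E ^+ 2) s t)%N = #|{: grid}|.
Proof.
move=> E0; rewrite count_eigs_free card_prod_bool.
rewrite [X in (_ + X + _)%N](@eq_card0 _ _) ?addn0 => [|g]; last first.
  by rewrite !inE /= free_eigF leNgt (lt_le_trans E0)// sqrtr_ge0.
rewrite addnC -(cardC [pred g : grid | gsym s t g < E ^+ 2]); congr addn.
apply: eq_card => g; rewrite !inE /= free_eigT lerNl -sqrrN leNgt.
by rewrite sqrt_ltE ?gsym_ge0// oppr_gt0.
Qed.

Lemma free_count_jump E : -3 < E < 3 -> E != 0 ->
    (E ^+ 2 != 1) || odd p1.+1 || odd p2.+1 ->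
  exists s t s' t', [/\ 0 <= s <= pi *+ 2, 0 <= t <= pi *+ 2, 0 <= s' <= pi *+ 2,
    0 <= t' <= pi *+ 2 &
    (count (<= E) (free_eigs s t) < count (< E) (free_eigs s' t'))%N].
Proof.
move=> /andP[E3 E3'] E0 hE.
have E2 : 0 < E ^+ 2 < 9.
  by rewrite exprn_even_gt0//= E0 /=; nra.
have [s [t [s' [t' [hs ht hs' ht' lt]]]]] : exists s t s' t' : R,
    [/\ 0 <= s <= pi *+ 2, 0 <= t <= pi *+ 2, 0 <= s' <= pi *+ 2,
    0 <= t' <= pi *+ 2 & (nle p1 p2 (E ^+ 2) s t < nlt p1 p2 (E ^+ 2) s' t')%N].
  by case/orP: hE => [/orP[h|h]|h]; [exact: count_jump|..];
    apply: count_jump_odd; rewrite ?h ?orbT.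
move: E0; rewrite neq_lt => /orP[En|Ep].
  exists s', t', s, t; split=> //.
  have arith (a b c d n : nat) : (a + c = n -> b + d = n -> c < d -> b < a)%N by clear; lia.
  exact: arith (count_lt_neg s t En) (count_le_neg s' t' En) lt.
exists s, t, s', t'; split=> //.
by rewrite count_le_pos// count_lt_pos// ltn_add2l.
Qed.

Lemma free_eig_mem s t k : (k < #|{: cell}|)%N ->
  exists r : cell, band (fun _ : cell => 0) s t k = free_eig s t r.
Proof.
move=> kn; have : band (fun _ : cell => 0) s t k \in free_eigs s t.
  by apply: mem_nth; rewrite size_eigs.
rewrite (perm_mem (eigs_free _ _ _ _)) => /mapP[i _ ->].
by exists (enum_val i).
Qed.

Lemma free_level E : exists s t, [/\ 0 <= s <= pi *+ 2, 0 <= t <= pi *+ 2 &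
  forall k, (k < #|{: cell}|)%N -> band (fun _ : cell => 0) s t k != E].
Proof.
have [s [t [hs ht h]]] := generic_level p1 p2 (E ^+ 2).
exists s, t; split=> // k /(free_eig_mem s t)[r ->].
apply: contra (h r.1) => /eqP <-; rewrite /free_eig exprMn sqr_sqrtr ?gsym_ge0//.
by rewrite -exprM mulnC exprM sqrrN expr1n expr1n mul1r.
Qed.

Lemma free_band_le3 s t k : (k < #|{: cell}|)%N ->
  -3 <= band (fun _ : cell => 0) s t k <= 3.
Proof.
move=> /(free_eig_mem s t)[r ->]; rewrite -ler_norml /free_eig normrM normrX normrN1 expr1n mul1r.
rewrite ger0_norm ?sqrtr_ge0// sqrt_leE ?gsym_ge0// /gsym /symbol.
have h (z : R[i]) : sqn z = Normc.normc z ^+ 2 by [].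
rewrite h ler_pXn2r ?nnegrE ?normc_ge0//.
rewrite (le_trans (le_normcD _ _))// -[3]/((2 + 1)%:R : R) natrD lerD//.
  rewrite (le_trans (le_normcD _ _))// -[2]/((1 + 1)%:R : R) natrD lerD ?Normc.normc1//.
  by rewrite /= cos2Dsin2 sqrtr1.
by rewrite /= cos2Dsin2 sqrtr1.
Qed.

End FreeCounts.

Section BandRange.
Variables (R : realType) (p1 p2 : nat).
Local Notation cell := ('I_p1.+1 * 'I_p2.+1 * bool)%type.
Implicit Types (q : cell -> R).

Definition inbox (t : R) : Prop := 0 <= t <= pi *+ 2.

Lemma normc_expiB (s s' : R) :
  Normc.normc (expi s - expi s') <= `|cos s - cos s'| + `|sin s - sin s'|.
Proof.
rewrite /=; move: (cos s - cos s') (sin s - sin s') => a b.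
rewrite -[leRHS]ger0_norm ?addr_ge0// -sqrtr_sqr ler_wsqrtr// sqrrD.
by rewrite !real_normK ?num_real// addrAC lerDl mulrn_wge0 ?mulr_ge0.
Qed.

Lemma band_continuous q k : (k < #|{: cell}|)%N ->
  continuous (fun z : R * R => band q z.1 z.2 k).
Proof.
move=> kn z0; pose N2 : R := (#|{: cell}| * #|{: cell}|)%:R.
pose B (z : R * R) := N2 * ((`|cos z.1 - cos z0.1| + `|sin z.1 - sin z0.1|)
   + (`|cos z.2 - cos z0.2| + `|sin z.2 - sin z0.2|)).
have hB z : `|band q z.1 z.2 k - band q z0.1 z0.2 k| <= B z.
  apply: (le_trans (@band_lipschitz _ _ _ q q _ _ _ _ 0 _ kn _)).
    by move=> r; rewrite subrr normr0.
  by rewrite addr0 ler_wpM2l// lerD// normc_expiB.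
have cv0 (f : R -> R) (p : R * R -> R) : continuous f -> p z @[z --> z0] --> p z0 ->
    `|f (p z) - f (p z0)| @[z --> z0] --> (0 : R).
  move=> fc pc; rewrite -[X in _ --> X](normr0 R) -(subrr (f (p z0))).
  apply: cvg_norm; apply: cvgB; last exact: cvg_cst.
  by apply: (@continuous_cvg _ _ _ _ _ p f) => //; exact: fc.
have cB : B z @[z --> z0] --> (0 : R).
  have -> : (0 : R) = N2 * ((0 + 0) + (0 + 0)) by ring.
  have c1 : (fun z : R * R => z.1) z @[z --> z0] --> z0.1 by exact: cvg_fst.
  have c2 : (fun z : R * R => z.2) z @[z --> z0] --> z0.2 by exact: cvg_snd.
  apply: cvgMr; apply: cvgD; apply: cvgD; apply: cv0 => //;
    by [exact: continuous_cos|exact: continuous_sin].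
apply: (@squeeze_cvgr _ _ _ _ (fun z => band q z0.1 z0.2 k - B z)
    (fun z => band q z0.1 z0.2 k + B z)).
- by near=> z; have := hB z; rewrite ler_norml; lra.
- by rewrite -[X in _ --> X]subr0; apply: cvgB => //; exact: cvg_cst.
- by rewrite -[X in _ --> X]addr0; apply: cvgD => //; exact: cvg_cst.
Unshelve. all: by end_near. Qed.

Lemma band_ivt q k s t s' t' c : (k < #|{: cell}|)%N ->
    inbox s -> inbox t -> inbox s' -> inbox t' ->
    band q s t k <= c <= band q s' t' k ->
  exists s0 t0, [/\ inbox s0, inbox t0 & band q s0 t0 k = c].
Proof.
move=> kn hs ht hs' ht' /andP[c1 c2].
pose path (x : R) : R * R := (s + x * (s' - s), t + x * (t' - t)).
pose f x := band q (path x).1 (path x).2 k.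
have pc : continuous path.
  have lc (a b x : R) : a + y * b @[y --> x] --> a + x * b.
    by apply: cvgD; [exact: cvg_cst|apply: cvgMl; exact: cvg_id].
  by move=> x; exact: (cvg_pair (lc s _ x) (lc t _ x)).
have fc : {within `[(0 : R), 1], continuous f}.
  apply: continuous_subspaceT => x.
  by apply: (@continuous_comp _ _ _ path (fun z : R * R => band q z.1 z.2 k));
    [exact: pc|exact: band_continuous].
have f0 : f 0 = band q s t k by rewrite /f /= !mul0r !addr0.
have f1 : f 1 = band q s' t' k by rewrite /f /= !mul1r ![_ + (_ - _)]addrC !subrK.
have [|x x01 fx] := IVT ler01 fc (v := c).
  rewrite f0 f1; apply/andP; split; first by rewrite ge_min c1.
  by rewrite le_max c2 orbT.
exists (path x).1, (path x).2; split=> //.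
  move: x01 hs hs'; rewrite in_itv /= /inbox; move: (pi *+ 2) => P.
  by clear=> /andP[? ?] /andP[? ?] /andP[? ?]; apply/andP; split; nra.
move: x01 ht ht'; rewrite in_itv /= /inbox; move: (pi *+ 2) => P.
by clear=> /andP[? ?] /andP[? ?] /andP[? ?]; apply/andP; split; nra.
Qed.

Lemma band_range q : exists m M : nat -> R, forall k, (k < #|{: cell}|)%N ->
  [/\ forall s t, inbox s -> inbox t -> m k <= band q s t k <= M k,
      exists s t, [/\ inbox s, inbox t & band q s t k = m k],
      exists s t, [/\ inbox s, inbox t & band q s t k = M k] &
      forall c, m k <= c <= M k -> exists s t, [/\ inbox s, inbox t & band q s t k = c]].
Proof.
suff /choice[mM h] : forall k, exists mM : R * R, (k < #|{: cell}|)%N ->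
  [/\ forall s t, inbox s -> inbox t -> mM.1 <= band q s t k <= mM.2,
      exists s t, [/\ inbox s, inbox t & band q s t k = mM.1],
      exists s t, [/\ inbox s, inbox t & band q s t k = mM.2] &
      forall c, mM.1 <= c <= mM.2 -> exists s t, [/\ inbox s, inbox t & band q s t k = c]].
  by exists (fun k => (mM k).1), (fun k => (mM k).2) => k /h.
move=> k; have [kn|] := boolP (k < #|{: cell}|)%N; last by exists (0, 0).
pose A : set (R * R) := `[0, pi *+ 2] `*` `[0, pi *+ 2].
have Ain s t : inbox s -> inbox t -> (s, t) \in A.
  by move=> hs ht; rewrite inE; split=> /=; rewrite in_itv.
have inA z : z \in A -> inbox z.1 /\ inbox z.2.
  by rewrite inE => -[] /=; rewrite !in_itv.
have P0 : inbox 0 by rewrite /inbox lexx mulrn_wge0// pi_ge0.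
have A0 : A !=set0 by exists (0, 0); have := Ain _ _ P0 P0; rewrite inE.
have Ac : compact A by apply: compact_setX; exact: segment_compact.
have gc : {within A, continuous (fun z : R * R => band q z.1 z.2 k)}.
  by apply: continuous_subspaceT; exact: band_continuous.
have [z1 /inA[h1 h1'] hz1] := compact_EVT_min A0 Ac gc.
have [z2 /inA[h2 h2'] hz2] := compact_EVT_max A0 Ac gc.
exists (band q z1.1 z1.2 k, band q z2.1 z2.2 k) => _ /=; split.
- by move=> s t hs ht; rewrite (hz1 (s, t)) ?Ain// (hz2 (s, t)) ?Ain.
- by exists z1.1, z1.2.
- by exists z2.1, z2.2.
- by move=> c; exact: band_ivt.
Qed.

End BandRange.

Section Intervals.
Variables (R : realType) (m M : nat -> R).
Local Notation gapat := (fun k => M k < m k.+1).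

Lemma merge_intervals n : (forall k, (k <= n)%N -> m k <= M k) ->
    (forall k, (k < n)%N -> m k <= m k.+1) -> (forall k, (k < n)%N -> M k <= M k.+1) ->
  exists a (l : seq (R * R)), [/\ a <= m n, all (fun p => p.1 <= p.2) l,
    size l = count gapat (iota 0 n) &
    forall x, (exists2 k, (k <= n)%N & m k <= x <= M k) <->
      (a <= x <= M n \/ exists2 p, p \in l & p.1 <= x <= p.2)].
Proof.
elim: n => [|n IH] mM mmono Mmono.
  exists (m 0%N), [::]; split=> // x; split.
    by move=> [k]; rewrite leqn0 => /eqP -> ?; left.
  by move=> [h|[]//]; exists 0%N.
have [|||a [l [am lle sl lE]]] := IH.
- by move=> k kn; exact: mM (leqW kn).
- by move=> k kn; exact: mmono (ltnW kn).
- by move=> k kn; exact: Mmono (ltnW kn).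
have mMn := mM n (leqnSn n); have mMn1 := mM n.+1 (leqnn _).
have mn := mmono n (leqnn _); have Mn := Mmono n (leqnn _).
rewrite -addn1 iotaD count_cat /= add0n addn1 addn0.
have splitE x : (exists2 k, (k <= n.+1)%N & m k <= x <= M k) <->
    ((exists2 k, (k <= n)%N & m k <= x <= M k) \/ m n.+1 <= x <= M n.+1).
  split=> [[k]|[[k kn h]|h]]; last 2 first.
  - by exists k; rewrite // leqW.
  - by exists n.+1.
  by rewrite leq_eqVlt => /predU1P[->|kn] h; [right|left; exists k].
have [gap|nogap] := ltrP (M n) (m n.+1).
  exists (m n.+1), ((a, M n) :: l); split=> //=.
  - by rewrite lle andbT (le_trans am).
  - by rewrite sl addn1.
  move=> x; rewrite splitE lE; split.
    move=> [[h|[p pl h]]|h]; [right|right|by left].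
      by exists (a, M n); rewrite ?mem_head.
    by exists p; rewrite // inE pl orbT.
  move=> [h|[p]]; first by right.
  by rewrite inE => /predU1P[->|pl] h; [left; left|left; right; exists p].
exists a, l; split=> //; first exact: le_trans am mn.
  by rewrite sl addn0.
move=> x; rewrite splitE lE; split.
  move=> [[/andP[h h']|h]|/andP[h h']]; [|by right|].
    by left; rewrite h (le_trans h').
  by left; rewrite h' andbT (le_trans am)// (le_trans mn).
move=> [/andP[h h']|h]; last by left; right.
have [xM|xM] := lerP x (M n); first by left; left; rewrite h.
by right; rewrite h' andbT (le_trans nogap (ltW xM)).
Qed.

Lemma consists_of_bands n K : (forall k, (k <= n)%N -> m k <= M k) ->
    (forall k, (k < n)%N -> m k <= m k.+1) -> (forall k, (k < n)%N -> M k <= M k.+1) ->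
    (count gapat (iota 0 n) < K)%N ->
  consists_of_at_most_intervals K
    [set x%:C%C | x in [set x | exists2 k, (k <= n)%N & m k <= x <= M k]].
Proof.
move=> mM mmono Mmono cK.
have [a [l [am lle sl lE]]] := merge_intervals mM mmono Mmono.
pose l' := (a, M n) :: l.
have sl' : (size l' <= K)%N by rewrite /= sl.
exists (size l') => //; exists (fun i : 'I_(size l') => nth (0, 0) l' i).
  move=> i; have : nth (0, 0) l' i \in l' by exact: mem_nth.
  rewrite inE => /predU1P[->|il]; first by rewrite /= (le_trans am)// mM.
  by move/allP: lle => /(_ _ il).
congr (_ @` _); apply/seteqP; split=> x.
  move=> /lE h.
  have [p pl' hp] : exists2 p, p \in l' & p.1 <= x <= p.2.
    case: h => [h|[p pl h]]; first by exists (a, M n); rewrite ?mem_head.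
    by exists p; rewrite // inE pl orbT.
  have pi : (index p l' < size l')%N by rewrite index_mem.
  by exists (Ordinal pi) => //=; rewrite in_itv /= nth_index.
move=> [i _] /=; rewrite in_itv /= => h; apply/lE.
have : nth (0, 0) l' i \in l' by exact: mem_nth.
rewrite inE => /predU1P[e|il]; first by left; rewrite e in h.
by right; exists (nth (0, 0) l' i).
Qed.

Lemma gap_between n (A : set R[i]) (G : set R) :
    (forall x : R, A x%:C%C <-> exists2 k, (k <= n)%N & m k <= x <= M k) ->
    (forall k, (k <= n)%N -> m k <= M k) ->
    (forall k l, (k <= l <= n)%N -> m k <= m l) ->
    (forall k l, (k <= l <= n)%N -> M k <= M l) ->
  is_gap A G -> exists k, [/\ (k < n)%N, M k < m k.+1 & G `<=` `]M k, m k.+1[%classic].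
Proof.
move=> AE mM mmono Mmono [x nAx [GE Gb]].
have notA y : ~ A y%:C%C <-> forall k, (k <= n)%N -> y < m k \/ M k < y.
  rewrite AE; split=> [h k kn|h [k kn /andP[h1 h2]]].
    have [?|h1] := ltrP y (m k); first by left.
    by right; rewrite ltNge; apply/negP => h2; apply: h; exists k; rewrite ?h1.
  by case: (h k kn); lra.
have xout := (notA x).1 nAx.
have Gx : G x by rewrite GE; exact: connected_component_refl.
have [b [_ hb]] := Gb.
have Gbd y : G y -> `|y| <= b + 1 by apply: hb; rewrite ltrDl.
have maxG (B : set R) : B x -> B `<=` [set y | ~ A y%:C%C] -> is_interval B -> B `<=` G.
  by move=> Bx BA Bi; rewrite GE; apply: connected_component_max => //; exact/connected_intervalP.
have [k0 [k0n k0x]] : exists k, (k <= n)%N /\ M k < x.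
  apply: contrapT => h.
  have all_gt k : (k <= n)%N -> x < m k.
    by move=> kn; case: (xout k kn) => // hk; case: h; exists k.
  have low : [set y | y <= x] `<=` G.
    apply: maxG => //=; first by move=> y yx; apply/notA => k kn; left;
      rewrite (le_lt_trans yx) ?all_gt.
    by move=> y z /= yx zx w /andP[_ wz]; exact: le_trans zx.
  have h1 : x - `|b| - `|x| - 2 <= x by have := normr_ge0 b; have := normr_ge0 x; lra.
  have := Gbd _ (low _ h1); have := ler_norm x; have := ler_norm b.
  by rewrite ler_norml; have := normr_ge0 b; have := normr_ge0 x; lra.
have ex1 : exists k, (k <= n)%N && (M k < x) by exists k0; rewrite k0n.
have ub k : (k <= n)%N && (M k < x) -> (k <= n)%N by case/andP.
have [k /andP[kn Mk] kmax] := ex_maxnP ex1 ub.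
have kn' : (k < n)%N.
  rewrite ltn_neqAle kn andbT; apply/eqP => ke.
  have up : [set y | x <= y] `<=` G.
    apply: maxG => //=.
      move=> y xy; apply/notA => l ln; right; apply: le_lt_trans (lt_le_trans Mk xy).
      by apply: Mmono; rewrite ke ln leqnn.
    by move=> y z /= yx zx w /andP[wy _]; exact: le_trans wy.
  have h1 : x <= x + `|b| + `|x| + 2 by have := normr_ge0 b; have := normr_ge0 x; lra.
  have := Gbd _ (up _ h1); have := ler_norm (- x); have := ler_norm b; rewrite normrN.
  by rewrite ler_norml; have := normr_ge0 b; have := normr_ge0 x; lra.
have xm : x < m k.+1.
  case: (xout k.+1 kn') => // h; have := kmax k.+1; rewrite kn' h => /(_ isT).
  by rewrite ltnn.
have inA l : (l <= n)%N -> A (m l)%:C%C /\ A (M l)%:C%C.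
  by move=> ln; split; apply/AE; exists l; rewrite // lexx ?mM.
have GA y : G y -> ~ A y%:C%C by rewrite GE => /connected_component_sub.
have Gi : is_interval G.
  by apply/connected_intervalP; rewrite GE; exact: component_connected.
exists k; split=> //; first exact: lt_trans xm.
move=> y Gy; rewrite /= in_itv /=; apply/andP; split; rewrite ltNge; apply/negP => h.
  apply: (GA (M k)); last exact: (inA _ kn).2.
  by apply: (Gi y x) => //; rewrite h ltW.
apply: (GA (m k.+1)); last exact: (inA _ kn').1.
by apply: (Gi x y) => //; rewrite h ltW.
Qed.

End Intervals.

Section Bands.
Variables (R : realType) (p1 p2 : nat).
Local Notation cell := ('I_p1.+1 * 'I_p2.+1 * bool)%type.
Local Notation n := (#|{: cell}|.-1).
Implicit Types (q : cell -> R) (m M : nat -> R).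

Lemma ncell_gt0 : (0 < #|{: cell}|)%N.
Proof. by apply/card_gt0P; exists (ord0, ord0, true). Qed.

Lemma ltn_cell k : (k <= n)%N = (k < #|{: cell}|)%N.
Proof. by rewrite -ltnS prednK ?ncell_gt0. Qed.

Definition band_bounds q m M : Prop := forall k, (k < #|{: cell}|)%N ->
  [/\ forall s t, inbox s -> inbox t -> m k <= band q s t k <= M k,
      exists s t, [/\ inbox s, inbox t & band q s t k = m k],
      exists s t, [/\ inbox s, inbox t & band q s t k = M k] &
      forall c, m k <= c <= M k -> exists s t, [/\ inbox s, inbox t & band q s t k = c]].

Lemma band_mono q s t k l : (k <= l)%N -> (l < #|{: cell}|)%N ->
  band q s t k <= band q s t l.
Proof. by move=> kl ln; apply: eig_mono; rewrite kl. Qed.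

Section OneBands.
Variables (q : cell -> R) (m M : nat -> R).
Hypothesis mM : band_bounds q m M.

Lemma bounds_le k : (k <= n)%N -> m k <= M k.
Proof.
rewrite ltn_cell => /mM[h _ [s [t [hs ht <-]]] _].
by case/andP: (h s t hs ht).
Qed.

Lemma bounds_min k l : (k <= l <= n)%N -> m k <= m l.
Proof.
move=> /andP[kl]; rewrite ltn_cell => ln.
have [h _ _ _] := mM (leq_ltn_trans kl ln); have [_ [s [t [hs ht <-]]] _ _] := mM ln.
by case/andP: (h s t hs ht) => h1 _; apply: le_trans h1 _; exact: band_mono.
Qed.

Lemma bounds_max k l : (k <= l <= n)%N -> M k <= M l.
Proof.
move=> /andP[kl]; rewrite ltn_cell => ln.
have [_ _ [s [t [hs ht <-]]] _] := mM (leq_ltn_trans kl ln); have [h _ _ _] := mM ln.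
by case/andP: (h s t hs ht) => _; apply: le_trans; exact: band_mono.
Qed.

Lemma spectrum_bands : l2_spectrum (op q) =
  [set x%:C%C | x in [set x | exists2 k, (k <= n)%N & m k <= x <= M k]].
Proof.
apply/seteqP; split=> z; last first.
  move=> [x [k + hx] <-]; rewrite ltn_cell => kn.
  have [_ _ _ /(_ x hx) [s [t [_ _ <-]]]] := mM kn.
  exact: band_spectrum.
apply: contraPP => nz; apply; case: z nz => a b nz.
have [b0|b0] := eqVneq b 0; last first.
  apply: (@resolvent_off_bands _ _ _ q a b (b ^+ 2)).
    by rewrite exprn_even_gt0.
  by move=> *; rewrite lerDr sqr_ge0.
have out k : (k <= n)%N -> a < m k \/ M k < a.
  move=> kn; have [?|h1] := ltrP a (m k); first by left.
  right; rewrite ltNge; apply/negP => h2; apply: nz; exists a; last by rewrite b0.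
  by exists k; rewrite // h1.
pose d k := if a < m k then (m k - a) ^+ 2 else (a - M k) ^+ 2.
apply: (@resolvent_off_bands _ _ _ q a b (\big[Num.min/1]_(k < #|{: cell}|) d k)).
  rewrite lt_bigmin// => k _; rewrite /d.
  case: (out k); rewrite ?ltn_cell// => h; first by rewrite h exprn_gt0// subr_gt0.
  case: ifP => h'; first by rewrite exprn_gt0// subr_gt0.
  by rewrite exprn_gt0// subr_gt0.
move=> s t k hs ht kn; apply: (@le_trans _ _ (d k)).
  exact: (bigmin_le_cond 1 (j := Ordinal kn)).
rewrite b0 expr0n addr0 /d; have [h _ _ _] := mM kn.
have /andP[h1 h2] := h s t hs ht.
have := out k; rewrite ltn_cell => /(_ kn).
case: ifP => [am _|am []]; last 2 first.
- by [].
- by move=> Ma; rewrite -[leRHS]sqrrN opprB ler_pXn2r// ?nnegrE ?subr_ge0; lra.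
by rewrite ler_pXn2r// ?nnegrE ?subr_ge0; lra.
Qed.

Lemma spectrumP (x : R) : l2_spectrum (op q) x%:C%C <->
  exists2 k, (k <= n)%N & m k <= x <= M k.
Proof.
rewrite spectrum_bands; split=> [[y h /(@complexI R) <-]//|h].
by exists x.
Qed.

End OneBands.

Lemma bounds_perturb q q' m M m' M' (d : R) k : (k <= n)%N ->
    band_bounds q m M -> band_bounds q' m' M' -> (forall r, `|q r - q' r| <= d) ->
  let e := (#|{: cell}| * #|{: cell}|)%:R * d in
  m' k <= m k + e /\ M k <= M' k + e.
Proof.
rewrite ltn_cell => kn mM mM' hd e.
have close s t : `|band q s t k - band q' s t k| <= e.
  apply: (le_trans (band_lipschitz _ _ _ _ kn hd)).
  by rewrite !subrr !Normc.normc0 !add0r.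
have [h [s1 [t1 [hs1 ht1 e1]]] [s2 [t2 [hs2 ht2 e2]]] _] := mM k kn.
have [h' _ _ _] := mM' k kn; split.
  have := h' s1 t1 hs1 ht1; have := close s1 t1; rewrite ler_norml e1; lra.
have := h' s2 t2 hs2 ht2; have := close s2 t2; rewrite ler_norml e2; lra.
Qed.

Section Free.
Variables (m M : nat -> R).
Hypothesis mM : band_bounds (fun=> 0) m M.

Lemma free_touch k E : (k < n)%N -> M k <= E <= m k.+1 ->
  E \in [:: -1; 0; 1] /\ (odd p1.+1 || odd p2.+1 -> E = 0).
Proof.
move=> kn /andP[ME Em].
have kn1 : (k.+1 < #|{: cell}|)%N by rewrite -ltn_cell.
have kn0 : (k < #|{: cell}|)%N by exact: ltnW.
have [h0 _ [s0 [t0 [_ _ e0]]] _] := mM kn0.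
have [h1 [s1 [t1 [_ _ e1]]] _ _] := mM kn1.
have nojump s t s' t' : inbox s -> inbox t -> inbox s' -> inbox t' ->
    (count (< E)%R (free_eigs p1 p2 s' t') <= count (<= E)%R (free_eigs p1 p2 s t))%N.
  move=> hs ht hs' ht'; apply: (@leq_trans k.+1).
    have /andP[h _] := h1 s' t' hs' ht'.
    have : ~~ (band (fun _ : cell => 0) s' t' k.+1 < E) by rewrite -leNgt (le_trans Em).
    by rewrite /band (eig_ltE _ _ kn1) -leqNgt.
  have /andP[_ h] := h0 s t hs ht.
  have : band (fun _ : cell => 0) s t k <= E by rewrite (le_trans h).
  by rewrite /band (eig_leE _ _ kn0).
have M3 : -3 <= M k by rewrite -e0; case/andP: (@free_band_le3 R p1 p2 s0 t0 k kn0).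
have m3 : m k.+1 <= 3 by rewrite -e1; case/andP: (@free_band_le3 R p1 p2 s1 t1 k.+1 kn1).
have [s [t [hs ht ne]]] := @free_level R p1 p2 E.
have En3 : E != -3.
  apply: contra_neq (ne k kn0) => E3; apply/le_anti.
  have /andP[_ h] := h0 s t hs ht; rewrite (le_trans h ME) E3.
  by case/andP: (@free_band_le3 R p1 p2 s t k kn0).
have E3 : E != 3.
  apply: contra_neq (ne k.+1 kn1) => E3; apply/le_anti.
  have /andP[h _] := h1 s t hs ht; rewrite (le_trans Em h) E3 andbT.
  by case/andP: (@free_band_le3 R p1 p2 s t k.+1 kn1).
have EI : -3 < E < 3 by rewrite !lt_neqAle eq_sym En3 E3; apply/andP; split; lra.
have jump : E != 0 -> ~~ [|| E ^+ 2 != 1, odd p1.+1 | odd p2.+1].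
  move=> E0; apply/negP; rewrite orbA => h.
  have [a [b [a' [b' [ha hb ha' hb']]]]] := free_count_jump EI E0 h.
  by rewrite ltnNge nojump.
have [->|E0] := eqVneq E 0; first by rewrite !inE eqxx orbT.
have := jump E0; rewrite negb_or negbK => /andP[/eqP E1 /negPf ->]; split=> //.
have /eqP := E1; rewrite sqrf_eq1 !inE => /orP[] /eqP ->; rewrite eqxx ?orbT//.
Qed.

Lemma free_touch_eq k : (k < n)%N -> M k <= m k.+1 -> M k = m k.+1.
Proof.
move=> kn h; apply/eqP; rewrite eq_le h /= leNgt; apply/negP => lt.
have [h1 _] := @free_touch k (M k) kn ltac:(by rewrite lexx h).
have [h2 _] := @free_touch k (m k.+1) kn ltac:(by rewrite h lexx).
have [|h3 _] := @free_touch k ((3 * M k + m k.+1) / 4) kn.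
  by apply/andP; split; lra.
move: h1 h2 h3 lt; rewrite !inE.
by move=> /or3P[] /eqP -> /or3P[] /eqP -> /or3P[] /eqP; lra.
Qed.

Lemma free_touch_inj k l : (k < l)%N -> (l < n)%N -> M k <= m k.+1 -> M k != M l.
Proof.
move=> kl ln h; apply/eqP => e.
have kn : (k < n)%N := ltn_trans kl ln.
have kn1 : (k.+1 < #|{: cell}|)%N by rewrite -ltn_cell.
have [s [t [hs ht ne]]] := @free_level R p1 p2 (M k).
have [h1 _ _ _] := mM kn1; have /andP[h2 h3] := h1 s t hs ht.
have := ne k.+1 kn1; apply/negP; rewrite negbK eq_le (le_trans h h2) andbT.
by rewrite (le_trans h3)// e; apply: (bounds_max mM); rewrite kl ltnW.
Qed.

Lemma free_touch_count (P : pred nat) : (forall k, (k < n)%N -> P k -> M k <= m k.+1) ->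
  (count P (iota 0 n) <= 3)%N /\
  (odd p1.+1 || odd p2.+1 -> (count P (iota 0 n) <= 1)%N).
Proof.
move=> hP; pose l := [seq k <- iota 0 n | P k].
have lP k : k \in l -> (k < n)%N /\ M k <= m k.+1.
  by rewrite mem_filter mem_iota => /andP[Pk /andP[_ kn]]; split=> //; exact: hP.
have lu : uniq [seq M k | k <- l].
  rewrite map_inj_in_uniq ?filter_uniq ?iota_uniq// => j k /lP[jn jm] /lP[kn km] e.
  case: (ltngtP j k) => // lt.
    by have := free_touch_inj lt kn jm; rewrite e eqxx.
  by have := free_touch_inj lt jn km; rewrite e eqxx.
have sub k : k \in l -> M k \in [:: -1; 0; 1] /\ (odd p1.+1 || odd p2.+1 -> M k = 0).
  by move=> /lP[kn km]; apply: (free_touch kn); rewrite lexx.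
rewrite -size_filter -/l -(size_map M l); split.
  rewrite -[3%N]/(size [:: -1 : R; 0; 1]); apply: uniq_leq_size => // x.
  by move=> /mapP[k /sub[h _] ->].
move=> od; rewrite -[1%N]/(size [:: 0 : R]); apply: uniq_leq_size => // x.
by move=> /mapP[k /sub[_ /(_ od) ->] ->]; rewrite inE.
Qed.

End Free.

Lemma op_spectrum_main : exists c : R, [/\ 0 < c,
    forall q, (forall r, `|q r| <= c) ->
      consists_of_at_most_intervals 4 (l2_spectrum (op q)) /\
      (odd p1.+1 || odd p2.+1 -> consists_of_at_most_intervals 2 (l2_spectrum (op q)))
  & forall eps : R, 0 < eps -> exists delta : R, [/\ 0 < delta, delta <= c &
      forall q, (forall r, `|q r| <= delta) ->
      forall G : set R, is_gap (l2_spectrum (op q)) G ->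
        exists2 E : R, E \in [:: -1; 0; 1] /\ (odd p1.+1 || odd p2.+1 -> E = 0) &
          G `<=` `]E - eps, E + eps[%classic]].
Proof.
have [m0 [M0 mM0]] := band_range (fun _ : cell => 0 : R).
pose kappa := \big[Num.min/1]_(k < n | m0 k.+1 < M0 k) (M0 k - m0 k.+1).
have kappa0 : 0 < kappa by rewrite lt_bigmin// => k; rewrite subr_gt0.
pose N2 : R := (#|{: cell}| * #|{: cell}|)%:R.
have N20 : 0 < N2 by rewrite ltr0n muln_gt0 ncell_gt0.
have touch c q m M k : c <= kappa / (4 * N2) -> (forall r, `|q r| <= c) ->
    band_bounds q m M -> (k < n)%N -> M k < m k.+1 ->
    [/\ M0 k <= m0 k.+1, M0 k <= M k + N2 * c & m k.+1 <= m0 k.+1 + N2 * c].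
  move=> hc qc mM kn gap.
  have d1 (r : cell) : `|0 - q r| <= c by rewrite sub0r normrN.
  have d2 (r : cell) : `|q r - 0| <= c by rewrite subr0.
  have [_ h1] := bounds_perturb (ltnW kn) mM0 mM d1.
  have [h2 _] := bounds_perturb kn mM0 mM d1.
  split=> //; rewrite leNgt; apply/negP => over.
  have hk : kappa <= M0 k - m0 k.+1 by exact: (bigmin_le_cond 1 (j := Ordinal kn)).
  have : N2 * c <= kappa / 4.
    by rewrite invfM mulrA ler_pdivlMr// mulrC in hc.
  rewrite -/N2 in h1 h2; clear -h1 h2 hk gap kappa0 => ?; lra.
exists (kappa / (4 * N2)); split.
- by rewrite divr_gt0// mulr_gt0.
- move=> q qc; have [m [M mM]] := band_range q.
  have [c3 c1] := free_touch_count mM0 (P := fun k => M k < m k.+1)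
    (fun k kn gap => let: And3 h _ _ := touch _ _ _ _ _ (lexx _) qc mM kn gap in h).
  have hm k : (k < n)%N -> m k <= m k.+1.
    by move=> kn; apply: (bounds_min mM); rewrite leqnSn.
  have hM k : (k < n)%N -> M k <= M k.+1.
    by move=> kn; apply: (bounds_max mM); rewrite leqnSn.
  rewrite (spectrum_bands mM); split=> [|od]; apply: consists_of_bands => //;
    by [exact: (bounds_le mM)|exact: c1].
move=> eps eps0; exists (Num.min (kappa / (4 * N2)) (eps / N2)); split.
- by rewrite lt_min !divr_gt0// mulr_gt0.
- by rewrite ge_min lexx.
move=> q qd G Ggap; have [m [M mM]] := band_range q.
have [k [kn gap GI]] := gap_between (spectrumP mM) (bounds_le mM) (bounds_min mM)
  (bounds_max mM) Ggap.
have dk : Num.min (kappa / (4 * N2)) (eps / N2) <= kappa / (4 * N2).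
  by rewrite ge_min lexx.
have [h0 h1 h2] := touch _ _ _ _ _ dk qd mM kn gap.
exists (M0 k); first by apply: (free_touch mM0 kn); rewrite lexx.
have e0 := free_touch_eq mM0 kn h0.
have : N2 * Num.min (kappa / (4 * N2)) (eps / N2) <= eps.
  by rewrite mulrC -ler_pdivlMr// ge_min lexx orbT.
move=> le1 x /GI /=; rewrite !in_itv /= => /andP[x1 x2].
by rewrite -e0 in h2; apply/andP; split; lra.
Qed.

End Bands.

Section Transport.
Variables (R : realType) (V W : choiceType) (g : W -> V) (h : V -> W).
Hypotheses (gK : cancel g h) (hK : cancel h g).

Lemma l2_sqnorm_comp (psi : V -> R[i]) : l2_sqnorm (psi \o g) = l2_sqnorm psi.
Proof.
rewrite /l2_sqnorm [RHS](@reindex_esum _ _ _ [set: W] [set: V] g)//.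
split=> // [x y _ _ /(can_inj gK)//|v _].
by exists (h v).
Qed.

Lemma resolvent_transport (T : (V -> R[i]) -> V -> R[i]) (T' : (W -> R[i]) -> W -> R[i]) :
    (forall phi u, T' phi u = T (phi \o h) (g u)) ->
  l2_resolvent_set T `<=` l2_resolvent_set T'.
Proof.
move=> TT' z [S [S2 Slin [B SB]] SK].
have gh phi : (phi \o h) \o g = phi :> (W -> R[i]).
  by apply/funext => u /=; rewrite gK.
have hg psi : (psi \o g) \o h = psi :> (V -> R[i]).
  by apply/funext => u /=; rewrite hK.
have h2 (phi : W -> R[i]) : in_l2 phi -> in_l2 (phi \o h).
  by rewrite /in_l2 -(l2_sqnorm_comp (phi \o h)) gh.
exists (fun phi => S (phi \o h) \o g).
  split.
  - by move=> phi /h2/S2; rewrite /in_l2 l2_sqnorm_comp.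
  - by move=> a psi phi /h2 psi2 /h2 phi2 u; exact: (Slin a _ _ psi2 phi2 (g u)).
  - exists B => phi /h2/SB; rewrite /l2_norm l2_sqnorm_comp.
    by rewrite -(l2_sqnorm_comp (phi \o h)) gh.
move=> phi /h2 phi2 u; have [e1 e2] := SK _ phi2 (g u); split.
  by rewrite TT' hg e1 /= gK.
transitivity (phi (h (g u))); last by rewrite gK.
rewrite -[RHS]e2 /=; congr (S _ (g u)); apply/funext => v /=.
by rewrite TT' hK.
Qed.

End Transport.

Lemma spectrum_transport (R : realType) (V W : choiceType) (g : W -> V) (h : V -> W)
    (T : (V -> R[i]) -> V -> R[i]) (T' : (W -> R[i]) -> W -> R[i]) :
    cancel g h -> cancel h g -> (forall psi u, T' (psi \o g) u = T psi (g u)) ->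
  l2_spectrum T = l2_spectrum T'.
Proof.
move=> gK hK TT'; congr (~` _); apply/seteqP; split.
  apply: (resolvent_transport gK hK) => phi u; rewrite -TT'; congr (T' _ u).
  by apply/funext => v /=; rewrite gK.
by apply: (resolvent_transport hK gK) => psi v; rewrite TT' hK.
Qed.

Lemma hexagon_eq (x y : int) : x ^+ 2 + x * y + y ^+ 2 + x + y = 0 <->
  [\/ x = 0 /\ y = 0, x = -1 /\ y = 0 | x = 0 /\ y = -1].
Proof.
split=> [e|[] [-> ->] //].
have x1 : (x + 1) ^+ 2 <= 1 by nia.
have y1 : (y + 1) ^+ 2 <= 1 by nia.
have [hx1 hx2] : -2 <= x /\ x <= 0 by nia.
have [hy1 hy2] : -2 <= y /\ y <= 0 by nia.
have {hx1 hx2} [|[|]] : x = 0 \/ x = -1 \/ x = -2 by lia.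
all: have {hy1 hy2} [|[|]] : y = 0 \/ y = -1 \/ y = -2 by lia.
all: by move=> yE xE; move: e; rewrite xE yE // => _;
  by [constructor 1|constructor 2|constructor 3].
Qed.

Section Lattice.
Variable R : realType.
Local Notation site := (int * int * bool)%type.
Implicit Types u v : site.

Definition hex_point (u : site) : R * R :=
  (if u.2 then hex_a1 R else 0) + hex_bp R *~ u.1.1 + hex_bm R *~ u.1.2.

Lemma hex_point_in u : hex_set (hex_point u).
Proof.
case: u => -[n m] []; [right|left]; exists (n, m) => //.
by rewrite /hex_point /= add0r.
Qed.

Definition hexv (u : site) : hex_vertex R := SigSub (mem_set (hex_point_in u)).

Lemma hexv_surj (v : hex_vertex R) : exists u, hexv u = v.
Proof.
case: v => x hx; have := set_mem hx; case=> -[[n m] _ e].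
  by exists (n, m, false); apply: val_inj; rewrite /= /hex_point /= add0r.
by exists (n, m, true); apply: val_inj.
Qed.

Definition abscissa u : int := 3 * (u.1.1 + u.1.2) + u.2%:Z *+ 2.

Lemma hex_pointE u : hex_point u =
  ((abscissa u)%:~R / 2, Num.sqrt 3 / 2 * (u.1.1 - u.1.2)%:~R).
Proof.
rewrite /hex_point /abscissa; case: u => -[n m] b /=.
rewrite [LHS]surjective_pairing /= !raddfD /= !(raddfMz fst) !(raddfMz snd) /=.
have mz (x : R) k : x *~ k = k%:~R * x by rewrite mulrzl.
rewrite (mz (3 / 2)) (mz (3 / 2)) (mz (_ / 2)) (mz (- _)).
by case: b => /=; congr pair; field.
Qed.

Lemma hexv_inj : injective hexv.
Proof.
move=> u v /(congr1 val) /=; rewrite !hex_pointE => -[].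
have s3 : Num.sqrt (3 : R) / 2 != 0 by rewrite mulf_neq0// sqrtr_eq0 -ltNge.
have n2 : (2^-1 : R) != 0 by rewrite invr_neq0.
move=> /(mulIf n2) /intr_inj e1 /(mulfI s3) /intr_inj e2.
move: e1 e2; case: u v => -[n m] b [[n' m'] b'] /=; rewrite /abscissa /= => e1 e2.
have -> : b = b' by case: b b' e1 => -[] //=; lia.
by congr (_, _, _); lia.
Qed.

Lemma hex_adjE u v : hex_adj (hexv u) (hexv v) <->
  (abscissa u - abscissa v) ^+ 2 + 3 * ((u.1.1 - u.1.2) - (v.1.1 - v.1.2)) ^+ 2 = 4.
Proof.
have -> : hex_adj (hexv u) (hexv v) = (Defs.edist (hex_point u) (hex_point v) = 1) by [].
rewrite !hex_pointE /Defs.edist /=.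
have -> : forall a b c d : int, (a%:~R / 2 - b%:~R / 2) ^+ 2 +
    (Num.sqrt 3 / 2 * c%:~R - Num.sqrt 3 / 2 * d%:~R) ^+ 2 =
    ((a - b) ^+ 2 + 3 * (c - d) ^+ 2)%:~R / 4 :> R.
  move=> a b c d; rewrite -mulrBr exprMn [(_ / 2) ^+ 2]exprMn sqr_sqrtr//.
  by rewrite !(rmorphD, rmorphM, rmorphXn, rmorphB) /=; field.
set Z : int := _ + 3 * _.
have Z0 : 0 <= Z by rewrite /Z addr_ge0 ?sqr_ge0// mulr_ge0 ?sqr_ge0.
clearbody Z; split=> [h|->]; last by rewrite divff ?sqrtr1.
have : Z%:~R / 4 = 1 :> R.
  have Z4 : 0 <= Z%:~R / 4 :> R by rewrite divr_ge0 ?ler0z.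
  by rewrite -(sqr_sqrtr Z4) h expr1n.
move=> e; apply: (@intr_inj R); rewrite -[LHS](divfK (_ : 4 != 0)) ?e ?mul1r//.
Qed.

Lemma hex_neighbours u v :
  hex_adj (hexv u) (hexv v) <-> v \in [:: nbr1 u; nbr2 u; nbr3 u].
Proof.
rewrite hex_adjE !inE /nbr1 /nbr2 /nbr3 /abscissa.
case: u v => -[n m] b [[n' m'] b'] /=; rewrite !xpair_eqE.
have e1 := hexagon_eq (n - n') (m - m'); have e2 := hexagon_eq (n' - n) (m' - m).
case: b b' => -[] /=; rewrite ?andbF ?andbT ?mul0rn ?addr0.
- by split=> // h; exfalso; lia.
- split=> [h|h].
    by have [f _] := e1; case: (f ltac:(lia)) => -[]; lia.
  by case/or3P: h => /andP[/eqP-> /eqP->]; ring.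
- split=> [h|h].
    by have [f _] := e2; case: (f ltac:(lia)) => -[]; lia.
  by case/or3P: h => /andP[/eqP-> /eqP->]; ring.
- by split=> // h; exfalso; lia.
Qed.
Lemma hex_laplacianE (psi : hex_vertex R -> R[i]) u : hex_laplacian psi (hexv u) =
  psi (hexv (nbr1 u)) + psi (hexv (nbr2 u)) + psi (hexv (nbr3 u)).
Proof.
rewrite /hex_laplacian; pose r := [:: hexv (nbr1 u); hexv (nbr2 u); hexv (nbr3 u)].
have -> : [set v | hex_adj (hexv u) v] = [set` r].
  apply/seteqP; split=> v /=; have [w <-] := hexv_surj v; rewrite hex_neighbours.
    by move=> hw; apply: (map_f hexv hw).
  by rewrite -(mem_map hexv_inj).
rewrite -fsbig_seq; last rewrite (map_inj_uniq hexv_inj [:: nbr1 u; nbr2 u; nbr3 u]).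
  by rewrite !big_cons big_nil /= addr0 addrA.
rewrite /nbr1 /nbr2 /nbr3; case: u @r => -[n m] b /=; rewrite !inE !xpair_eqE !eqxx /=.
by apply/and3P; split=> //; case: b => /=; lia.
Qed.

Lemma hex_translateE (a b : int) u :
  hex_translate a b (hexv u) = hexv (u.1.1 + a, u.1.2 + b, u.2).
Proof.
apply: val_inj; rewrite /= /hex_point /= !mulrzDr.
by rewrite -!addrA; congr (_ + (_ + _)); rewrite addrCA.
Qed.

Lemma periodic_modz (f : int -> R) (p : nat) : (forall n, f (n + p%:Z) = f n) ->
  forall n, f n = f (n %% p%:Z)%Z.
Proof.
move=> fp n; rewrite {1}(divz_eq n p).
have up k i : f (i + p%:Z *+ k) = f i.
  by elim: k i => [|k IH] i; rewrite ?addr0// mulrSr addrA fp.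
case: (n %/ p%:Z)%Z => k.
  by rewrite addrC -[Posz k]natz mulr_natl up.
by rewrite -(up k.+1) addrAC -mulr_natl natz NegzE mulNr addNr add0r.
Qed.

Lemma hex_periodicE p1 p2 (Q : hex_vertex R -> R) u : hex_periodic p1.+1 p2.+1 Q ->
  Q (hexv u) = Q (hexv (val (cellof p1 p2 u).1.1 : int, val (cellof p1 p2 u).1.2 : int, u.2)).
Proof.
move=> hQ; have projE p (k : int) : (val (proj p k))%:Z = (k %% p.+1%:Z)%Z.
  by rewrite /proj /= inordK; lia.
case: u => -[n m] b; rewrite /cellof /= !projE.
rewrite (@periodic_modz (fun n => Q (hexv (n, m, b))) p1.+1) => [|k].
  rewrite (@periodic_modz (fun m => Q (hexv (_, m, b))) p2.+1)// => k.
  by have [_ <-] := hQ (hexv ((n %% p1.+1)%Z, k, b)); rewrite hex_translateE /= addr0.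
by have [<- _] := hQ (hexv (k, m, b)); rewrite hex_translateE /= addr0.
Qed.

Lemma sup_norm_le (V : choiceType) (Q : V -> R) c (x : V) : (sup_norm Q <= c%:E)%E -> `|Q x| <= c.
Proof.
by move=> hc; rewrite -lee_fin (le_trans _ hc)// /sup_norm; apply: ereal_sup_ubound; exists x.
Qed.

Lemma hex_spectrumE p1 p2 (Q : hex_vertex R -> R) : hex_periodic p1.+1 p2.+1 Q ->
  exists2 q : 'I_p1.+1 * 'I_p2.+1 * bool -> R,
    (forall r, exists x, q r = Q x) & l2_spectrum (hex_schrodinger Q) = l2_spectrum (op q).
Proof.
move=> hQ; pose q (r : 'I_p1.+1 * 'I_p2.+1 * bool) :=
  Q (hexv ((r.1.1 : nat)%:Z, (r.1.2 : nat)%:Z, r.2)).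
exists q; first by move=> r; eexists.
have [h hK] := choice hexv_surj.
apply: (@spectrum_transport _ _ _ hexv h) => // [u|psi u].
  by apply: hexv_inj; rewrite hK.
rewrite /op /hex_schrodinger hex_laplacianE (hex_periodicE _ hQ); congr (_ + _).
Qed.

End Lattice.

Theorem theorem1p3 (R : realType) (p1 p2 : nat)
    (hp1 : (0 < p1)%N) (hp2 : (0 < p2)%N) :
  exists c : R, [/\ 0 < c,
    forall Q : hex_vertex R -> R,
      hex_periodic p1 p2 Q -> (sup_norm Q <= c%:E)%E ->
      consists_of_at_most_intervals 4 (l2_spectrum (hex_schrodinger Q)) /\
      (odd p1 || odd p2 ->
       consists_of_at_most_intervals 2 (l2_spectrum (hex_schrodinger Q)))
  & forall eps : R, 0 < eps ->
    exists delta : R, [/\ 0 < delta, delta <= c &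
      forall Q : hex_vertex R -> R,
        hex_periodic p1 p2 Q -> (sup_norm Q <= delta%:E)%E ->
        forall G : set R, is_gap (l2_spectrum (hex_schrodinger Q)) G ->
          (exists2 E : R, E \in [:: -1; 0; 1] & G `<=` `]E - eps, E + eps[%classic) /\
          (odd p1 || odd p2 -> G `<=` `]- eps, eps[%classic)]].
Proof.
case: p1 p2 hp1 hp2 => [//|p1] [//|p2] _ _.
have [c [c0 few gaps]] := @op_spectrum_main R p1 p2.
have bnd (Q : hex_vertex R -> R) (q : 'I_p1.+1 * 'I_p2.+1 * bool -> R) d :
    (forall r, exists x, q r = Q x) -> (sup_norm Q <= d%:E)%E -> forall r, `|q r| <= d.
  by move=> qQ Qd r; have [v ->] := qQ r; exact: sup_norm_le.
exists c; split=> // [Q /hex_spectrumE[q qQ ->] Qc|eps eps0].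
  by apply: few; exact: bnd Qc.
have [d [d0 dc hd]] := gaps eps eps0; exists d; split=> // Q /hex_spectrumE[q qQ ->] Qd G Gg.
have [E [EI E0] GE] := hd q (bnd _ _ _ qQ Qd) G Gg; split; first by exists E.
by move=> /E0 e x /GE; rewrite e !add0r.
Qed.
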